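(* Let $G$ be a planar graph of girth at least $10$, let $C$ be a $5$-cycle, and let $v_1,v_2\in V(G)$ and $c_1,c_2\in V(C)$ be arbitrary vertices. Then $G$ has a homomorphism $\psi$ to $C$ such that $\psi(v_1)=c_1$ and $\psi(v_2)=c_2$ if and only if $(c_1,c_2)$ is plausible for $(v_1,v_2)$.
   Context: All graphs are finite and simple. A homomorphism from $G$ to $H$ is a function $f:V(G)\to V(H)$ such that $f(u)f(v)\in E(H)$ for every $uv\in E(G)$. The girth of a graph is the length of its shortest cycle (infinite if there is no cycle). Given a graph $G$, a $5$-cycle $C$, vertices $v_1,v_2\in V(G)$ and $c_1,c_2\in V(C)$, the pair $(c_1,c_2)$ is plausible for $(v_1,v_2)$ if one of the following holds: (i) $v_1=v_2$ and $c_1=c_2$; or (ii) $v_1v_2\in E(G)$ and $c_1c_2\in E(C)$; or (iii) the distance between $v_1$ and $v_2$ in $G$ is exactly two, and $c_1$ is not adjacent to $c_2$ in $C$; or (iv) the distance between $v_1$ and $v_2$ in $G$ is exactly three, and $c_1\neq c_2$; or (v) the distance between $v_1$ and $v_2$ in $G$ is at least four (including the case that $v_1,v_2$ lie in different components). *)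

(* Defs.v *)
From mathcomp Require Import all_boot all_order all_algebra.
From mathcomp Require Import all_classical all_reals all_analysis.
Import Order.TTheory GRing.Theory Num.Theory.
Import numFieldNormedType.Exports.

Set Implicit Arguments.
Unset Strict Implicit.
Unset Printing Implicit Defensive.

Local Open Scope classical_set_scope.
Local Open Scope ring_scope.

Record sgraph := SGraph {
  vertex :> finType;
  edge : rel vertex;
  edge_sym : symmetric edge;
  edge_irrefl : irreflexive edge
}.

Arguments edge {s} : rename.

Definition homomorphism (G H : sgraph) (f : G -> H) : Prop :=
  forall u v : G, edge u v -> edge (f u) (f v).

(* The bound 2 < size c excludes the sequences [:: x; y] with x, y adjacent,
   which satisfy [path.cycle edge] but are not cycles of a simple graph. *)
Definition is_cycle (G : sgraph) (c : seq G) : bool :=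
  [&& cycle edge c, uniq c & (2 < size c)%N].

(* The length of the shortest cycle is at least g; true of every g when there
   is no cycle, i.e. when the girth is infinite. *)
Definition girth_at_least (G : sgraph) (g : nat) : Prop :=
  forall c : seq G, is_cycle c -> (g <= size c)%N.

(* C is itself a cycle of length n: some cyclic sequence c lists its vertices
   once each, and its edges are exactly the pairs of consecutive entries. *)
Definition is_cycle_graph (C : sgraph) (n : nat) : Prop :=
  exists c : seq C,
    [/\ is_cycle c, size c = n, (forall x : C, x \in c) &
        forall x y : C, edge x y = (y == next c x) || (x == next c y)].

(* [:: u & p] is a walk from u to v, of length [size p]. *)
Definition is_walk (G : sgraph) (u v : G) (p : seq G) : bool :=
  path edge u p && (last u p == v).

(* Vacuously true when u and v lie in different components. *)
Definition dist_at_least (G : sgraph) (u v : G) (k : nat) : Prop :=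
  forall p : seq G, is_walk u v p -> (k <= size p)%N.

Definition dist_exactly (G : sgraph) (u v : G) (k : nat) : Prop :=
  (exists2 p : seq G, is_walk u v p & size p = k) /\ dist_at_least u v k.

Definition plausible (G C : sgraph) (v1 v2 : G) (c1 c2 : C) : Prop :=
  (v1 = v2 /\ c1 = c2) \/
  (edge v1 v2 /\ edge c1 c2) \/
  (dist_exactly v1 v2 2 /\ ~ edge c1 c2) \/
  (dist_exactly v1 v2 3 /\ c1 <> c2) \/
  dist_at_least v1 v2 4.

(* A drawing of G in the plane R * R: u is drawn as the point [pos u], and the
   edge uv as the simple arc parametrized on [0, 1] by [arc u v], which is
   traversed backwards by [arc v u]. *)
Record plane_drawing (R : realType) (G : sgraph)
    (pos : G -> R * R) (arc : G -> G -> R -> R * R) : Prop := PlaneDrawing {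
  pos_inj : injective pos;
  arc_rev : forall (u v : G) (t : R), edge u v -> arc v u t = arc u v (1 - t);
  arc_start : forall u v : G, edge u v -> arc u v 0 = pos u;
  arc_end : forall u v : G, edge u v -> arc u v 1 = pos v;
  arc_continuous : forall u v : G, edge u v ->
    {within `[0, 1], continuous (arc u v)};
  arc_inj : forall u v : G, edge u v -> {in `[0, 1] &, injective (arc u v)};
  arc_avoids_vertices : forall (u v w : G) (t : R), edge u v ->
    t \in `]0, 1[ -> arc u v t <> pos w;
  arc_disjoint : forall (u v x y : G) (s t : R), edge u v -> edge x y ->
    (u, v) <> (x, y) -> (u, v) <> (y, x) ->
    s \in `]0, 1[ -> t \in `]0, 1[ -> arc u v s <> arc x y t
}.

Definition planar (R : realType) (G : sgraph) : Prop :=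
  exists (pos : G -> R * R) (arc : G -> G -> R -> R * R),
    plane_drawing pos arc.

(* Main.v *)
Require Import Defs.
From mathcomp Require Import all_boot all_order all_algebra.
From mathcomp Require Import zify ring lra.

(* Sparsity comes from Euler's formula: a drawing, approximated on a fine grid, represents
   the vertices by disjoint connected sets of grid points, adjacent for adjacent
   vertices; over F_2 every even set of edges is a sum of face boundaries. With
   girth 10 this gives 5 |S| - 4 e(S) >= min(10, |S| + 4) for every nonempty S.

   This lets one extend a colouring of {v1, v2} (or of a shortest path from v1 to v2,
   of length at most 3) to G. Contracting the precoloured part leads to graphs
   whose edges forbid 1, 2 or 3 consecutive differences in Z5, at cost 2, 3 or 4.
   If every nonempty R has potential 5 |R| - cost(R) >= 3, parallel edges forbid
   at most 4 differences and no triangle consists of weight 3 edges, a colouring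
   exists. In a minimal counterexample, proper subsets with at least two vertices
   have potential >= 6, so one may delete a vertex and add a constraining edge
   (gadget) that leaves the vertex a free colour. This excludes all vertices of
   cost below 10 except those with three weight 2 edges, and constrains the
   neighbours of these; discharging then makes the total potential nonpositive. *)

Set Implicit Arguments. Unset Strict Implicit. Unset Printing Implicit Defensive.
Import Order.TTheory GRing.Theory Num.Theory.
Local Open Scope ring_scope.

(** * Colourings of gain graphs over Z5 *)

(** All edges of [G] have weight 3, but the induction leaves that class: collapsing a coloured set
    creates parallel edges with different gains, and a deleted vertex may be replaced by an edge of
    smaller weight. Hence arbitrary gains, and a cost exceeding the weight by one, so that several
    light edges are dearer than one heavy edge forbidding as much. The bound 3 is what collapsing
    tolerates. Collapsing [R] turns the potential of a set [R'] containing it into that of [R']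
    minus that of [R] plus 5; in the worst case, two vertices at distance at least 4, [R] has
    potential 10 and a set of four or more vertices possibly only 8. Potential at least 3 makes the
    sum of cost minus 10 over all vertices at most -6, so vertices of cost below 10 must exist. The
    obstacle is the type (2,2,2), of cost 9: it is not reducible by itself, only beside certain
    neighbours, and most of the case analysis shows that its other neighbours are rich enough to pay
    for it. *)

Notation Z5 := 'I_5.

Section GainGraphs.
Variable V : finType.

(* The edge (x, y, (g, k)) forbids the k consecutive values g, ..., g + k - 1
   of f y - f x. Scaling Z5 so that the neighbours of 0 in the 5-cycle are 2
   and 3, an edge of G becomes an edge with g = 4 and k = 3. *)

Definition gedge := (V * V * (Z5 * nat))%type.
Implicit Types (e : gedge) (L : seq gedge) (S R A B : {set V}) (f : V -> Z5).

Definition src e := e.1.1.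
Definition tgt e := e.1.2.
Definition gain e := e.2.1.
Definition wt e := e.2.2.

(** The difference is read as its representative in 0, ..., 4, so one comparison says that it avoids
    the [wt e] values starting at [gain e]. *)
Definition sat f e := (wt e <= (f (tgt e) - f (src e) - gain e)%R)%N.
Definition inside S e := (src e \in S) && (tgt e \in S).
Definition pcol f S L := all (fun e => inside S e ==> sat f e) L.
Definition colorable S L := exists f, pcol f S L.

Definition cost S L : nat := \sum_(e <- L | inside S e) (wt e).+1.
Definition pot L S : int := (5 * #|S|)%:Z - (cost S L)%:Z.

Definition cross A B e :=
  ((src e \in A) && (tgt e \in B)) || ((src e \in B) && (tgt e \in A)).
Definition kap L A B : nat := \sum_(e <- L | cross A B e) wt e.
Definition cst L A B : nat := \sum_(e <- L | cross A B e) (wt e).+1.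
Definition has3 L A B := has (fun e => cross A B e && (wt e == 3%N)) L.

Definition weighted L := all (fun e => (0 < wt e <= 3)%N) L.

(** [sp_kap] and [sp_tri] exclude small instances that may be uncolourable although the potential
    admits them: parallel edges of weights 3 and 2, and a triangle of three edges of weight 3, both
    have potential 3. *)
Record sparse S L : Prop := Sparse {
  sp_wt : weighted L;
  sp_loop : all (fun e => inside S e ==> (src e != tgt e)) L;
  sp_pot : forall R, R \subset S -> R != set0 -> 3 <= pot L R;
  sp_kap : forall x y, x \in S -> y \in S -> x != y ->
    (kap L [set x] [set y] <= 4)%N;
  sp_tri : forall x y z, x \in S -> y \in S -> z \in S ->
    x != y -> y != z -> x != z ->
    ~~ [&& has3 L [set x] [set y], has3 L [set y] [set z]
         & has3 L [set x] [set z]] }.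

Lemma crossC A B e : cross A B e = cross B A e.
Proof. by rewrite /cross orbC. Qed.

Lemma kapC L A B : kap L A B = kap L B A.
Proof. by apply: eq_bigl => e; rewrite crossC. Qed.

Lemma cstC L A B : cst L A B = cst L B A.
Proof. by apply: eq_bigl => e; rewrite crossC. Qed.

Lemma has3C L A B : has3 L A B = has3 L B A.
Proof. by apply: eq_has => e; rewrite crossC. Qed.

(** The ratio of weight to cost, [k / (k + 1)], is at most 3/4 for [k <= 3]. *)
Lemma kap_cst L A B : weighted L -> (4 * kap L A B <= 3 * cst L A B)%N.
Proof.
move=> wL; rewrite /kap /cst !big_distrr /= big_seq_cond [leqRHS]big_seq_cond.
apply: leq_sum => e /andP[eL _]; move/allP: wL => /(_ e eL); lia.
Qed.

Lemma has3_cst L A B : has3 L A B -> (4 <= cst L A B)%N.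
Proof.
elim: L => //= e L IH; rewrite /cst big_cons.
case/orP => [/andP[-> /eqP ->]|/IH]; first by lia.
by rewrite -/(cst L A B); case: ifP; lia.
Qed.

Lemma pot_addv L S v : v \notin S ->
  all (fun e => ~~ ((src e == v) && (tgt e == v))) L ->
  pot L (v |: S) = pot L S + 5 - (cst L [set v] S)%:Z.
Proof.
move=> vS nl; rewrite /pot cardsU1 vS.
suff -> : cost (v |: S) L = (cost S L + cst L [set v] S)%N by lia.
elim: L nl => [|e L IH] /=; first by rewrite /cost /cst !big_nil.
case/andP=> nle /IH; rewrite /cost /cst !big_cons => ->.
rewrite /inside /cross !inE.
move: nle; case: (eqVneq (src e) v) => [->|_] /=; case: (eqVneq (tgt e) v) => [->|_] //=;
  rewrite ?(negbTE vS) ?andbF ?andbT ?orbF //=; case: ifP; lia.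
Qed.

Lemma sparse_sub S R L : R \subset S -> sparse S L -> sparse R L.
Proof.
move=> sRS [wL nl hp hk ht]; move/subsetP: (sRS) => sRS'; split => //.
- apply/allP => e /(allP nl); rewrite /inside.
  move/implyP=> h; apply/implyP=> /andP[/sRS' h1 /sRS' h2]; apply: h; rewrite h1; exact: h2.
- by move=> R' sR' n0; apply: hp => //; apply: subset_trans sRS.
- by move=> x y /sRS' ? /sRS' ?; apply: hk.
- by move=> x y z /sRS' ? /sRS' ? /sRS' ?; apply: ht.
Qed.

(* R, coloured by phi, is contracted to x0; the gains are shifted so that
   colourings of the quotient correspond to those extending phi up to a constant. *)
Section Quotient.
Variables (R : {set V}) (x0 : V) (phi : V -> Z5) (L : seq gedge).
Hypothesis x0R : x0 \in R.

Definition qv y := if y \in R then x0 else y.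
Definition qshift y := if y \in R then phi y - phi x0 else 0 : Z5.
Definition qe e : gedge :=
  (qv (src e), qv (tgt e), (gain e - qshift (tgt e) + qshift (src e), wt e)).
Definition qL := [seq qe e | e <- L & ~~ inside R e].

Lemma qvE S y : x0 \notin S -> (qv y \in S) = (y \in S :\: R).
Proof.
by move=> x0S; rewrite /qv inE; case: (y \in R) => //=; apply: negbTE.
Qed.

Lemma qv_in S y : x0 \in S -> (qv y \in S) = (y \in R :|: S).
Proof.
by move=> x0S; rewrite /qv inE; case: (y \in R) => //=.
Qed.

Lemma pot_q0 (W : {set V}) : [disjoint W & R] -> pot qL W = pot L W.
Proof.
move=> dW; have x0W : x0 \notin W by rewrite (disjointFl dW).
rewrite /pot; congr (_ - _%:Z); rewrite /cost /qL big_map big_filter_cond.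
apply: eq_bigl => e; rewrite /inside /= !qvE // (setDidPl dW) /=.
case sW: (src e \in W); rewrite ?andbF //=.
by rewrite (disjointFr dW sW).
Qed.

(** The set is read as its union with [R]; the edges inside [R] disappear and [R] itself counts as
    one vertex, worth 5. *)
Lemma pot_q1 (W : {set V}) : x0 \in W -> W :&: R \subset [set x0] ->
  pot qL W = pot L (R :|: W) - pot L R + 5.
Proof.
move=> x0W WR; have WRE : W :&: R = [set x0].
  by apply/eqP; rewrite eqEsubset WR sub1set inE x0W.
have cU : (#|R :|: W| + 1 = #|R| + #|W|)%N.
  by have := cardsUI R W; rewrite [R :&: W]setIC WRE cards1.
have cE : (cost W qL + cost R L = cost (R :|: W) L)%N.
  rewrite /cost /qL big_map big_filter_cond addnC.
  rewrite [RHS](bigID (inside R)) /=; congr (_ + _)%N.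
    apply: eq_bigl => e; rewrite /inside !inE.
    by case: (src e \in R) (tgt e \in R) => [] [] //=; rewrite ?andbF.
  by apply: eq_bigl => e; rewrite andbC /inside /= !qv_in.
rewrite /pot; move: cU cE; lia.
Qed.

Lemma cross_qe0 y z e : y \notin R -> z \notin R ->
  cross [set y] [set z] (qe e) = cross [set y] [set z] e.
Proof.
move=> yR zR; rewrite /cross /= !qvE ?inE; try by apply: contraNneq yR => <-.
  all: try by apply: contraNneq zR => <-.
have h (w : V) : w \notin R -> forall t, (t \notin R) && (t == w) = (t == w).
  by move=> wR t; case: (eqVneq t w) => [->|]; rewrite ?andbF // wR.
by rewrite !h.
Qed.

Lemma cross_qe1 y e : y \notin R ->
  cross [set y] [set x0] (qe e) = cross [set y] R e.
Proof.
move=> yR; have nyx : x0 != y by apply: contraNneq yR => <-.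
have h t : (qv t == y) = (t == y).
  rewrite /qv; case: ifP => // tR; rewrite (negbTE nyx).
  by apply/esym; apply: contraNF yR => /eqP <-.
have h' t : (qv t == x0) = (t \in R).
  rewrite /qv; case: ifP => [|tR]; first by rewrite eqxx.
  by apply: contraFF tR => /eqP ->.
by rewrite /cross /= !inE !h !h'.
Qed.

Lemma cross_ninside y A e : y \notin R -> cross [set y] A e -> ~~ inside R e.
Proof.
by move=> yR; rewrite /cross /inside !inE => /orP[/andP[/eqP -> _]|/andP[_ /eqP ->]];
  rewrite (negbTE yR) ?andbF.
Qed.

Lemma kap_q y A B : y \notin R ->
  (forall e, cross [set y] A (qe e) = cross [set y] B e) ->
  kap qL [set y] A = kap L [set y] B.
Proof.
move=> yR h; rewrite /kap /qL big_map big_filter_cond.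
apply: eq_bigl => e; rewrite h andbC.
by case c: (cross _ _ _); rewrite ?andbF // (cross_ninside yR c).
Qed.

Lemma has3_q y A B : y \notin R ->
  (forall e, cross [set y] A (qe e) = cross [set y] B e) ->
  has3 qL [set y] A = has3 L [set y] B.
Proof.
move=> yR h; rewrite /has3 /qL has_map; apply/hasP/hasP => -[e].
  by rewrite mem_filter => /andP[_ eL] /=; rewrite h => c; exists e.
move=> eL /andP[c k]; exists e => /=; last by rewrite h c.
by rewrite mem_filter eL (cross_ninside yR c).
Qed.

(** Translating a colouring changes no difference, so the one of the quotient may be shifted to
    agree with [phi] at [x0]; the gains of the quotient were chosen to make the two parts fit. *)
Lemma qe_lift S f : R \subset S ->
  pcol phi R L -> pcol f (x0 |: (S :\: R)) qL ->
  pcol (fun y => if y \in R then phi y else f y - f x0 + phi x0) S L.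
Proof.
move=> RS /allP pphi /allP pf; apply/allP => e eL; apply/implyP => eS.
have [eR|neR] := boolP (inside R e).
  have := pphi e eL; rewrite eR /= /sat.
  by case/andP: eR => -> ->.
have := pf (qe e); rewrite map_f ?mem_filter ?neR // => /(_ isT) /implyP h.
move: h; rewrite /inside /= !qv_in ?setU11 // !inE.
have inR t : t \in S -> (t \in R) || ((t == x0) || (t \notin R) && (t \in S)).
  by move=> ->; case: (t \in R); rewrite ?orbT.
case/andP: eS => /inR -> /inR -> /(_ isT).
have -> : sat f (qe e) = (wt e <= (f (qv (tgt e)) - f (qv (src e)) -
  (gain e - qshift (tgt e) + qshift (src e)))%R)%N by [].
rewrite /sat /qv /qshift.
move: neR; rewrite /inside; case: ifP => sR; case: ifP => tR // _ h;
  apply: etrans h; congr (leq _ (nat_of_ord _)); ring.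
Qed.

End Quotient.

End GainGraphs.

(** * Extending a colouring from a collapsed set; half-edges and arcs of forbidden colours *)

#[local] Arguments nat_of_ord : simpl never.

Section Extension.
Variable V : finType.
Implicit Types (e : gedge V) (L : seq (gedge V)) (S R A B : {set V}) (f : V -> Z5).

(** The quotient by [R] is coloured by [IH]. The last three hypotheses are the conditions of
    [sparse] at the collapsed vertex; the slack 2 gives potential at least 5 - 2 = 3. The bound [n]
    stays abstract because it is the size of a minimal counterexample at first, and any large number
    once all sparse instances are known to be colourable. *)
Lemma extend L R S x0 (phi : V -> Z5) n :
  (forall S' L', (#|S'| < n)%N -> sparse S' L' -> colorable S' L') ->
  x0 \in R -> R \subset S -> (#|S :\: R|.+1 < n)%N ->
  pcol phi R L -> sparse (S :\: R) L ->
  (forall R', R \proper R' -> R' \subset S -> pot L R - 2 <= pot L R') ->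
  (forall y, y \in S :\: R -> (kap L [set y] R <= 4)%N) ->
  (forall y z, y \in S :\: R -> z \in S :\: R -> y != z ->
     ~~ [&& has3 L [set y] [set z], has3 L [set y] R & has3 L [set z] R]) ->
  exists f, pcol f S L /\ {in R, f =1 phi}.
Proof.
move=> IH x0R RS cS pphi sp hpot hkap htri.
have [f pf] : colorable (x0 |: (S :\: R)) (qL R x0 phi L).
  have notR y : y \in x0 |: (S :\: R) -> y != x0 -> y \in S :\: R.
    by rewrite in_setU1 => /orP[->|].
  have nR y : y \in S :\: R -> y \notin R by rewrite inE => /andP[].
  have x0nD : x0 \notin S :\: R by rewrite inE x0R.
  have [wL nl hp hk ht] := sp.
  apply: IH; first by rewrite cardsU1 x0nD.
  split.
  - by apply/allP => e' /mapP[e]; rewrite mem_filter => /andP[_ /(allP wL)] ? ->.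
  - apply/allP => e' /mapP[e]; rewrite mem_filter => /andP[nin eL] ->.
    apply/implyP; rewrite /inside /qe /src /tgt /=.
    rewrite !qv_in ?setU11 // => /andP[h1 h2].
    move: nin h1 h2; rewrite /inside /qv -/(src e) -/(tgt e).
    case: ifP => [sR|snR]; case: ifP => [tR|tnR] //= _.
    + move=> _ _; by apply: contraFneq tnR => <-.
    + move=> _ _; by apply: contraFneq snR => ->.
    rewrite !inE snR tnR /=.
    have nx0 t : (t \in R) = false -> (t == x0) = false.
      by move=> tR; apply: contraFF tR => /eqP->.
    rewrite !nx0 //= => h1 h2.
    by have /implyP := allP nl _ eL; apply; rewrite /inside !inE snR tnR h1.
  - move=> W WS W0; have [x0W|x0W] := boolP (x0 \in W); last first.
      have WD : W \subset S :\: R.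
        apply/subsetP => y yW; apply: notR; first exact: (subsetP WS).
        by apply: contraNneq x0W => <-.
      rewrite pot_q0 //; first exact: hp.
      by rewrite disjoint_subset; apply/subsetP => y /(subsetP WD) /nR.
    rewrite pot_q1 //; last first.
      apply/subsetP => y; rewrite in_setI => /andP[/(subsetP WS) yW yR].
      rewrite in_set1; apply: contraLR yR => yx; exact: nR _ (notR _ yW yx).
    have [->|RU] := eqVneq (R :|: W) R; first by lia.
    have := hpot (R :|: W) _ _; rewrite properEneq eq_sym RU subsetUl => /(_ isT).
    have -> : R :|: W \subset S.
      rewrite subUset RS; apply: subset_trans WS _.
      by rewrite subUset sub1set (subsetP RS) //= subsetDl.
    by move=> /(_ isT); lia.
  - have q0 y z : y \in S :\: R -> z \in S :\: R ->
        kap (qL R x0 phi L) [set y] [set z] = kap L [set y] [set z].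
      by move=> yD zD; apply: kap_q; rewrite ?nR // => e; rewrite cross_qe0 ?nR.
    have q1 y : y \in S :\: R ->
        kap (qL R x0 phi L) [set y] [set x0] = kap L [set y] R.
      by move=> yD; apply: kap_q; rewrite ?nR // => e; rewrite cross_qe1 ?nR.
    move=> x y xS yS xy; have [ex|nx] := eqVneq x x0.
      have yD : y \in S :\: R by apply: notR; rewrite // -ex eq_sym.
      by rewrite ex kapC q1 ?hkap.
    have xD := notR _ xS nx.
    have [ey|ny] := eqVneq y x0; first by rewrite ey q1 ?hkap.
    by have yD := notR _ yS ny; rewrite q0 ?hk.
  - have q0 y z : y \in S :\: R -> z \in S :\: R ->
        has3 (qL R x0 phi L) [set y] [set z] = has3 L [set y] [set z].
      by move=> yD zD; apply: has3_q; rewrite ?nR // => e; rewrite cross_qe0 ?nR.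
    have q1 y : y \in S :\: R ->
        has3 (qL R x0 phi L) [set y] [set x0] = has3 L [set y] R.
      by move=> yD; apply: has3_q; rewrite ?nR // => e; rewrite cross_qe1 ?nR.
    move=> x y z xS yS zS xy yz xz.
    have [ex|nx] := eqVneq x x0.
      have yD : y \in S :\: R by apply: notR; rewrite // -ex eq_sym.
      have zD : z \in S :\: R by apply: notR; rewrite // -ex eq_sym.
      rewrite ex (has3C _ [set x0] [set y]) (has3C _ [set x0] [set z]) (q0 y z) // !q1 //.
      by apply: contra (htri y z yD zD yz) => /and3P[-> -> ->].
    have xD := notR _ xS nx.
    have [ey|ny] := eqVneq y x0.
      have zD : z \in S :\: R by apply: notR; rewrite // -ey eq_sym.
      rewrite ey (has3C _ [set x0] [set z]) (q0 x z) // !q1 //.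
      by apply: contra (htri x z xD zD xz) => /and3P[-> -> ->].
    have yD := notR _ yS ny.
    have [ez|nz] := eqVneq z x0.
      rewrite ez (q0 x y) // !q1 //.
      by apply: contra (htri x y xD yD xy) => /and3P[-> -> ->].
    have zD := notR _ zS nz.
    by rewrite !q0 //; apply: ht.
have := qe_lift RS pphi pf; set g := (fun y => _) => pg.
by exists g; split => // y yR; rewrite /g yR.
Qed.

(* A half-edge at v: neighbour, start and length of the arc of forbidden
   colours at v, relative to the colour of the neighbour. *)
Definition hedge := (V * (Z5 * nat))%type.
Implicit Types (h : hedge).

(** The same constraint seen from the other end: negation sends the arc [g, ..., g + k - 1] to the
    arc of length [k] starting at [1 - g - k]. *)
Definition flip (a : Z5 * nat) : Z5 * nat := (1 - a.1 - a.2%:R, a.2).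
Definition hed L v : seq hedge :=
  [seq (src e, e.2) | e <- L & tgt e == v] ++
  [seq (tgt e, flip e.2) | e <- L & src e == v].
Definition nbr h : V := h.1.
Definition hk h : nat := h.2.2.
Definition start f h : Z5 := f (nbr h) + h.2.1.
Definition okh f h (c : Z5) := (hk h <= (c - start f h)%R)%N.

Lemma flipK : involutive flip.
Proof. by case=> g k; rewrite /flip /=; congr pair; ring. Qed.

(** The reflection [d |-> k - 1 - d] maps the arc [0, ..., k - 1] onto itself. *)
Lemma flip_le (d : Z5) k : (0 < k <= 3)%N -> (k <= (k%:R - 1 - d)%R)%N = (k <= d)%N.
Proof. by case: k => [|[|[|[|k]]]] // _; case: d => [[|[|[|[|[|]]]]] Hd]. Qed.

Lemma hed_sym L v h : h \in hed L v -> (v, flip h.2) \in hed L (nbr h).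
Proof.
rewrite !mem_cat => /orP[] /mapP[e]; rewrite mem_filter => /andP[/eqP <- eL] ->; apply/orP.
- by right; apply/mapP; exists e; rewrite // mem_filter eqxx.
- by left; apply/mapP; exists e; rewrite ?mem_filter ?eqxx // flipK; case: e {eL} => [[a b] c].
Qed.

Lemma hed_edge L v h : h \in hed L v -> exists e, [/\ e \in L, cross [set v] [set (nbr h)] e & wt e = hk h].
Proof.
rewrite mem_cat => /orP[] /mapP[e]; rewrite mem_filter => /andP[/eqP ev eL] ->.
- by exists e; split; rewrite // /cross !inE ev !eqxx orbT.
- by exists e; split; rewrite // /cross !inE ev !eqxx.
Qed.

Lemma edge_hed L v e B : e \in L -> cross [set v] B e ->
  exists2 h, h \in hed L v & (nbr h) \in B /\ hk h = wt e.
Proof.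
move=> eL; rewrite /cross !inE => /orP[/andP[ev eB]|/andP[eB ev]].
- exists (tgt e, flip e.2) => //; rewrite mem_cat; apply/orP; right.
  by apply/mapP; exists e; rewrite // mem_filter ev.
- exists (src e, e.2) => //; rewrite mem_cat; apply/orP; left.
  by apply/mapP; exists e; rewrite // mem_filter ev.
Qed.

Lemma hed_sum L v S (F : nat -> nat) : v \notin S ->
  (\sum_(h <- hed L v | (nbr h) \in S) F (hk h) = \sum_(e <- L | cross [set v] S e) F (wt e))%N.
Proof.
move=> vS; rewrite /hed big_cat !big_map !big_filter_cond /=.
rewrite [RHS](bigID (fun e => tgt e == v)) /=; congr (_ + _)%N; apply: eq_bigl => e;
  rewrite /cross !inE.
- case: (eqVneq (tgt e) v) => [->|]; rewrite ?andbF //=.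
  by rewrite (negbTE vS) andbF !andbT.
- case: (eqVneq (tgt e) v) => [->|]; rewrite ?andbF ?andbT ?orbF //=.
  by rewrite (negbTE vS) andbF.
Qed.

Lemma cst_hed L v S : v \notin S -> cst L [set v] S = (\sum_(h <- hed L v | (nbr h) \in S) (hk h).+1)%N.
Proof. by move=> vS; rewrite (hed_sum _ succn). Qed.

Lemma kap_hed L v S : v \notin S -> kap L [set v] S = (\sum_(h <- hed L v | (nbr h) \in S) hk h)%N.
Proof. by move=> vS; rewrite (hed_sum _ id). Qed.

Lemma pcol_addv L f S v c : weighted L -> pcol f S L -> v \notin S ->
  all (fun e => ~~ ((src e == v) && (tgt e == v))) L ->
  (forall h, h \in hed L v -> (nbr h) \in S -> okh f h c) ->
  pcol (fun y => if y == v then c else f y) (v |: S) L.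
Proof.
move=> wL /allP pf vS nl hc; apply/allP => e eL; apply/implyP.
have nS t : t \in S -> (t == v) = false by move=> tS; apply: contraNF vS => /eqP <-.
rewrite /inside !in_setU1; have := allP nl _ eL.
case: (eqVneq (src e) v) => [sv|sv] /=; case: (eqVneq (tgt e) v) => [tv|tv] //= _.
- move=> tS; have /hc : (tgt e, flip e.2) \in hed L v.
    by rewrite mem_cat; apply/orP; right; apply/mapP; exists e; rewrite // mem_filter sv eqxx.
  move=> /(_ tS); rewrite /okh /start /hk /sat sv eqxx (negbTE tv).
  rewrite -[leq (wt e) _](flip_le _ (allP wL _ eL)); apply: etrans; congr (leq _ (nat_of_ord _)).
  by case: (e) => [[a b] [g k]]; rewrite /src /tgt /gain /wt /=; ring.
- rewrite andbT => sS; have /hc : (src e, e.2) \in hed L v.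
    by rewrite mem_cat; apply/orP; left; apply/mapP; exists e; rewrite // mem_filter tv eqxx.
  move=> /(_ sS); rewrite /okh /start /hk /sat tv eqxx (negbTE sv) /=.
  by rewrite opprD addrA.
- move=> eS; have := pf _ eL; rewrite /inside eS /sat (negbTE sv) (negbTE tv); exact.
Qed.

Lemma arc_card (s : Z5) k : (#|[set c : Z5 | ((c - s)%R < k)%N]| <= k)%N.
Proof.
have -> : [set c : Z5 | ((c - s)%R < k)%N] = (fun d => d + s) @: [set d : Z5 | (d < k)%N].
  apply/setP => c; rewrite inE; apply/idP/imsetP => [h|[d]].
    by exists (c - s); rewrite ?inE ?subrK.
  by rewrite inE => ? ->; rewrite addrK.
rewrite card_imset; last exact: addIr.
rewrite cardE -(size_map val) -[leqRHS](size_iota 0); apply: uniq_leq_size.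
  by rewrite map_inj_uniq ?enum_uniq //; apply: val_inj.
by move=> d /mapP[c]; rewrite mem_enum inE mem_iota => ? ->.
Qed.

(** Greedy choice: removing an arc of length [k] costs at most [k] elements of [X]. *)
Lemma pick_color (X : {set Z5}) (s : seq (Z5 * nat)) : (\sum_(a <- s) a.2 < #|X|)%N ->
  exists2 c, c \in X & all (fun a => (a.2 <= (c - a.1)%R)%N) s.
Proof.
elim: s X => [|[a k] s IH] X; first by rewrite big_nil => /card_gt0P[c]; exists c.
rewrite big_cons /= => h.
have [|c] := IH (X :\: [set c : Z5 | ((c - a)%R < k)%N]).
  set A := [set c : Z5 | _]; have cA : (#|A| <= k)%N := arc_card a k.
  have cI := leq_trans (subset_leq_card (subsetIr X A)) cA.
  by rewrite -(ltn_add2l #|X :&: A|) cardsID; apply: leq_ltn_trans h; rewrite leq_add2r.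
by rewrite !inE -leqNgt => /andP[h1 h2] h3; exists c => //; rewrite h1.
Qed.

End Extension.

(** Reduces statements about relative positions of arcs to finitely many computations; all arc
    lemmas below are checked in this way. *)
Lemma forall_Z5 (P : Z5 -> Prop) : P 0 -> P 1 -> P 2%:R -> P 3%:R -> P 4%:R -> forall a, P a.
Proof.
move=> P0 P1 P2 P3 P4 [[|[|[|[|[|//]]]]] Ha].
- by rewrite (_ : Ordinal Ha = 0) //; apply/val_inj.
- by rewrite (_ : Ordinal Ha = 1) //; apply/val_inj.
- by rewrite (_ : Ordinal Ha = 2%:R) //; apply/val_inj.
- by rewrite (_ : Ordinal Ha = 3%:R) //; apply/val_inj.
- by rewrite (_ : Ordinal Ha = 4%:R) //; apply/val_inj.
Qed.

(** An edge of weight [k] costs [k + 1 <= 2 k], with a surplus of 2 when [k = 3]. *)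
Lemma has3_kap (V : finType) (L : seq (gedge V)) A B : weighted L -> has3 L A B ->
  (cst L A B + 2 <= 2 * kap L A B)%N.
Proof.
have le0 L' : weighted L' -> (cst L' A B <= 2 * kap L' A B)%N.
  move=> wL; rewrite /kap /cst !big_distrr /= big_seq_cond [leqRHS]big_seq_cond.
  by apply: leq_sum => e /andP[eL _]; move/allP: wL => /(_ e eL); lia.
elim: L => //= e L IH /andP[we wL]; rewrite /cst /kap !big_cons -/(cst L A B) -/(kap L A B).
case/orP => [/andP[-> /eqP ->]|/(IH wL)]; first by have := le0 _ wL; lia.
case: ifP; lia.
Qed.

(** [cst - kap] counts the edges, so there is at most one, and it carries the whole weight. *)
Lemma single_has3 (V : finType) (L : seq (gedge V)) A B : weighted L ->
  (cst L A B <= (kap L A B).+1)%N -> (3 <= kap L A B)%N -> has3 L A B.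
Proof.
elim: L => [|e L IH] /=; first by rewrite /kap big_nil.
case/andP => we wL; have := kap_cst A B wL; have := IH wL.
rewrite /cst /kap !big_cons -/(cst L A B) -/(kap L A B).
case: ifP => c h h1 h2 h3; last by rewrite h ?orbT.
by have -> : wt e = 3%N by lia.
Qed.

(** * Adding a gadget edge to a sparse instance *)

Section Gadgets.
Variable V : finType.
Implicit Types (e : gedge V) (L : seq (gedge V)) (S R A B : {set V}).

Lemma pot_cons e L S : pot (e :: L) S = pot L S - (if inside S e then (wt e).+1 else 0%N)%:Z.
Proof. by rewrite /pot /cost big_cons; case: ifP; lia. Qed.

Lemma kap_cons e L A B : kap (e :: L) A B = (kap L A B + if cross A B e then wt e else 0)%N.
Proof. by rewrite /kap big_cons; case: ifP; lia. Qed.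

Lemma has3_cons e L A B : has3 (e :: L) A B = cross A B e && (wt e == 3%N) || has3 L A B.
Proof. by []. Qed.

Lemma cross1 e x y : cross [set x] [set y] e -> (x = src e /\ y = tgt e) \/ (x = tgt e /\ y = src e).
Proof. by rewrite /cross !inE => /orP[/andP[/eqP-> /eqP->]|/andP[/eqP-> /eqP->]]; [left|right]. Qed.

(** The new edge costs [wt e + 1], hence the bound [4 + wt e] for sets containing both ends. A
    triangle can use it only for one of its sides, so a new weight 3 triangle needs two old edges of
    weight 3 with a common end. *)
Lemma sparse_cons S e L : sparse S L -> (0 < wt e <= 3)%N -> src e != tgt e ->
  (forall R, R \subset S -> src e \in R -> tgt e \in R -> 4 + (wt e)%:Z <= pot L R) ->
  (kap L [set src e] [set tgt e] + wt e <= 4)%N ->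
  (wt e = 3%N -> forall t, t \in S -> ~~ (has3 L [set src e] [set t] && has3 L [set tgt e] [set t])) ->
  sparse S (e :: L).
Proof.
move=> [wL nl hp hk ht] we ne hpe hke hte; split.
- by rewrite /weighted /= we.
- by rewrite /= ne implybT.
- move=> R RS R0; rewrite pot_cons; case: ifP => [/andP[h1 h2]|_].
    by have := hpe R RS h1 h2; lia.
  by have := hp R RS R0; lia.
- move=> x y xS yS xy; rewrite kap_cons; case: ifP => [/cross1|_]; last by rewrite addn0 hk.
  by case=> -[-> ->] //; rewrite kapC.
- move=> x y z xS yS zS xy yz xz; have h0 := ht x y z xS yS zS xy yz xz.
  rewrite !has3_cons.
  have [w3|nw3] := eqVneq (wt e) 3; last by rewrite !andbF.
  rewrite !andbT.
  have T t : t \in S -> has3 L [set src e] [set t] -> has3 L [set tgt e] [set t] -> False.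
    by move=> tS h1 h2; have := hte w3 t tS; rewrite h1 h2.
  have C2 a b c : a != c -> cross [set a] [set b] e -> cross [set b] [set c] e -> False.
    by move=> ac /cross1[[Ea Eb]|[Ea Eb]] /cross1[[Eb' Ec]|[Eb' Ec]]; subst;
      first [by move: ne; rewrite ?Eb' ?eqxx | by move: ne; rewrite -?Eb' ?eqxx | by rewrite eqxx in ac].
  apply/negP => /and3P[/orP[c1|g1] /orP[c2|g2] /orP[c3|g3]].
  + exact: C2 xz c1 c2.
  + exact: C2 xz c1 c2.
  + by apply: (C2 z x y) => //; rewrite 1?eq_sym 1?crossC // crossC.
  + case/cross1: c1 => -[? ?]; subst; apply: (T z zS) => //.
  + by apply: (C2 y z x) => //; rewrite 1?eq_sym // crossC.
  + case/cross1: c2 => -[? ?]; subst; apply: (T x xS); rewrite has3C //.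
  + case/cross1: c3 => -[? ?]; subst; apply: (T y yS) => //; rewrite has3C //.
  + by move: h0; rewrite g1 g2 g3.
Qed.

(* Added to a colouring problem from which v was removed, this edge keeps the
   forbidden arcs of h1 and h2 at v in a favourable relative position. *)
Definition gad (h1 h2 : hedge V) (t : Z5) (k : nat) : gedge V :=
  ((nbr h1), (nbr h2), (t + h1.2.1 - h2.2.1, k)).

Lemma sat_gad f h1 h2 t k : sat f (gad h1 h2 t k) = (k <= (start f h2 - start f h1 - t)%R)%N.
Proof. by rewrite /sat /gad /start /src /tgt /gain /wt /=; congr (leq _ (nat_of_ord _)); ring. Qed.

End Gadgets.

(** * Minimal counterexamples *)

(** Minimality refers to the number of vertices only and ranges over all edge lists: once a vertex
    is deleted, any edges may be added as long as the result is sparse. *)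
Record minimal (V : finType) (U : {set V}) (L : seq (gedge V)) : Prop := Minimal {
  min_IH : forall (S' : {set V}) L', (#|S'| < #|U|)%N -> sparse S' L' -> colorable S' L';
  min_sparse : sparse U L;
  min_inside : all (inside U) L;
  min_bad : ~ colorable U L }.

Section Degrees.
Variables (V : finType) (L : seq (gedge V)).
(* cost of v into S, total cost of v, total weight at v *)
Definition dg v (S : {set V}) : nat := \sum_(h <- hed L v | (nbr h) \in S) (hk h).+1.
Definition dv v : nat := \sum_(h <- hed L v) (hk h).+1.
Definition kv v : nat := \sum_(h <- hed L v) hk h.
End Degrees.

Section Minimal.
Variables (V : finType) (U : {set V}) (L : seq (gedge V)).
Hypothesis M : minimal U L.
Implicit Types (S R Q : {set V}) (u v x y z : V) (h : hedge V) (f : V -> Z5).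

Notation P := (pot L).
Let sp : sparse U L := min_sparse M.
Let LU : all (inside U) L := min_inside M.
Let wL : weighted L := sp_wt sp.
Local Notation dg := (dg L).
Local Notation dv := (dv L).
Local Notation kv := (kv L).

Lemma nl v : all (fun e => ~~ ((src e == v) && (tgt e == v))) L.
Proof.
apply/allP => e eL; have /implyP := allP (sp_loop sp) _ eL; rewrite (allP LU _ eL) => /(_ isT).
by apply: contraNN => /andP[/eqP -> /eqP ->].
Qed.

Lemma hedU v h : h \in hed L v -> [/\ v \in U, (nbr h) \in U, (nbr h) != v & (0 < hk h <= 3)%N].
Proof.
move=> /hed_edge[e [eL c we]]; have /andP[sU tU] := allP LU _ eL.
have k := allP wL _ eL; have := allP (nl v) _ eL; rewrite -we.
by case/cross1: c => -[-> ->]; rewrite eqxx ?andbT /= => n; split.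
Qed.

Lemma P_add v S : v \notin S -> P (v |: S) = P S + 5 - (dg v S)%:Z.
Proof. by move=> vS; rewrite pot_addv ?nl // cst_hed. Qed.

Lemma P1 v : P [set v] = 5.
Proof.
rewrite -[[set v]]setU0 P_add ?inE // /dg big1 => [|h]; last by rewrite inE.
by rewrite /pot cards0 /cost big1 => [|e] //; rewrite /inside !inE.
Qed.

Lemma P2 u v : u != v -> P [set u; v] = 10 - (cst L [set u] [set v])%:Z.
Proof. by move=> uv; rewrite P_add ?inE // P1 /dg -cst_hed ?inE //; lia. Qed.

Lemma dv_dg v S : v \in U -> U :\ v \subset S -> dg v S = dv v.
Proof.
move=> vU /subsetP US; rewrite [LHS]big_seq_cond [RHS]big_seq_cond.
apply: eq_bigl => h; rewrite andbT; apply: andb_idr => /hedU[_ hU hn _].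
by apply: US; rewrite in_setD1 hn.
Qed.

Lemma dv_kv v : dv v = (kv v + size (hed L v))%N.
Proof. by rewrite /dv /kv -sum1_size -big_split; apply: eq_bigr => h _ /=; rewrite addn1. Qed.

Lemma colored S : S \proper U -> colorable S L.
Proof. move=> SU. refine (min_IH M (proper_card SU) (sparse_sub (proper_sub SU) sp)). Qed.

Lemma no_extension v f c : v \in U -> pcol f (U :\ v) L ->
  (forall h, h \in hed L v -> okh f h c) -> False.
Proof.
move=> vU pf hc; apply: (min_bad M); exists (fun y => if y == v then c else f y).
rewrite -(setD1K vU); apply: pcol_addv; rewrite ?inE ?eqxx ?nl // => h hv _; exact: hc.
Qed.

Lemma no_pick v f (X : {set Z5}) (s : seq (hedge V)) : v \in U -> pcol f (U :\ v) L ->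
  (\sum_(h <- s) hk h < #|X|)%N ->
  (forall c, c \in X -> forall h, h \in hed L v -> okh f h c \/ h \in s) -> False.
Proof.
move=> vU pf hX hs; have [|c cX ok] := @pick_color X [seq (start f h, hk h) | h <- s].
  by rewrite big_map.
apply: (no_extension vU pf (c := c)) => h hv; have [//|hsm] := hs c cX h hv.
by move/allP: ok => /(_ (start f h, hk h)); apply; apply/mapP; exists h.
Qed.

(** With total weight at most 4, a colouring of the remaining vertices leaves a colour free at
    [v]. *)
Lemma kv5 v : v \in U -> (5 <= kv v)%N.
Proof.
move=> vU; rewrite leqNgt; apply/negP => kv4.
have [f pf] := colored (properD1 vU).
apply: (@no_pick v f setT (hed L v) vU pf); first by rewrite cardsT card_ord.
by move=> c _ h hv; right.
Qed.

Lemma hed_subseq v s : perm_eq (hed L v) s -> [/\ kv v = \sum_(h <- s) hk h, dv v = \sum_(h <- s) (hk h).+1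
  & forall S, dg v S = \sum_(h <- s | (nbr h) \in S) (hk h).+1]%N.
Proof. by move=> p; split=> [||S]; rewrite /kv /dv /dg; apply: perm_big. Qed.

Lemma P_sparse R : R \subset U -> R != set0 -> 3 <= P R.
Proof. exact: sp_pot. Qed.

(** Two arcs of length 3 cover Z5 exactly when their starts differ by 2 or 3; for lengths 3 and 2,
    as in [loc32], the only covering position is 3. A gadget edge forbids these positions. *)
Lemma loc33 (d : Z5) : (2 <= (d - 2%:R)%R)%N -> exists c : Z5, (3 <= c)%N && (3 <= (c - d)%R)%N.
Proof.
by elim/forall_Z5: d => // _; first [by exists 0 | by exists 1 | by exists 2%:R | by exists 3%:R | by exists 4%:R].
Qed.

Lemma loc32 (d : Z5) : (1 <= (d - 3%:R)%R)%N -> exists c : Z5, (3 <= c)%N && (2 <= (c - d)%R)%N.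
Proof.
by elim/forall_Z5: d => // _; first [by exists 0 | by exists 1 | by exists 2%:R | by exists 3%:R | by exists 4%:R].
Qed.

End Minimal.

(** * Every vertex has at least three half-edges *)

Section Minimal.
Variables (V : finType) (U : {set V}) (L : seq (gedge V)).
Hypothesis M : minimal U L.
Implicit Types (S R Q : {set V}) (u v x y z : V) (h : hedge V) (f : V -> Z5).

Notation P := (pot L).
Let sp : sparse U L := min_sparse M.
Let wL : weighted L := sp_wt sp.
Local Notation dg := (dg L).
Local Notation dv := (dv L).

Lemma pcol_cons f S e : pcol f S (e :: L) = (inside S e ==> sat f e) && pcol f S L.
Proof. by []. Qed.

Lemma perm_sorted v : exists2 s, perm_eq (hed L v) s & sorted (fun h1 h2 => hk h2 <= hk h1)%N s.
Proof.
exists (sort (fun h1 h2 => hk h2 <= hk h1)%N (hed L v)); first by rewrite perm_sym perm_sort.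
by apply: sort_sorted => h1 h2; apply: leq_total.
Qed.

Lemma color_gad S h1 h2 t k : (#|S| < #|U|)%N -> S \subset U ->
  (0 < k <= 3)%N -> (nbr h1) != (nbr h2) -> (nbr h1) \in S -> (nbr h2) \in S ->
  (forall R, R \subset S -> (nbr h1) \in R -> (nbr h2) \in R -> 4 + k%:Z <= P R) ->
  (kap L [set (nbr h1)] [set (nbr h2)] + k <= 4)%N ->
  (k = 3%N -> forall t, t \in S -> ~~ (has3 L [set (nbr h1)] [set t] && has3 L [set (nbr h2)] [set t])) ->
  exists2 f, pcol f S L & (k <= (start f h2 - start f h1 - t)%R)%N.
Proof.
move=> cS SU hk hne h1S h2S hp hkap htri.
have [|f] := min_IH M cS (L' := gad h1 h2 t k :: L).
  by apply: sparse_cons => //; apply: sparse_sub sp.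
rewrite pcol_cons /inside /gad /src /tgt /= h1S h2S /= => /andP[].
by rewrite -/(gad h1 h2 t k) sat_gad => h pf; exists f.
Qed.

Lemma has3_hed v h : h \in hed L v -> hk h = 3%N -> has3 L [set v] [set (nbr h)].
Proof. by move=> /hed_edge[e [eL c we]] h3; apply/hasP; exists e; rewrite // c we h3. Qed.

(** With two half-edges the weights [k1], [k2] are 3 and 3, or 3 and 2. The vertex is deleted and
    its neighbours are joined by a gadget of weight [k1 + k2 - 4], which forbids the positions where
    the two arcs cover Z5. Adding [v] to a set containing both neighbours changes the potential by
    [5 - (k1 + k2 + 2)] and leaves at least 3, so the set has potential at least [k1 + k2]: exactly
    what a gadget of this weight needs. *)
Lemma deg3 v : v \in U -> (3 <= size (hed L v))%N.
Proof.
move=> vU; rewrite leqNgt; apply/negP => s2.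
have [s ps ss] := perm_sorted v; have := kv5 M vU.
have [kE _ dE] := hed_subseq ps; have hs h : h \in s -> h \in hed L v by rewrite (perm_mem ps).
have {}s2 : (size s < 3)%N by rewrite -(perm_size ps).
move: ps ss hs; rewrite kE; case: s s2 {kE} dE => [|h1 [|h2 [|]]] //=; rewrite ?big_cons ?big_nil //=.
- by move=> _ _ _ _ hs h; have [_ _ _] := hedU M (hs h1 (mem_head _ _)); lia.
- move=> _ dE ps; rewrite andbT => k21 hs h5.
  have [_ aU av k1] := hedU M (hs h1 (mem_head _ _)).
  have h2in : h2 \in [:: h1; h2] by rewrite !inE eqxx orbT.
  have [_ bU bv k2] := hedU M (hs h2 h2in).
  rewrite addn0 in h5.
  have dgE S : (nbr h1) \in S -> (nbr h2) \in S -> dg v S = (hk h1 + hk h2).+2.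
    by move=> aS bS; rewrite dE !big_cons aS bS big_nil; lia.
  have ab : (nbr h1) != (nbr h2).
    apply/negP => /eqP ab; have := sp_kap sp vU aU; rewrite eq_sym av => /(_ isT).
    rewrite kap_hed; last by rewrite inE eq_sym.
    by rewrite (perm_big _ ps) /= !big_cons big_nil -ab !inE eqxx; lia.
  have PR R : v \notin R -> R \subset U -> (nbr h1) \in R -> (nbr h2) \in R -> (hk h1 + hk h2)%:Z <= P R.
    move=> vR RU aR bR; have := @P_sparse _ _ _ M (v |: R).
    rewrite (P_add M vR) dgE // subUset sub1set vU RU => /(_ isT).
    have -> : v |: R != set0 by apply/set0Pn; exists v; rewrite setU11.
    by move=> /(_ isT); clear; lia.
  have := PR [set (nbr h1); (nbr h2)]; rewrite (P2 M ab) !inE !eqxx orbT !(eq_sym v) negb_or av bv.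
  rewrite subUset !sub1set aU bU => /(_ isT isT isT isT) Pab.
  have := kap_cst [set (nbr h1)] [set (nbr h2)] wL => kc.
  pose k := (hk h1 + hk h2 - 4)%N.
  have k33 : hk h1 = 3%N /\ (hk h2 = 3%N \/ hk h2 = 2%N) by lia.
  pose t : Z5 := if hk h2 == 3%N then 2%:R else 3%:R.
  have aS : (nbr h1) \in U :\ v by rewrite !inE av.
  have bS : (nbr h2) \in U :\ v by rewrite !inE bv.
  have h3v1 := has3_hed (hs h1 (mem_head _ _)).
  have h3v2 := has3_hed (hs h2 h2in).
  have [||||||f pf fk] := @color_gad (U :\ v) h1 h2 t k _ _ _ ab aS bS.
  + by rewrite [ltnRHS](cardsD1 v) vU.
  + exact: subD1set.
  + by rewrite /k; move: k33; clear; lia.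
  + move=> R /subsetP RS aR bR; have := PR R; rewrite aR bR.
    have -> : v \notin R by apply/negP => /RS; rewrite !inE eqxx.
    have -> : R \subset U by apply/subsetP => y /RS; rewrite inE => /andP[].
    by move=> /(_ isT isT isT isT); rewrite /k; move: k33; clear; lia.
  + have [k3|k3] := leqP 3 (kap L [set (nbr h1)] [set (nbr h2)]); last first.
      by rewrite /k; move: k33 kc Pab k3; clear; lia.
    have [k6|k6] := leqP 3 (hk h2); last by rewrite /k; move: k33 k6 kc Pab; clear; lia.
    (* For weights 3 and 3 the potential of the two neighbours allows cost at most 4 between them,
       so weight 3 means a single edge of weight 3, closing a forbidden triangle with [v]. *)
    have /= := sp_tri sp vU aU bU; rewrite !(eq_sym v) av bv ab => /(_ isT isT isT).
    by rewrite h3v1 ?h3v2 ?andbT ?single_has3 //; move: k33 k3 k6 Pab; clear; lia.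
  + by rewrite /k; move: k33; clear; lia.
  suff [c c1 c2] : exists2 c, okh f h1 c & okh f h2 c.
    apply: (no_extension M vU pf (c := c)) => h; rewrite (perm_mem ps) !inE.
    by case/orP => /eqP ->.
  have [d] : exists d : Z5, (hk h1 <= d)%N && (hk h2 <= (d - (start f h2 - start f h1))%R)%N.
    move: fk; rewrite /t /k; case: k33 => -> [] -> /=; [exact: loc33|exact: loc32].
  case/andP => d1 d2; exists (start f h1 + d).
    by rewrite /okh addrC addKr.
  by rewrite /okh; apply: etrans d2; congr (leq _ (nat_of_ord _)); ring.
Qed.

Lemma dv8 v : v \in U -> (8 <= dv v)%N.
Proof. by move=> vU; have := deg3 vU; have := kv5 M vU; rewrite dv_kv; lia. Qed.

End Minimal.

(** * Proper subsets have potential at least 6 *)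

Section Minimal.
Variables (V : finType) (U : {set V}) (L : seq (gedge V)).
Hypothesis M : minimal U L.
Implicit Types (S R Q : {set V}) (u v x y z : V) (h : hedge V) (f : V -> Z5).

Notation P := (pot L).
Let sp : sparse U L := min_sparse M.
Let wL : weighted L := sp_wt sp.
Local Notation dg := (dg L).
Local Notation dv := (dv L).
Local Notation kv := (kv L).

Lemma P_cst y R : y \notin R -> P (y |: R) = P R + 5 - (cst L [set y] R)%:Z.
Proof. by move=> yR; rewrite (P_add M yR) /dg -cst_hed. Qed.

Lemma cst_total y R z : y \notin R -> y != z -> z \notin R ->
  (forall h, h \in hed L y -> nbr h \in z |: R) ->
  dv y = (cst L [set y] R + cst L [set y] [set z])%N /\
  kv y = (kap L [set y] R + kap L [set y] [set z])%N.
Proof.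
move=> yR yz zR US; rewrite !cst_hed ?inE // !kap_hed ?inE // /dv /kv.
have E (F : nat -> nat) : (\sum_(h <- hed L y) F (hk h) =
    \sum_(h <- hed L y | nbr h \in R) F (hk h) + \sum_(h <- hed L y | nbr h \in [set z]) F (hk h))%N.
  rewrite (bigID (fun h => nbr h \in R)) /=; congr (_ + _)%N.
  rewrite big_seq_cond [RHS]big_seq_cond; apply: eq_bigl => h.
  case hh: (h \in hed L y) => //=; have := US _ hh; rewrite !inE.
  by case: (eqVneq (nbr h) z) => [->|_] /=; rewrite ?zR // => ->.
by rewrite (E succn) (E id).
Qed.

Lemma cst_setU1 y z R : z \notin R -> y \notin z |: R ->
  cst L [set y] (z |: R) = (cst L [set y] [set z] + cst L [set y] R)%N.
Proof.
move=> zR yzR; have := yzR; rewrite in_setU1 negb_or => /andP[yz yR].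
have yz1 : y \notin [set z] by rewrite inE.
rewrite (cst_hed _ yzR) (cst_hed _ yz1) (cst_hed _ yR) (bigID (fun h => nbr h == z)) /=; congr (_ + _)%N; apply: eq_bigl => h;
  rewrite !inE; case: (eqVneq (nbr h) z) => [->|]; rewrite ?(negbTE zR) ?andbF ?andbT //.
Qed.

(** Three edges of weight 3 cost at least 12, against the 10 gained for [y] and [z]. If [y] has no
    other neighbours, its third half-edge, guaranteed by [deg3], raises the cost of [y] to at least
    10, and the total to 14. *)
Lemma tri_bound y z R : y \in U -> z \in U -> y != z -> y \notin R -> z \notin R ->
  [&& has3 L [set y] [set z], has3 L [set y] R & has3 L [set z] R] ->
  P (z |: (y |: R)) <= P R - 2 /\
  ((forall h, h \in hed L y -> nbr h \in z |: R) -> P (z |: (y |: R)) <= P R - 4).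
Proof.
move=> yU zU yz yR zR /and3P[h1 h2 h3].
have zyR : z \notin y |: R by rewrite !inE eq_sym (negbTE yz).
rewrite (P_cst zyR) (P_cst yR) cst_setU1 //.
have c1 := has3_cst h1; have c2 := has3_cst h2; have c3 := has3_cst h3.
rewrite [cst L [set z] [set y]]cstC; split; first by move: c1 c2 c3; clear; lia.
move=> US; have [dE kE] := cst_total yR yz zR US.
have := has3_kap wL h1; have := has3_kap wL h2.
have := deg3 M yU; have := dv_kv L y; rewrite dE kE.
move: c1 c2 c3; clear; lia.
Qed.

(** Weight 5 costs at least 7; if all neighbours of [y] are in [R], the cost is at least 8 by
    [dv8]. *)
Lemma kap_bound y R : y \in U -> y \notin R -> (5 <= kap L [set y] R)%N ->
  P (y |: R) <= P R - 2 /\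
  ((forall h, h \in hed L y -> nbr h \in R) -> P (y |: R) <= P R - 3).
Proof.
move=> yU yR h5; rewrite (P_cst yR); have := kap_cst [set y] R wL => kc; split.
  by move: h5 kc; clear; lia.
move=> US; have : dv y = cst L [set y] R.
  rewrite cst_hed // /dv big_seq [RHS]big_seq_cond; apply: eq_bigl => h.
  by apply/esym/andb_idr => /US.
by have := dv8 M yU => h8 hE; move: h8; rewrite hE; clear; lia.
Qed.

(** Downward induction: if [R] has potential at most 5 and all larger proper sets have potential at
    least 6, a colouring of [R] extends to [U] by collapsing [R], since [U] itself has at least 3.
    The sharper halves of [kap_bound] and [tri_bound] deal with local obstructions that exhaust [U],
    where only 3 is known. With fewer than two vertices in [R] the quotient would not be smaller. *)
Lemma pot_ge6 R : R \proper U -> (1 < #|R|)%N -> 6 <= P R.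
Proof.
move: {2}(#|U :\: R|)%N (leqnn #|U :\: R|) => n; elim: n R => [|n IHn] R cR RU R2.
  by move: RU cR; rewrite leqn0 cards_eq0 setD_eq0 properE => /andP[_ /negbTE ->].
have big (T : {set V}) : R \proper T -> T \subset U -> T <> U -> 6 <= P T.
  move=> RT TU TnU; apply: IHn; last 2 first.
  - by rewrite properEneq TU; case: eqVneq TnU.
  - exact: leq_trans R2 (subset_leq_card (proper_sub RT)).
  rewrite -ltnS; apply: leq_trans cR; apply: proper_card.
  by move: RT; rewrite !properE => /andP[h1 h2]; rewrite setDS //=;
    apply: contra h2 => h; apply/subsetP => x xT; move: (subsetP h x); rewrite !inE (subsetP TU _ xT) xT;
    case: (x \in R) => // /(_ isT).
have PU : 3 <= P U.
  apply: (P_sparse M (subxx _)); apply/set0Pn; have /properP[_ [x xU _]] := RU; by exists x.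
rewrite leNgt; apply/negP => P5; apply: (min_bad M).
have [f pf] := colored M RU; have /card_gt0P[x0 x0R] := ltnW R2.
have RU' := proper_sub RU.
have inD y : y \in U :\: R -> y \in U /\ y \notin R by rewrite inE => /andP[].
have nbrsU y (T : {set V}) : y |: T = U -> forall h, h \in hed L y -> nbr h \in T.
  by move=> E h /(hedU M)[_ hU hy _]; move: hU; rewrite -E !inE (negbTE hy).
have prop1 y : y \in U :\: R -> R \proper y |: R.
  by case/inD => yU yR; rewrite properE subsetUr subUset sub1set (negbTE yR).
have [|||||g [pg _]] := extend (min_IH M) x0R RU' _ pf; last by exists g.
- have := cardsID R U; rewrite (setIidPr RU') => <-; move: R2; clear; lia.
- by apply: sparse_sub sp; apply: subsetDl.
- move=> T RT TU; have [->|/eqP TnU] := eqVneq T U; first by move: PU P5; clear; lia.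
  by have := big _ RT TU TnU; move: P5; clear; lia.
- move=> y yD; have [yU yR] := inD y yD; rewrite leqNgt; apply/negP => k5.
  have [b1 b2] := kap_bound yU yR k5.
  have TU : y |: R \subset U by rewrite subUset sub1set yU.
  have [E|/eqP TnU] := eqVneq (y |: R) U.
    by have := b2 (nbrsU _ _ E); rewrite E; move: PU P5; clear; lia.
  by have := big _ (prop1 _ yD) TU TnU; move: b1 P5; clear; lia.
- move=> y z yD zD yz; have [yU yR] := inD y yD; have [zU zR] := inD z zD.
  apply/negP => t3; have [b1 b2] := tri_bound yU zU yz yR zR t3.
  have TU : z |: (y |: R) \subset U by rewrite !subUset !sub1set yU zU.
  have [E|/eqP TnU] := eqVneq (z |: (y |: R)) U.
    have b3 := b2 (nbrsU y (z |: R) _); move: b3; rewrite E setUCA => /(_ E).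
    by move: PU P5; clear; lia.
  have RT : R \proper z |: (y |: R) by apply: proper_sub_trans (prop1 _ yD) (subsetUr _ _).
  by have := big _ RT TU TnU; move: b1 P5; clear; lia.
Qed.

(** The vertex [a] is kept off [k] consecutive colours starting at [c] by an extra edge of weight
    [k] from a vertex of [R], whose colour is known. It costs [k + 1] in sets containing [a]; this
    turns the slack 2 of [extend] into 1 and the term [k]. Slack 1 also excludes the local
    obstructions at other vertices, since these lose at least 2. *)
Lemma extend2 R S f a (c : Z5) k : R \subset S -> S \subset U -> (0 < #|R|)%N ->
  (#|S :\: R|.+1 < #|U|)%N -> pcol f R L -> a \in S -> a \notin R -> (0 < k <= 2)%N ->
  (kap L [set a] R + k <= 4)%N \/ (k = 1)%N ->
  (forall R', R \proper R' -> R' \subset S ->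
     P R - 1 + (if a \in R' then k%:Z else 0) <= P R') ->
  exists g, [/\ pcol g S L, {in R, g =1 f} & (k <= (g a - c)%R)%N].
Proof.
move=> RS SU /card_gt0P[x0 x0R] cS pf aS aR k2 ha hp.
have inD y : y \in S :\: R -> [/\ y \in S, y \in U & y \notin R].
  by rewrite inE => /andP[-> yS]; rewrite yS (subsetP SU).
pose e : gedge V := (x0, a, (c - f x0, k)).
have se : src e = x0 by [].
have te : tgt e = a by [].
have we : wt e = k by [].
have eR (T : {set V}) : a \notin T -> inside T e = false by move=> /negbTE h; rewrite /inside /e /tgt /= h andbF.
have eT (T : {set V}) : inside T e -> a \in T by rewrite /inside /e /tgt /= => /andP[].
have enD (T : {set V}) : [disjoint T & R] -> inside T e = false.
  by move=> d; rewrite /inside /e /src /= (disjointFl d).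
have cr y (T : {set V}) : cross [set y] T e -> y = a \/ (y = x0 /\ a \in T).
  by rewrite /cross !inE /e /src /tgt /= => /orP[/andP[/eqP <- ?]|/andP[_ /eqP <-]]; [right|left].
have nR y : y \notin R -> (y == x0) = false by move=> yR; apply: contraNF yR => /eqP ->.
have cr1 y z : y \notin R -> z \notin R -> cross [set y] [set z] e = false.
  move=> yR zR; apply/negP => /cross1[[E _]|[_ E]].
    by move: yR; rewrite E se x0R.
  by move: zR; rewrite E se x0R.
have [|||||g [pg gf]] := @extend V (e :: L) R S x0 f #|U| (min_IH M) x0R RS cS _ _.
- by rewrite pcol_cons eR.
- have [w' l' p' k' t'] : sparse (S :\: R) L.
    by apply: sparse_sub sp; apply: subset_trans (subsetDl _ _) SU.
  have dD (T : {set V}) : T \subset S :\: R -> inside T e = false.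
    by move=> TD; apply: enD; rewrite disjoint_subset; apply/subsetP => y /(subsetP TD) /inD[].
  split.
  + have -> : weighted (e :: L) = (0 < wt e <= 3)%N && weighted L by [].
    by rewrite w' andbT we; move: k2; clear; lia.
  + by apply/andP; split; [rewrite dD | exact: l'].
  + by move=> T TD T0; rewrite pot_cons dD // subr0 p'.
  + move=> y z yD zD yz; have [_ _ yR] := inD y yD; have [_ _ zR] := inD z zD.
    by rewrite kap_cons cr1 // addn0 k'.
  + move=> x y z xD yD zD xy yz xz; have [_ _ xR] := inD x xD.
    have [_ _ yR] := inD y yD; have [_ _ zR] := inD z zD.
    by rewrite !has3_cons !cr1 //; apply: t'.
- move=> T RT TS; have := hp T RT TS; rewrite !pot_cons (eR R) // we.
  by have [aT|/eR ->] := boolP (a \in T); [case: ifP|]; clear; lia.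
- move=> y /inD[yS yU yR]; rewrite kap_cons we.
  have RT : R \proper y |: R by rewrite properE subsetUr !subUset !sub1set (negbTE yR).
  have TS : y |: R \subset S by rewrite subUset sub1set yS.
  have := hp _ RT TS; rewrite in_setU1.
  have [/cr c1|_] := boolP (cross [set y] R e); last first.
    rewrite addn0 => b; rewrite leqNgt; apply/negP => k5.
    by have [b1 _] := kap_bound yU yR k5; move: b b1; case: ifP; clear; lia.
  have {c1} ya : y = a by case: c1 => // -[E _]; rewrite E x0R in yR.
  rewrite ya eqxx /=; case: ha => [h _|k1]; first exact: h.
  rewrite P_cst // k1 => b; rewrite leqNgt; apply/negP.
  by have := kap_cst [set a] R wL; move: b; clear; lia.
- move=> y z /inD[yS yU yR] /inD[zS zU zR] yz; rewrite !has3_cons.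
  have -> : (wt e == 3)%N = false by rewrite we; move: k2; clear; lia.
  rewrite !andbF /=; apply/negP => t3.
  have [b1 _] := tri_bound yU zU yz yR zR t3; have := hp (z |: (y |: R)).
  rewrite properE !subUset !sub1set yS zS RS (negbTE yR) andbF /=.
  have -> : R \subset z |: (y |: R) by rewrite setUA subsetUr.
  by move=> /(_ isT isT); move: b1; case: ifP; clear; lia.
exists g; move: pg; rewrite pcol_cons => /andP[].
rewrite {1}/inside se te aS (subsetP RS _ x0R) /= => sate pg; split=> //.
apply: etrans sate; rewrite /sat se te we (gf _ x0R).
by congr (leq _ (nat_of_ord _)); rewrite /gain /=; ring.
Qed.

End Minimal.

(** * Counting vertices; vertices of cost 8, and of cost 9 with three half-edges *)

Ltac z5ex := first [by exists 0 | by exists 1 | by exists 2%:R | by exists 3%:R | by exists 4%:R].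

(** Here and in the next two lemmas the gadget makes the first two arcs overlap: the point lies in
    the arc of length 3, the two arcs of length 2 meet, the arc of length 2 lies in the arc of
    length 3. At most four colours are then forbidden. *)
Lemma arcs311 (d2 d3 : Z5) : (2 <= (d2 - 3%:R)%R)%N ->
  exists c : Z5, [&& 3 <= c, 1 <= (c - d2)%R & 1 <= (c - d3)%R]%N.
Proof. by elim/forall_Z5: d2 => // _; elim/forall_Z5: d3; z5ex. Qed.

Lemma arcs221 (d2 d3 : Z5) : (2 <= (d2 - 2%:R)%R)%N ->
  exists c : Z5, [&& 2 <= c, 2 <= (c - d2)%R & 1 <= (c - d3)%R]%N.
Proof. by elim/forall_Z5: d2 => // _; elim/forall_Z5: d3; z5ex. Qed.

Lemma arcs321 (d2 d3 : Z5) : (3 <= (d2 - 2%:R)%R)%N ->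
  exists c : Z5, [&& 3 <= c, 2 <= (c - d2)%R & 1 <= (c - d3)%R]%N.
Proof. by elim/forall_Z5: d2 => // _; elim/forall_Z5: d3; z5ex. Qed.

Section Minimal.
Variables (V : finType) (U : {set V}) (L : seq (gedge V)).
Hypothesis M : minimal U L.
Implicit Types (S R Q : {set V}) (u v x y z : V) (h : hedge V) (f : V -> Z5).

Notation P := (pot L).
Let sp : sparse U L := min_sparse M.
Let LU : all (inside U) L := min_inside M.
Let wL : weighted L := sp_wt sp.
Local Notation dg := (dg L).
Local Notation dv := (dv L).
Local Notation kv := (kv L).

Lemma U_neq0 : U != set0.
Proof.
apply/eqP => U0; apply: (min_bad M); exists (fun=> 0); apply/allP => e /(allP LU).
by rewrite U0 /inside inE.
Qed.

Lemma pot_U_ge3 : 3 <= P U.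
Proof. exact: (P_sparse M (subxx _) U_neq0). Qed.

Lemma handshake (F : nat -> nat) :
  (\sum_(v in U) \sum_(h <- hed L v) F (hk h) = 2 * \sum_(e <- L) F (wt e))%N.
Proof.
have E v : (\sum_(h <- hed L v) F (hk h) =
    \sum_(e <- L) ((tgt e == v) * F (wt e) + (src e == v) * F (wt e)))%N.
  rewrite /hed big_cat /= !big_map !big_filter big_split /=; congr (_ + _)%N.
    by rewrite big_mkcond; apply: eq_bigr => e _; case: eqP; rewrite ?mul1n ?mul0n.
  by rewrite big_mkcond; apply: eq_bigr => e _; case: eqP; rewrite ?mul1n ?mul0n.
rewrite (eq_bigr _ (fun v _ => E v)) exchange_big /= big_distrr /=.
apply: eq_big_seq => e /(allP LU) /andP[sU tU].
rewrite big_split /= (bigD1 (tgt e)) //= eqxx (bigD1 (src e) (P := fun v => v \in U)) //= eqxx.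
rewrite !big1 => [|v /andP[_ /negbTE]|v /andP[_ /negbTE]]; first lia.
  by rewrite eq_sym => ->.
by rewrite eq_sym => ->.
Qed.

Lemma sum_dv : (\sum_(v in U) dv v = 2 * cost U L)%N.
Proof.
rewrite /dv (handshake succn); congr (_ * _)%N; rewrite /cost big_seq [RHS]big_seq_cond.
by apply: eq_bigl => e; rewrite andb_idr // => /(allP LU).
Qed.

Lemma sum_dv_lt : (\sum_(v in U) dv v + 6 <= 10 * #|U|)%N.
Proof. by rewrite sum_dv; have := pot_U_ge3; rewrite /pot; lia. Qed.

(** Costs of at least 8 with sum at most [10 #|U| - 6] require three vertices. With exactly three,
    every cost is 8 and every weight 5, but the sum 15 of the weights would have to be even. *)
Lemma U_gt3 : (3 < #|U|)%N.
Proof.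
have sk : (2 * \sum_(e <- L) wt e)%N = (\sum_(v in U) kv v)%N by rewrite /kv (handshake id).
have := sum_dv_lt; have lb : (8 * #|U| <= \sum_(v in U) dv v)%N.
  by rewrite mulnC -sum_nat_const; apply: leq_sum => v vU; exact: (dv8 M vU).
rewrite ltnNge => ub; apply/negP => n3.
have c3 : (#|U| = 3)%N by have := U_neq0; rewrite -card_gt0; lia.
have eq5 : (\sum_(v in U) kv v = 5 * #|U|)%N.
  rewrite mulnC -sum_nat_const; apply: eq_bigr => v vU; apply/eqP.
  have s : (\sum_(w in U) dv w = dv v + \sum_(w in U | w != v) dv w)%N by rewrite (bigD1 v).
  have lb' : (8 * 2 <= \sum_(w in U | w != v) dv w)%N.
    have -> : (8 * 2 = \sum_(w in U | w != v) 8)%N.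
      rewrite sum_nat_const mulnC; congr (_ * _)%N.
      rewrite -[RHS](_ : #|U :\ v| = _)%N; first by have := cardsD1 v U; rewrite vU c3; lia.
      by apply: eq_card => w; rewrite !inE andbC.
    by apply: leq_sum => w /andP[wU _]; exact: (dv8 M wU).
  have := dv_kv L v; have := deg3 M vU; have := kv5 M vU; move: ub s lb' c3; clear; lia.
by move: sk; rewrite eq5 c3; lia.
Qed.

Lemma pot_ge6_out (T : {set V}) z : T \subset U -> (1 < #|T|)%N -> z \in U -> z \notin T -> 6 <= P T.
Proof.
move=> TU T2 zU zT; apply: (pot_ge6 M) T2; rewrite properE TU.
by apply/negP => /subsetP /(_ _ zU); rewrite (negbTE zT).
Qed.

Lemma small_out (T : {set V}) n : (n < #|U|)%N -> (#|T| <= n)%N -> exists2 z, z \in U & z \notin T.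
Proof.
move=> nU Tn; case: (pickP (fun z => (z \in U) && (z \notin T))) => [z /andP[]|h]; first by exists z.
have : U \subset T by apply/subsetP => z zU; have := h z; rewrite zU => /negbFE.
by move=> /subset_leq_card; lia.
Qed.

Lemma P_del v S z : v \in U -> v \notin S -> S \subset U -> (0 < #|S|)%N ->
  z \in U -> z \notin v |: S -> (dg v S)%:Z + 1 <= P S.
Proof.
move=> vU vS SU S0 zU zT; have := @pot_ge6_out (v |: S) z.
rewrite subUset sub1set vU SU cardsU1 vS zU zT => /(_ isT).
by rewrite (P_add M vS) add1n ltnS S0 => /(_ isT isT isT); lia.
Qed.

Lemma P_del_full v S : v \in U -> v \notin S -> S \subset U -> (dg v S)%:Z - 2 <= P S.
Proof.
move=> vU vS SU; have := P_sparse M (R := v |: S); rewrite subUset sub1set vU SU (P_add M vS).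
have -> : v |: S != set0 by apply/set0Pn; exists v; rewrite setU11.
by move=> /(_ isT isT); lia.
Qed.

Lemma cst_pair t a b : a != b -> t \notin [set a; b] ->
  cst L [set t] [set a; b] = (cst L [set t] [set a] + cst L [set t] [set b])%N.
Proof.
move=> ab; rewrite !inE negb_or => /andP[ta tb].
rewrite !cst_hed ?inE ?negb_or ?ta ?tb // (bigID (fun h => nbr h == a)) /=.
congr (_ + _)%N; apply: eq_bigl => h; rewrite !inE.
  by case: (eqVneq (nbr h) a); rewrite ?andbF ?andbT.
by case: (eqVneq (nbr h) a) => [->|]; rewrite ?andbF ?andbT // (negbTE ab).
Qed.

Lemma notU_out S : S \subset U -> S != U -> exists2 z, z \in U & z \notin S.
Proof.
move=> SU SnU; have : S \proper U by rewrite properEneq SnU.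
by case/properP => _ [z]; exists z.
Qed.

Lemma has3_neq x y : has3 L [set x] [set y] -> x != y.
Proof.
case/hasP => e eL /andP[/cross1 c _]; have := allP (nl M y) _ eL.
by apply: contraNneq => xy; case: c; rewrite xy => -[<- <-]; rewrite eqxx.
Qed.

(** The bound [5 + k] is one more than the gadget needs. Applied to the two neighbours, and to these
    with a third vertex, the surplus excludes five forbidden differences and weight 3 triangles. For
    the set of all vertices but [v] the required bound comes from the cost of [v] instead. *)
Lemma vertex_gadget v h1 h2 t k : v \in U -> h1 \in hed L v -> h2 \in hed L v ->
  nbr h1 != nbr h2 -> (k = 2 \/ k = 3 /\ 4 < #|U|)%N -> (k + 6 <= dv v)%N ->
  (forall S, S \subset U :\ v -> v |: S != U -> nbr h1 \in S -> nbr h2 \in S ->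
     5 + k%:Z <= P S) ->
  exists2 f, pcol f (U :\ v) L & (k <= (start f h2 - start f h1 - t)%R)%N.
Proof.
move=> vU hh1 hh2 ab k23 hdv hS; set a := nbr h1 in ab hS *; set b := nbr h2 in ab hS *.
have [_ aU av k1] := hedU M hh1; have [_ bU bv k2] := hedU M hh2.
have n4 := U_gt3; rewrite -/a -/b in aU av bU bv.
have vab : v \notin [set a; b] by rewrite !inE negb_or !(eq_sym v) av bv.
have Pab : 5 + k%:Z <= P [set a; b].
  apply: hS; rewrite ?inE ?eqxx ?orbT //.
    by rewrite subUset !sub1set !inE av aU bv bU.
  apply/eqP => E; have := n4; rewrite -E cardsU1 vab cards2 ab; clear; lia.
have cab : (cst L [set a] [set b] + k <= 5)%N by move: Pab; rewrite (P2 M ab); clear; lia.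
have kc := kap_cst [set a] [set b] wL.
apply: (color_gad M) => //; rewrite -/a -/b.
- by rewrite [ltnRHS](cardsD1 v) vU.
- exact: subD1set.
- by move: k23; clear; lia.
- by rewrite !inE av.
- by rewrite !inE bv.
- move=> R RS aR bR; have [E|/eqP nE] := eqVneq (v |: R) U; last first.
    by have := hS _ RS (introN eqP nE) aR bR; clear; lia.
  have vR : v \notin R by apply/negP => /(subsetP RS); rewrite !inE eqxx.
  have RU : R \subset U by apply: subset_trans RS (subD1set _ _).
  have := P_del_full vU vR RU; rewrite (dv_dg M) //; first by move: hdv; clear; lia.
  by rewrite -E; apply/subsetP => x; rewrite !inE; case: (x == v).
- by move: k23 cab kc; clear; lia.
- move=> k3 s; rewrite !inE => /andP[sv sU]; apply/negP => /andP[h3a h3b].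
  have sab : s \notin [set a; b] by rewrite !inE negb_or eq_sym (has3_neq h3a) eq_sym has3_neq.
  have n5 : (4 < #|U|)%N by move: k23 k3; clear; lia.
  have := hS (s |: [set a; b]); rewrite (P_cst M sab) cst_pair // (P2 M ab) k3.
  have -> : s |: [set a; b] \subset U :\ v.
    by rewrite !subUset !sub1set !inE sv sU av aU bv bU.
  have -> : v |: (s |: [set a; b]) != U.
    apply/eqP => E; move: n5; rewrite -E cardsU1 cardsU1 sab cards2 ab; case: (_ \notin _); clear; lia.
  rewrite !inE !eqxx !orbT => /(_ isT isT isT isT).
  rewrite ![cst L [set s] _]cstC; have := has3_cst h3a; have := has3_cst h3b; clear; lia.
Qed.

(** Adding [v] to a set leaves potential at least 6 unless [U] is exhausted, so a cost of [k + 4]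
    from [v] into the set forces potential at least [k + 5]. *)
Lemma vertex_gadget_dg v h1 h2 t k : v \in U -> h1 \in hed L v -> h2 \in hed L v ->
  (k = 2 \/ k = 3 /\ 4 < #|U|)%N -> (k + 6 <= dv v)%N ->
  (forall S, nbr h1 \in S -> nbr h2 \in S -> k + 4 <= dg v S)%N ->
  exists2 f, pcol f (U :\ v) L & (k <= (start f h2 - start f h1 - t)%R)%N.
Proof.
move=> vU hh1 hh2 k23 hdv hD.
have [_ aU av k1] := hedU M hh1; have [_ bU bv k2] := hedU M hh2.
apply: vertex_gadget => //.
- apply/eqP => ab; have c2 : (#|[set v; nbr h1]| <= 2)%N by rewrite cards2; case: (_ == _).
  have [z zU zT] := small_out (ltnW U_gt3) c2.
  have := @P_del v [set nbr h1] z vU; rewrite inE eq_sym av sub1set aU cards1.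
  rewrite zU zT => /(_ isT isT isT isT isT); rewrite (P1 M).
  by have := hD [set nbr h1]; rewrite -ab inE eqxx => /(_ isT isT); move: k23; clear; lia.
- move=> S SU SnU aS bS; have vS : v \notin S by apply/negP => /(subsetP SU); rewrite !inE eqxx.
  have SU' : S \subset U by apply: subset_trans SU (subD1set _ _).
  have vSU : v |: S \subset U by rewrite subUset sub1set vU.
  have [z zU zT] := notU_out vSU SnU.
  have S0 : (0 < #|S|)%N by apply/card_gt0P; exists (nbr h1).
  have := P_del vU vS SU' S0 zU zT; have := hD S aS bS; clear; lia.
Qed.

Lemma no_extension_perm v f s c : v \in U -> pcol f (U :\ v) L -> perm_eq (hed L v) s ->
  all (fun h => okh f h c) s -> False.
Proof.
move=> vU pf ps /allP hc; apply: (no_extension M vU pf (c := c)) => h.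
by rewrite (perm_mem ps); apply: hc.
Qed.

Lemma okh_shift f h h0 (d : Z5) :
  okh f h (start f h0 + d) = (hk h <= (d - (start f h - start f h0))%R)%N.
Proof. by rewrite /okh; congr (leq _ (nat_of_ord _)); ring. Qed.

(** Cost 8 means weights (3,1,1) or (2,2,1); a gadget of weight 2 between the neighbours along the
    two heaviest half-edges makes their arcs overlap. *)
Lemma dv9 v : v \in U -> (9 <= dv v)%N.
Proof.
move=> vU; have := dv8 M vU; have kd := dv_kv L v; have d3 := deg3 M vU; have k5 := kv5 M vU.
rewrite leq_eqVlt => /orP[/eqP d8|//]; exfalso.
have [s ps ss] := perm_sorted L v; have [kE dE gE] := hed_subseq ps.
have sz0 : size (hed L v) = 3%N by move: kd d3 k5 d8; clear; lia.
have sz : size s = 3%N by rewrite -(perm_size ps).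
have ks : kv v = 5%N by move: kd d3 k5 d8; clear; lia.
have hs h : h \in s -> h \in hed L v by rewrite (perm_mem ps).
case: s sz ps ss kE dE gE hs => [|h1 [|h2 [|h3 [|]]]] //= _ ps; rewrite andbT => /andP[k21 k32].
rewrite ks !big_cons !big_nil => kE dE gE hs.
have h1s := hs h1 (mem_head _ _); have h2s : h2 \in hed L v by apply: hs; rewrite !inE eqxx orbT.
have h3s : h3 \in hed L v by apply: hs; rewrite !inE eqxx !orbT.
have [_ _ _ b1] := hedU M h1s; have [_ _ _ b2] := hedU M h2s; have [_ _ _ b3] := hedU M h3s.
pose t : Z5 := if hk h1 == 3%N then 3%:R else 2%:R.
have [||f pf fk] := vertex_gadget_dg (k := 2) t vU h1s h2s (or_introl erefl).
- by move: d8; clear; lia.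
- by move=> S aS bS; rewrite gE !big_cons aS bS; case: ifP; move: kE k21 k32 b1 b2 b3; clear; lia.
have [c] : exists c : Z5, [&& hk h1 <= c, hk h2 <= (c - (start f h2 - start f h1))%R
    & hk h3 <= (c - (start f h3 - start f h1))%R]%N.
  have [[E1 [E2 E3]]|[E1 [E2 E3]]] : (hk h1 = 3 /\ hk h2 = 1 /\ hk h3 = 1)%N \/ (hk h1 = 2 /\ hk h2 = 2 /\ hk h3 = 1)%N.
  - by move: kE k21 k32 b1 b2 b3; clear; lia.
  - by move: fk; rewrite /t E1 E2 E3 eqxx; apply: arcs311.
  - by move: fk; rewrite /t E1 E2 E3 /=; apply: arcs221.
case/and3P => c1 c2 c3; apply: (no_extension_perm vU pf ps (c := start f h1 + c)).
by rewrite /= !okh_shift subrr subr0 c1 c2 c3.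
Qed.

Lemma U_gt5 : (5 < #|U|)%N.
Proof.
have := sum_dv_lt; have lb : (9 * #|U| <= \sum_(v in U) dv v)%N; last by move: lb; clear; lia.
by rewrite mulnC -sum_nat_const; apply: leq_sum => v vU; exact: dv9.
Qed.

(** The only other weights are (3,2,1), where a gadget of weight 3 puts the arc of length 2 inside
    the arc of length 3. *)
Lemma dv9_deg3 v s : v \in U -> dv v = 9%N -> size s = 3%N -> perm_eq (hed L v) s ->
  all (fun h => hk h == 2%N) s.
Proof.
move=> vU d9 sz ps.
have {ps sz} [s' ps' [ss sz ps]] : exists2 s', perm_eq (hed L v) s' &
    [/\ sorted (fun h1 h2 => hk h2 <= hk h1)%N s', size s' = 3%N & perm_eq s s'].
  have [s' p1 p2] := perm_sorted L v; exists s' => //; split=> //.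
    by rewrite -(perm_size p1) (perm_size ps).
  by rewrite -(permPl ps).
rewrite (perm_all _ ps) => {s ps}.
have [kE dE gE] := hed_subseq ps'; have kd := dv_kv L v; rewrite (etrans (perm_size ps') sz : size (hed L v) = 3%N) d9 in kd.
have hs h : h \in s' -> h \in hed L v by rewrite (perm_mem ps').
case: s' sz ps' ss kE dE gE hs kd => [|h1 [|h2 [|h3 [|]]]] //= _ ps; rewrite andbT => /andP[k21 k32].
rewrite !big_cons !big_nil => kE dE gE hs kd.
have h1s := hs h1 (mem_head _ _); have h2s : h2 \in hed L v by apply: hs; rewrite !inE eqxx orbT.
have h3s : h3 \in hed L v by apply: hs; rewrite !inE eqxx !orbT.
have [_ _ _ b1] := hedU M h1s; have [_ _ _ b2] := hedU M h2s; have [_ _ _ b3] := hedU M h3s.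
rewrite andbT; have [/eqP k1|k1] := boolP (hk h1 == 3%N); last first.
  by move: kE kd k21 k32 b1 b2 b3 k1; clear; lia.
exfalso; have [E2 E3] : (hk h2 = 2 /\ hk h3 = 1)%N by move: kE kd k21 k32 b1 b2 b3 k1; clear; lia.
have [|||f pf fk] := vertex_gadget_dg (k := 3) 2%:R vU h1s h2s.
- by right; split=> //; move: U_gt5; clear; lia.
- by rewrite d9.
- by move=> S aS bS; rewrite gE !big_cons aS bS k1 E2; case: ifP; clear; lia.
have [c /and3P[c1 c2 c3]] := arcs321 (start f h3 - start f h1) fk.
apply: (no_extension_perm vU pf ps (c := start f h1 + c)).
by rewrite /= !okh_shift subrr subr0 k1 E2 E3 c1 c2 c3.
Qed.

End Minimal.

(** * Vertices of type (2,1,1,1) *)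

Lemma arcs2111_gad (d1 d2 d3 : Z5) : (3 <= (d1 - 2%:R)%R)%N ->
  exists c : Z5, [&& 2 <= c, 1 <= (c - d1)%R, 1 <= (c - d2)%R & 1 <= (c - d3)%R]%N.
Proof. by elim/forall_Z5: d1 => // _; elim/forall_Z5: d2; elim/forall_Z5: d3; z5ex. Qed.

(** The hypothesis makes two of the forbidden sets overlap: two points coincide, or one lies in the
    arc of length 2. *)
Lemma arcs2111 (d1 d2 d3 : Z5) : [|| d1 == d2, ~~ (2 <= d1)%N | ~~ (2 <= d2)%N] ->
  exists c : Z5, [&& 2 <= c, 1 <= (c - d1)%R, 1 <= (c - d2)%R & 1 <= (c - d3)%R]%N.
Proof.
by elim/forall_Z5: d1; elim/forall_Z5: d2 => // _; elim/forall_Z5: d3; z5ex.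
Qed.

(* Two pairs of colours both contained in a set of three must intersect. *)
Lemma pick2111 (x x' y y' : Z5) : (1 <= (x' - x)%R)%N -> (1 <= (y' - y)%R)%N ->
  exists b1 b2 : bool, let p := if b1 then x else x' in let q := if b2 then y else y' in
    [|| p == q, ~~ (2 <= p)%N | ~~ (2 <= q)%N].
Proof.
by elim/forall_Z5: x; elim/forall_Z5: x' => // _; elim/forall_Z5: y; elim/forall_Z5: y' => // _;
  first [by exists true, true | by exists true, false | by exists false, true | by exists false, false].
Qed.

(** Submodularity of the potential, with the exact defect. *)
Lemma potUI (V : finType) (L : seq (gedge V)) (A B : {set V}) :
  pot L (A :|: B) + pot L (A :&: B) + (cst L (A :\: B) (B :\: A))%:Z = pot L A + pot L B.
Proof.
have E : (cost (A :|: B) L + cost (A :&: B) L = cost A L + cost B L + cst L (A :\: B) (B :\: A))%N.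
  rewrite /cost /cst (big_mkcond (inside (A :|: B))) (big_mkcond (inside (A :&: B))).
  rewrite (big_mkcond (inside A)) (big_mkcond (inside B)) (big_mkcond (cross (A :\: B) (B :\: A))).
  rewrite -!big_split /=.
  apply: eq_bigr => e _; rewrite /inside /cross !inE.
  by case: (src e \in A); case: (src e \in B); case: (tgt e \in A); case: (tgt e \in B); rewrite /=; lia.
by have := cardsUI A B; rewrite /pot; lia.
Qed.

Lemma cst_neq1 (V : finType) (L : seq (gedge V)) (A B : {set V}) : weighted L -> cst L A B != 1%N.
Proof.
elim: L => [|e L IH] /=; first by rewrite /cst big_nil.
by case/andP => we /IH; rewrite /cst big_cons; case: ifP => // _ _; move: we; lia.
Qed.

Section Minimal.
Variables (V : finType) (U : {set V}) (L : seq (gedge V)).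
Hypothesis M : minimal U L.
Implicit Types (S R Q : {set V}) (u v x y z : V) (h : hedge V) (f : V -> Z5).

Notation P := (pot L).
Let sp : sparse U L := min_sparse M.
Let wL : weighted L := sp_wt sp.
Local Notation dg := (dg L).
Local Notation dv := (dv L).

Lemma dg1 v a : v \in U -> a \in U -> a != v -> (dg v [set a] <= 4)%N.
Proof.
move=> vU aU av; have c2 : (#|[set v; a]| <= 2)%N by rewrite cards2; case: (_ == _).
have [z zU zT] := small_out M (ltnW (U_gt3 M)) c2.
have := P_del M (v := v) (S := [set a]) (z := z) vU; rewrite inE eq_sym av sub1set aU cards1.
by rewrite zU zT (P1 M) => /(_ isT isT isT isT isT); clear; lia.
Qed.

Section Type2111.
Variables (v : V) (hc h1 h2 h3 : hedge V).
Hypotheses (vU : v \in U) (ps : perm_eq (hed L v) [:: hc; h1; h2; h3]).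
Hypotheses (kc : hk hc = 2%N) (k1 : hk h1 = 1%N) (k2 : hk h2 = 1%N) (k3 : hk h3 = 1%N).

Let hs h : h \in [:: hc; h1; h2; h3] -> h \in hed L v.
Proof. by rewrite (perm_mem ps). Qed.

Let hcs : hc \in hed L v. Proof. by apply: hs; rewrite !inE eqxx. Qed.
Let h1s : h1 \in hed L v. Proof. by apply: hs; rewrite !inE eqxx ?orbT. Qed.
Let h3s : h3 \in hed L v. Proof. by apply: hs; rewrite !inE eqxx ?orbT. Qed.

Lemma dg2111 S : dg v S = (3 * (nbr hc \in S) + 2 * (nbr h1 \in S) + 2 * (nbr h2 \in S) + 2 * (nbr h3 \in S))%N.
Proof.
have [_ _ ->] := hed_subseq ps; rewrite !big_cons big_nil kc k1 k2 k3.
by do 4 case: (_ \in S).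
Qed.

(** A gadget of weight 3 between the neighbours along [hc] and [h1] would put the point of [h1] into
    the arc of [hc] and free a colour. Only a set of too small potential can prevent it. *)
Lemma blocking2111 : exists S, [/\ S \subset U :\ v, v |: S != U, nbr hc \in S, nbr h1 \in S & P S <= 7].
Proof.
case: (pickP (fun S : {set V} => [&& S \subset U :\ v, v |: S != U, nbr hc \in S, nbr h1 \in S & P S <= 7])) => [S /and5P[? ? ? ? ?]|no].
  by exists S.
exfalso; have [||||f pf fk] := vertex_gadget M (k := 3) 2%:R vU hcs h1s.
- apply/eqP => E; have [_ aU av _] := hedU M hcs.
  by have := dg1 vU aU av; rewrite dg2111 -E !inE eqxx; clear; lia.
- by right; split=> //; move: (U_gt5 M); clear; lia.
- by have [_ -> _] := hed_subseq ps; rewrite !big_cons big_nil kc k1 k2 k3.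
- move=> S h h' h'' h3'; have := no S; rewrite h h' h'' h3' /= => /negbT; rewrite -ltNge; clear; lia.
have [c /and4P[c1 c2 c3 c4]] := arcs2111_gad (start f h2 - start f hc) (start f h3 - start f hc) fk.
apply: (no_extension_perm M vU pf ps (c := start f hc + c)).
by rewrite /= !okh_shift subrr subr0 kc k1 k2 k3 c1 c2 c3 c4.
Qed.

(** A third neighbour in [S] would raise the cost from [v] into [S] to 7, hence the potential to
    8. *)
Lemma blocking_sep S : S \subset U :\ v -> v |: S != U -> nbr hc \in S -> nbr h1 \in S -> P S <= 7 ->
  nbr h2 \notin S /\ nbr h3 \notin S.
Proof.
move=> SU SnU cS aS PS; have vS : v \notin S by apply/negP => /(subsetP SU); rewrite !inE eqxx.
have SU' : S \subset U by apply: subset_trans SU (subD1set _ _).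
have vSU : v |: S \subset U by rewrite subUset sub1set vU.
have [z zU zT] := notU_out vSU SnU.
have S0 : (0 < #|S|)%N by apply/card_gt0P; exists (nbr hc).
have := P_del M vU vS SU' S0 zU zT; rewrite dg2111 cS aS => h.
by split; apply/negP => e; move: h; rewrite e; move: PS; clear; lia.
Qed.

Let nv h : h \in hed L v -> nbr h \in U /\ nbr h != v.
Proof. by case/(hedU M). Qed.

(** Larger sets have potential at least 7, and at least 8 unless they contain [nbr h3] and exhaust
    [U] together with [v]. A local obstruction to [extend] leaves at most 7, so it must be of the
    latter kind. A vertex with five forbidden differences is then [nbr h3], with cost 9 and three
    half-edges, one of weight 1, against [dv9_deg3]. A triangle has a vertex other than [nbr h3],
    all of whose neighbours are inside, so the loss is 4 and not 2. *)
Lemma ext2111 R f : R \subset U :\ v -> nbr hc \in R -> nbr h1 \in R -> nbr h2 \in R ->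
  nbr h3 \notin R -> P R <= 9 -> pcol f R L ->
  exists g, pcol g (U :\ v) L /\ {in R, g =1 f}.
Proof.
move=> RS cR aR bR dR PR pf; have SU : U :\ v \subset U := subD1set _ _.
have R0 : (0 < #|R|)%N by apply/card_gt0P; exists (nbr hc).
have cS : (#|(U :\ v) :\: R|.+1 < #|U|)%N.
  have := cardsID R (U :\ v); rewrite (setIidPr RS) (cardsD1 v U) vU; move: R0; clear; lia.
have inD y : y \in (U :\ v) :\: R -> [/\ y \in U :\ v, y \in U, y != v & y \notin R].
  by rewrite inE => /andP[-> yS]; rewrite yS; move: yS; rewrite !inE => /andP[-> ->].
have vn (T : {set V}) : T \subset U :\ v -> v \notin T.
  by move=> TU; apply/negP => /(subsetP TU); rewrite !inE eqxx.
have lb (T : {set V}) : R \subset T -> T \subset U :\ v -> 7 <= P T /\ (nbr h3 \notin T -> 8 <= P T).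
  move=> RT TU; have dT : (7 <= dg v T)%N by rewrite dg2111 (subsetP RT _ cR) (subsetP RT _ aR) (subsetP RT _ bR); clear; lia.
  have TU' := subset_trans TU SU; have vT := vn T TU.
  have T0 : (0 < #|T|)%N := leq_trans R0 (subset_leq_card RT).
  have dl (z : V) : z \in U -> z \notin v |: T -> 8 <= P T.
    by move=> zU zT; have := P_del M vU vT TU' T0 zU zT; move: dT; clear; lia.
  have [h3U h3v] := nv h3s; split=> [|h3T]; last first.
    by apply: (dl _ h3U); rewrite !inE negb_or h3v.
  have [E|nE] := eqVneq (v |: T) U; last first.
    have vTU : v |: T \subset U by rewrite subUset sub1set vU.
    by have [z zU zT] := notU_out vTU nE; have := dl z zU zT; clear; lia.
  have := P_del_full M vU vT TU'; rewrite (dv_dg M) //.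
    by have [_ -> _] := hed_subseq ps; rewrite !big_cons big_nil kc k1 k2 k3; clear; lia.
  by rewrite -E; apply/subsetP => x; rewrite !inE; case: (x == v).
have hv y : y \in U -> y \notin R -> y != nbr h3 -> forall h, h \in hed L y -> nbr h != v.
  move=> yU yR y3 h hh; apply: contraNneq yR => E; have := hed_sym hh; rewrite E (perm_mem ps) !inE.
  case/or4P => /eqP E'; [move: cR|move: aR|move: bR|move: y3]; rewrite -E' /nbr //= ?eqxx //.
have R_lt (T : {set V}) y : y \in T -> y \notin R -> R \subset T -> R \proper T.
  by move=> yT yR RT; rewrite properE RT; apply/negP => /subsetP/(_ y yT); apply/negP.
have [x0 x0R] : exists x0, x0 \in R by exists (nbr hc).
apply: (extend (min_IH M) x0R RS cS pf).
- by apply: sparse_sub sp; apply: subset_trans (subsetDl _ _) SU.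
- by move=> T RT TS; have [b _] := lb T (proper_sub RT) TS; move: b PR; clear; lia.
- move=> y /inD[yS yU yv yR]; rewrite leqNgt; apply/negP => k5.
  have [b1 _] := kap_bound M yU yR k5; have TS : y |: R \subset U :\ v by rewrite subUset sub1set yS.
  have [b2 b3] := lb (y |: R) (subsetUr _ _) TS.
  have y3 : nbr h3 = y.
    apply/eqP; apply: contraTT b1 => n3; rewrite -ltNge.
    have := b3; rewrite in_setU1 negb_or n3 dR => /(_ isT); move: PR; clear; lia.
  have vR : v \notin R := vn R RS.
  have [vcst vkap] : cst L [set y] [set v] = 2%N /\ kap L [set y] [set v] = 1%N.
    rewrite cstC kapC cst_hed ?inE 1?eq_sym // kap_hed ?inE 1?eq_sym //.
    rewrite !(perm_big _ ps) !big_cons !big_nil k3 !inE y3 eqxx.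
    have E z : z \in R -> (z == y) = false by move=> zR; apply: contraNF yR => /eqP <-.
    by rewrite !E.
  have vTU : v |: (y |: R) = U.
    apply/eqP; apply: contraTT b1 => nE; rewrite -ltNge.
    have vS' : v \notin y |: R := vn _ TS.
    have TU := subset_trans TS SU.
    have vU' : v |: (y |: R) \subset U by rewrite subUset sub1set vU.
    have [z zU zT] := notU_out vU' nE.
    have T0 : (0 < #|y |: R|)%N by apply/card_gt0P; exists y; rewrite setU11.
    have := P_del M vU vS' TU T0 zU zT; rewrite dg2111 !in_setU1 cR aR bR !orbT y3 eqxx.
    by move: PR; clear; lia.
  have nb h : h \in hed L y -> nbr h \in v |: R.
    move=> hh; have [_ hU hy _] := hedU M hh; move: hU; rewrite -vTU !in_setU1 (negbTE hy) //.
  have [dE kE] := cst_total yR yv vR nb.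
  have kc4 := kap_cst [set y] R wL; have PE := P_cst M yR.
  have kd := dv_kv L y.
  have d9 : dv y = 9%N by move: dE PE kc4 k5 b2 PR vcst; clear; lia.
  have sz : size (hed L y) = 3%N by move: dE PE kc4 k5 b2 PR vcst vkap kE kd; clear; lia.
  have /allP al := dv9_deg3 M yU d9 sz (perm_refl _).
  have hh : (v, flip h3.2) \in hed L y by rewrite -y3; exact: hed_sym h3s.
  by have := al _ hh; rewrite [hk _]k3.
- move=> y z /inD[yS yU yv yR] /inD[zS zU zv zR] yz; apply/negP => t3.
  wlog y3 : y z yS yU yv yR zS zU zv zR yz t3 / y != nbr h3.
    move=> W; have [y3|n3] := eqVneq y (nbr h3); last exact: (W y z).
    apply: (W z y) => //; rewrite 1?eq_sym //; last by rewrite -y3.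
    by case/and3P: t3 => t1 t2 t3; rewrite has3C t1 t3 t2.
  have [b1 b1'] := tri_bound M yU zU yz yR zR t3.
  have TS : z |: (y |: R) \subset U :\ v by rewrite !subUset !sub1set yS zS.
  have RT : R \subset z |: (y |: R) by rewrite setUA subsetUr.
  have [b2 b3] := lb _ RT TS.
  have [E|nE] := eqVneq (v |: (z |: (y |: R))) U.
    have nb h : h \in hed L y -> nbr h \in z |: R.
      move=> hh; have [_ hU hy _] := hedU M hh; move: hU; rewrite -E !in_setU1 (negbTE hy) /=.
      by rewrite (negbTE (hv y yU yR y3 h hh)).
    by have := b1' nb; move: b2 PR; clear; lia.
  have vS' : v \notin z |: (y |: R) := vn _ TS.
  have TU := subset_trans TS SU.
  have vU' : v |: (z |: (y |: R)) \subset U by rewrite subUset sub1set vU.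
  have [w wU wT] := notU_out vU' nE.
  have T0 : (0 < #|z |: (y |: R)|)%N by apply/card_gt0P; exists z; rewrite setU11.
  have := P_del M vU vS' TU T0 wU wT; rewrite dg2111 !in_setU1 cR aR bR !orbT.
  by move: PR b1; clear; lia.
Qed.

End Type2111.

(** Sets of two or more vertices missing [z] have potential at least 6, which leaves room for an
    extra edge of weight 1 when [J], of potential at most 6, is collapsed. *)
Lemma avoid_color (J S : {set V}) a (d : Z5) f z : J \subset S -> S \subset U -> (0 < #|J|)%N -> P J <= 6 ->
  a \in S -> a \notin J -> z \in U -> z \notin S -> pcol f J L ->
  exists g, [/\ pcol g S L, {in J, g =1 f} & (1 <= (g a - d)%R)%N].
Proof.
move=> JS SU J0 PJ aS aJ zU zS pf; apply: (@extend2 V U L M J S f a d 1%N JS SU J0) => //.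
- have SzU : S \subset U :\ z.
    by apply/subsetP => y yS; rewrite !inE (subsetP SU _ yS) andbT; apply: contraNneq zS => <-.
  have := cardsID J S; rewrite (setIidPr JS) [in ltnRHS](cardsD1 z U) zU.
  by have := subset_leq_card SzU; move: J0; clear; lia.
- by right.
- move=> T JT TS; have TU := subset_trans TS SU.
  have := pot_ge6_out M TU _ zU; rewrite (contraNN (subsetP TS z) zS) => h.
  have T1 : (1 < #|T|)%N by have := proper_card JT; move: J0; clear; lia.
  by have := h T1 isT; move: PJ; case: ifP; clear; lia.
Qed.

(* The neighbours by light edges play symmetric roles. *)
Lemma no2111 v hc h1 h2 h3 : v \in U -> perm_eq (hed L v) [:: hc; h1; h2; h3] ->
  hk hc = 2%N -> hk h1 = 1%N -> hk h2 = 1%N -> hk h3 = 1%N -> False.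
Proof.
move=> vU ps kc k1 k2 k3; have ps' : perm_eq (hed L v) [:: hc; h2; h1; h3].
  by apply: (perm_trans ps); rewrite perm_cons (perm_catCA [:: h1] [:: h2] [:: h3]).
have [S1 [S1U S1n cS1 aS1 PS1]] := blocking2111 vU ps kc k1 k2 k3.
have [S2 [S2U S2n cS2 aS2 PS2]] := blocking2111 vU ps' kc k2 k1 k3.
have [h2S1 h3S1] := blocking_sep vU ps kc k1 k2 k3 S1U S1n cS1 aS1 PS1.
have [h1S2 h3S2] := blocking_sep vU ps' kc k2 k1 k3 S2U S2n cS2 aS2 PS2.
have SU : U :\ v \subset U := subD1set _ _.
have hs h : h \in [:: hc; h1; h2; h3] -> nbr h \in U /\ nbr h != v.
  by rewrite -(perm_mem ps) => /(hedU M)[].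
have [h1U h1v] : nbr h1 \in U /\ nbr h1 != v by apply: hs; rewrite !inE eqxx ?orbT.
have [h2U h2v] : nbr h2 \in U /\ nbr h2 != v by apply: hs; rewrite !inE eqxx ?orbT.
have [h3U h3v] : nbr h3 \in U /\ nbr h3 != v by apply: hs; rewrite !inE eqxx ?orbT.
set J := S1 :&: S2; set U0 := S1 :|: S2.
have cJ : nbr hc \in J by rewrite inE cS1.
have J0 : (0 < #|J|)%N by apply/card_gt0P; exists (nbr hc).
have U0U : U0 \subset U :\ v by rewrite subUset S1U.
have PU0 : 8 <= P U0.
  have vU0 : v \notin U0 by apply/negP => /(subsetP U0U); rewrite !inE eqxx.
  have U00 : (0 < #|U0|)%N by apply/card_gt0P; exists (nbr hc); rewrite inE cS1.
  have := P_del M vU vU0 (subset_trans U0U SU) U00 h3U.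
  rewrite !inE (negbTE h3v) (negbTE h3S1) (negbTE h3S2) (dg2111 ps) // !inE cS1 aS1 aS2 orbT.
  by move=> /(_ isT); clear; lia.
have JU : J \subset U by apply: subset_trans (subsetIl _ _) (subset_trans S1U SU).
have PJ : 5 <= P J.
  have [J1|J1] := leqP #|J| 1; last first.
    by apply: le_trans (pot_ge6_out M JU J1 h1U _); rewrite // inE (negbTE h1S2) andbF.
  have /eqP/cards1P[x ->] : (#|J| = 1)%N by move: J0 J1; clear; lia.
  by rewrite (P1 M).
(* The blocking sets have potential at most 7, their union at least 8 and their intersection at
   least 5. So at most 1 remains for the edges between the two differences, and since an edge costs
   at least 2 there are none. *)
have UI := potUI L S1 S2; rewrite -/U0 -/J in UI.
have X2 : cst L (S1 :\: S2) (S2 :\: S1) != 1%N by apply: cst_neq1.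
have [PJ6 PU09 X0] : [/\ P J <= 6, P U0 <= 9 & cst L (S1 :\: S2) (S2 :\: S1) = 0%N].
  by move: UI X2 PJ PU0 PS1 PS2; clear; move=> UI X2 PJ PU0 PS1 PS2; split; lia.
have [f pf] : colorable J L.
  by apply: (colored M); apply/properP; split=> //; exists (nbr h1); rewrite // inE (negbTE h1S2) andbF.
have Ja : nbr h1 \notin J by rewrite inE negb_and h1S2 orbT.
have Jb : nbr h2 \notin J by rewrite inE negb_and h2S1.
pose st h c : Z5 := c + h.2.1 - start f hc.
have av1 d : exists g, [/\ pcol g S1 L, {in J, g =1 f} & (1 <= (st h1 (g (nbr h1)) - d)%R)%N].
  have [g [g1 g2 g3]] := avoid_color (d - h1.2.1 + start f hc) (subsetIl S1 S2) (subset_trans S1U SU) J0 PJ6 aS1 Ja h2U h2S1 pf.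
  by exists g; split=> //; apply: etrans g3; congr (leq _ (nat_of_ord _)); rewrite /st; ring.
have av2 d : exists g, [/\ pcol g S2 L, {in J, g =1 f} & (1 <= (st h2 (g (nbr h2)) - d)%R)%N].
  have [g [g1 g2 g3]] := avoid_color (d - h2.2.1 + start f hc) (subsetIr S1 S2) (subset_trans S2U SU) J0 PJ6 aS2 Jb h1U h1S2 pf.
  by exists g; split=> //; apply: etrans g3; congr (leq _ (nat_of_ord _)); rewrite /st; ring.
(* Starting from one colouring of the intersection, each blocking set offers two different colours
   for its light neighbour. After the choice of [pick2111] the two colourings are glued; no edge
   crosses. *)
have [g1 [pg1 gJ1 _]] := av1 0; have [g1' [pg1' gJ1' n1]] := av1 (st h1 (g1 (nbr h1))).
have [g2 [pg2 gJ2 _]] := av2 0; have [g2' [pg2' gJ2' n2]] := av2 (st h2 (g2 (nbr h2))).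
have [b1 [b2 /= E]] := pick2111 n1 n2.
have {pg1 pg1' gJ1 gJ1' n1} [k [pk kJ kE]] : exists k, [/\ pcol k S1 L, {in J, k =1 f} &
    st h1 (k (nbr h1)) = if b1 then st h1 (g1 (nbr h1)) else st h1 (g1' (nbr h1))].
  by case: b1 {E}; [exists g1 | exists g1'].
have {pg2 pg2' gJ2 gJ2' n2} [l [pl lJ lE]] : exists l, [/\ pcol l S2 L, {in J, l =1 f} &
    st h2 (l (nbr h2)) = if b2 then st h2 (g2 (nbr h2)) else st h2 (g2' (nbr h2))].
  by case: b2 {E}; [exists g2 | exists g2'].
rewrite -kE -lE in E.
pose m y := if y \in S1 then k y else l y.
have mS1 : {in S1, m =1 k} by move=> y yS; rewrite /m yS.
have mS2 : {in S2, m =1 l}.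
  by move=> y yS; rewrite /m; case: ifP => // yS1; rewrite kJ ?lJ // inE yS1.
have pm : pcol m U0 L.
  apply/allP => e eL; apply/implyP; rewrite /inside !inE => /andP[].
  have := allP pk _ eL; have := allP pl _ eL; rewrite /inside /sat => /implyP q2 /implyP q1.
  have := sum_nat_seq_eq0 L (cross (S1 :\: S2) (S2 :\: S1)) (fun e => (wt e).+1).
  rewrite -/(cst _ _ _) X0 eqxx => /esym/allP/(_ e eL); rewrite implybF /cross !inE => nc.
  have [t1|t1] := boolP (tgt e \in S1); have [u1|u1] := boolP (src e \in S1).
  - by move=> _ _; rewrite !mS1 // q1 // u1.
  - rewrite /= => u2 _; have t2 : tgt e \in S2.
      by move: nc; rewrite t1 (negbTE u1) u2; case: (tgt e \in S2).
    by rewrite !mS2 // q2 // u2.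
  - rewrite /= => _ t2; have u2 : src e \in S2.
      by move: nc; rewrite u1 (negbTE t1) t2; case: (src e \in S2).
    by rewrite !mS2 // q2 // u2.
  - by rewrite /= => u2 t2; rewrite !mS2 // q2 // u2.
have cU0 : nbr hc \in U0 by rewrite inE cS1.
have aU0 : nbr h1 \in U0 by rewrite inE aS1.
have bU0 : nbr h2 \in U0 by rewrite inE aS2 orbT.
have dU0 : nbr h3 \notin U0 by rewrite inE negb_or h3S1.
have [g [pg gm]] := ext2111 vU ps kc k1 k2 k3 U0U cU0 aU0 bU0 dU0 PU09 pm.
have sc : start g hc = start f hc by rewrite /start gm ?inE ?cS1 // mS1 // kJ.
have s1 : start g h1 - start g hc = st h1 (k (nbr h1)) by rewrite sc /start gm ?inE ?aS1 // mS1.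
have s2 : start g h2 - start g hc = st h2 (l (nbr h2)) by rewrite sc /start gm ?inE ?aS2 ?orbT // mS2.
rewrite -s1 -s2 in E.
have [c /and4P[c1 c2 c3 c4]] := arcs2111 (start g h3 - start g hc) E.
apply: (no_extension_perm M vU pg ps (c := start g hc + c)).
by rewrite /= !okh_shift subrr subr0 kc k1 k2 k3 c1 c2 c3 c4.
Qed.

End Minimal.

(** * Vertices of type (2,2,2) *)

Lemma arcs22 (d : Z5) : (2 <= (d - 2%:R)%R)%N ->
  exists x : Z5, [&& 2 <= x, 2 <= (x - d)%R, 2 <= (x + 1)%R & 2 <= (x + 1 - d)%R]%N.
Proof. by elim/forall_Z5: d => // _; z5ex. Qed.

Lemma arc_miss (x : Z5) (s : Z5) : (1 <= (s - x)%R)%N -> (2 <= (x - s)%R)%N || (2 <= (x + 1 - s)%R)%N.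
Proof. by elim/forall_Z5: x; elim/forall_Z5: s. Qed.

Lemma points_miss (x s t : Z5) : (2 <= (s - x)%R)%N ->
  ((1 <= (x - s)%R) && (1 <= (x - t)%R) || (1 <= (x + 1 - s)%R) && (1 <= (x + 1 - t)%R))%N.
Proof. by elim/forall_Z5: x; elim/forall_Z5: s => // _; elim/forall_Z5: t. Qed.

Section Minimal.
Variables (V : finType) (U : {set V}) (L : seq (gedge V)).
Hypothesis M : minimal U L.
Implicit Types (S R Q : {set V}) (u v x y z : V) (h : hedge V) (f : V -> Z5).

Notation P := (pot L).
Let sp : sparse U L := min_sparse M.
Let wL : weighted L := sp_wt sp.
Local Notation dg := (dg L).
Local Notation dv := (dv L).

Lemma card_del v R S : v \in U -> S \subset U :\ v -> R \subset S -> (0 < #|R|)%N -> (#|S :\: R|.+1 < #|U|)%N.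
Proof.
move=> vU SU RS; have := cardsID R S; rewrite (setIidPr RS).
have := subset_leq_card SU; have := cardsD1 v U; rewrite vU; lia.
Qed.

Lemma notin_del v S : S \subset U :\ v -> v \notin S.
Proof. by move=> SU; apply/negP => /(subsetP SU); rewrite !inE eqxx. Qed.

Lemma sub_del v S : S \subset U :\ v -> S \subset U.
Proof. by move/subset_trans; apply; apply: subD1set. Qed.

(** Adding [v] leaves potential at least 6 if a vertex remains outside, and at least 3 otherwise. *)
Lemma P_delE v S : v \in U -> S \subset U :\ v -> (0 < #|S|)%N ->
  (dg v S)%:Z + 1 <= P S \/ (v |: S = U /\ (dv v)%:Z - 2 <= P S).
Proof.
move=> vU SU S0; have vS := notin_del SU; have SU' := sub_del SU.
have [E|nE] := eqVneq (v |: S) U.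
  right; split=> //; have := P_del_full M vU vS SU'; rewrite (dv_dg M) //.
  by rewrite -E; apply/subsetP => x; rewrite !inE; case: (x == v).
have vSU : v |: S \subset U by rewrite subUset sub1set vU.
by have [z zU zT] := notU_out vSU nE; left; apply: (P_del M vU vS SU' S0 zU zT).
Qed.

Lemma kap_pair x y : x != y -> 7 <= P [set x; y] -> (kap L [set x] [set y] <= 2)%N.
Proof.
move=> xy; rewrite (P2 M xy); have := kap_cst [set x] [set y] wL; clear; lia.
Qed.

Section Type222.
Variables (v : V) (hw hp hq : hedge V).
Hypotheses (vU : v \in U) (ps : perm_eq (hed L v) [:: hw; hp; hq]).
Hypotheses (kw : hk hw = 2%N) (kp : hk hp = 2%N) (kq : hk hq = 2%N).

Lemma dg222 S : dg v S = (3 * (nbr hw \in S) + 3 * (nbr hp \in S) + 3 * (nbr hq \in S))%N.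
Proof.
have [_ _ ->] := hed_subseq ps; rewrite !big_cons big_nil kw kp kq.
by do 3 case: (_ \in S).
Qed.

Lemma nbrs222 : [/\ [/\ nbr hw \in U, nbr hp \in U & nbr hq \in U],
  [/\ nbr hw != v, nbr hp != v & nbr hq != v] &
  [/\ nbr hw != nbr hp, nbr hw != nbr hq & nbr hp != nbr hq]].
Proof.
have hs h : h \in [:: hw; hp; hq] -> [/\ nbr h \in U, nbr h != v & (dg v [set nbr h] <= 4)%N].
  by rewrite -(perm_mem ps) => /(hedU M)[_ hU hv _]; split=> //; apply: (dg1 M).
have [a1 b1 c1] : [/\ nbr hw \in U, nbr hw != v & (dg v [set nbr hw] <= 4)%N] by apply: hs; rewrite !inE eqxx ?orbT.
have [a2 b2 c2] : [/\ nbr hp \in U, nbr hp != v & (dg v [set nbr hp] <= 4)%N] by apply: hs; rewrite !inE eqxx ?orbT.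
have [a3 b3 c3] : [/\ nbr hq \in U, nbr hq != v & (dg v [set nbr hq] <= 4)%N] by apply: hs; rewrite !inE eqxx ?orbT.
split=> //; split; apply/eqP => E.
- by move: c1; rewrite dg222 E !inE eqxx; case: (_ == _).
- by move: c1; rewrite dg222 E !inE eqxx; case: (_ == _).
- by move: c2; rewrite dg222 E !inE eqxx; case: (_ == _).
Qed.

(** The bound 7 follows from the cost of [v]. If 8 failed, [S] would be coloured with a gadget of
    weight 2 between the neighbours along [hp] and [hq], leaving two consecutive colours [x],
    [x + 1] at [v]. When [S] is collapsed, an extra edge of weight 1 at [nbr hw] keeps the arc of
    [hw] from being exactly these two; it fits because larger sets still have potential at least
    7. *)
Lemma seven222 S : S \subset U :\ v -> nbr hp \in S -> nbr hq \in S -> nbr hw \notin S -> 8 <= P S.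
Proof.
move=> SU pS qS wS; have [[wU pU qU] [wv pv qv] [_ _ pq]] := nbrs222.
have ne (T : {set V}) : nbr hp \in T -> (0 < #|T|)%N by move=> pT; apply/card_gt0P; exists (nbr hp).
have lb (T : {set V}) : T \subset U :\ v -> nbr hp \in T -> nbr hq \in T -> 7 <= P T.
  move=> TU pT qT; have [] := P_delE vU TU (ne T pT); rewrite ?dg222 ?pT ?qT; first by clear; lia.
  by case=> _; have [_ -> _] := hed_subseq ps; rewrite !big_cons big_nil kw kp kq; clear; lia.
rewrite leNgt; apply/negP => PS.
have SU' := sub_del SU; have SUv : U :\ v \subset U := subD1set _ _.
have pqS : [set nbr hp; nbr hq] \subset U :\ v by rewrite subUset !sub1set !inE pv pU qv qU.
have [||||f pf fk] := @color_gad V U L M S hp hq 2%:R 2 _ SU' isT pq pS qS.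
- by apply: proper_card; apply/properP; split=> //; exists v; rewrite ?(notin_del SU).
- by move=> R RS pR qR; have := lb R (subset_trans RS SU) pR qR; clear; lia.
- by rewrite addn2 ltnS ltnS; apply: kap_pair => //; apply: lb; rewrite ?inE ?eqxx ?orbT.
- by [].
have [x /and4P[x1 x2 x3 x4]] := arcs22 fk.
pose c := start f hp + x.
have [|||g [pg gf gk]] := @extend2 V U L M S (U :\ v) f (nbr hw) (c - hw.2.1) 1%N SU SUv (ne S pS) _ pf _ wS isT (or_intror erefl).
- exact: card_del vU (subxx _) SU (ne S pS).
- by rewrite !inE wv.
- move=> T ST TU; have pT := subsetP (proper_sub ST) _ pS; have qT := subsetP (proper_sub ST) _ qS.
  by have := lb T TU pT qT; move: PS; case: ifP; clear; lia.
have sp' : start g hp = start f hp by rewrite /start gf.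
have sq' : start g hq = start f hq by rewrite /start gf.
have sw : (1 <= (start g hw - start g hp - x)%R)%N.
  by apply: etrans gk; congr (leq _ (nat_of_ord _)); rewrite sp' /c /start; ring.
rewrite -sq' -sp' in x2 x4.
by case/orP: (arc_miss sw) => xw; apply: (no_extension_perm M vU pg ps);
  [instantiate (1 := start g hp + x) | instantiate (1 := start g hp + (x + 1))];
  rewrite /= !okh_shift subrr subr0 kw kp kq xw ?x1 ?x2 ?x3 ?x4.
Qed.

End Type222.

End Minimal.

(** * Vertices of type (2,2,1,1) *)

Section Minimal.
Variables (V : finType) (U : {set V}) (L : seq (gedge V)).
Hypothesis M : minimal U L.
Implicit Types (S R Q : {set V}) (u v x y z : V) (h : hedge V) (f : V -> Z5).

Notation P := (pot L).
Let sp : sparse U L := min_sparse M.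
Let wL : weighted L := sp_wt sp.
Local Notation dg := (dg L).
Local Notation dv := (dv L).

Section Type2211.
Variables (w : V) (hv hc ha hb : hedge V).
Hypotheses (wU : w \in U) (ps : perm_eq (hed L w) [:: hv; hc; ha; hb]).
Hypotheses (kv2 : hk hv = 2%N) (kc : hk hc = 2%N) (ka : hk ha = 1%N) (kb : hk hb = 1%N).

Lemma dg2211 S : dg w S = (3 * (nbr hv \in S) + 3 * (nbr hc \in S) + 2 * (nbr ha \in S) + 2 * (nbr hb \in S))%N.
Proof.
have [_ _ ->] := hed_subseq ps; rewrite !big_cons big_nil kv2 kc ka kb.
by do 4 case: (_ \in S).
Qed.

Lemma dv2211 : dv w = 10%N.
Proof. by have [_ -> _] := hed_subseq ps; rewrite !big_cons big_nil kv2 kc ka kb. Qed.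

Lemma nbrs2211 : [/\ [/\ nbr hv \in U, nbr hc \in U, nbr ha \in U & nbr hb \in U],
  [/\ nbr hv != w, nbr hc != w, nbr ha != w & nbr hb != w] &
  [/\ nbr hv != nbr hc, nbr hv != nbr ha, nbr hv != nbr hb, nbr hc != nbr ha & nbr hc != nbr hb]].
Proof.
have hs h : h \in [:: hv; hc; ha; hb] -> [/\ nbr h \in U, nbr h != w & (dg w [set nbr h] <= 4)%N].
  by rewrite -(perm_mem ps) => /(hedU M)[_ hU hn _]; split=> //; apply: (dg1 M).
have [a1 b1 c1] : [/\ nbr hv \in U, nbr hv != w & (dg w [set nbr hv] <= 4)%N] by apply: hs; rewrite !inE eqxx ?orbT.
have [a2 b2 c2] : [/\ nbr hc \in U, nbr hc != w & (dg w [set nbr hc] <= 4)%N] by apply: hs; rewrite !inE eqxx ?orbT.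
have [a3 b3 c3] : [/\ nbr ha \in U, nbr ha != w & (dg w [set nbr ha] <= 4)%N] by apply: hs; rewrite !inE eqxx ?orbT.
have [a4 b4 c4] : [/\ nbr hb \in U, nbr hb != w & (dg w [set nbr hb] <= 4)%N] by apply: hs; rewrite !inE eqxx ?orbT.
split=> //; split; apply/eqP => E.
- by move: c1; rewrite dg2211 E !inE eqxx; clear; lia.
- by move: c1; rewrite dg2211 E !inE eqxx; clear; lia.
- by move: c1; rewrite dg2211 E !inE eqxx; clear; lia.
- by move: c2; rewrite dg2211 E !inE eqxx; clear; lia.
- by move: c2; rewrite dg2211 E !inE eqxx; clear; lia.
Qed.

Lemma P_w S : S \subset U :\ w -> nbr hv \in S -> nbr hc \in S ->
  7 <= P S /\ ((nbr ha \in S) || (nbr hb \in S) -> 8 <= P S).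
Proof.
move=> SU vS cS; have S0 : (0 < #|S|)%N by apply/card_gt0P; exists (nbr hv).
have := P_delE M wU SU S0; rewrite dv2211 dg2211 vS cS.
case=> [|[_]]; last by clear; lia.
by case: (_ \in S); case: (_ \in S); clear; lia.
Qed.

(** As for [seven222]: the two heavy half-edges leave two consecutive colours at [w]. An extra edge
    of weight 2 keeps the point of [ha] off both, and the point of [hb] removes at most one. *)
Lemma seven2211 S : S \subset U :\ w -> nbr hv \in S -> nbr hc \in S -> nbr ha \notin S -> nbr hb \notin S ->
  8 <= P S.
Proof.
move=> SU vS cS aS bS; have [[vU cU aU bU] [vw cw aw bw] [vc _ _ _ _]] := nbrs2211.
have ne (T : {set V}) : nbr hv \in T -> (0 < #|T|)%N by move=> pT; apply/card_gt0P; exists (nbr hv).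
rewrite leNgt; apply/negP => PS.
have SU' := sub_del SU; have SUv : U :\ w \subset U := subD1set _ _.
have vcS : [set nbr hv; nbr hc] \subset U :\ w by rewrite subUset !sub1set !inE vw vU cw cU.
have [||||f pf fk] := @color_gad V U L M S hv hc 2%:R 2 _ SU' isT vc vS cS.
- by apply: proper_card; apply/properP; split=> //; exists w; rewrite ?(notin_del SU).
- by move=> R RS vR cR; have [] := P_w (subset_trans RS SU) vR cR; clear; lia.
- by rewrite addn2 ltnS ltnS; apply: (kap_pair M vc); have [] := P_w vcS (set21 _ _) (set22 _ _).
- by [].
have [x /and4P[x1 x2 x3 x4]] := arcs22 fk.
pose c := start f hv + x.
have PT (T : {set V}) : S \proper T -> T \subset U :\ w -> 7 <= P T /\ ((nbr ha \in T) || (nbr hb \in T) -> 8 <= P T).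
  by move=> ST TU; apply: P_w => //; apply: (subsetP (proper_sub ST)).
have kaS : (kap L [set nbr ha] S + 2 <= 4)%N.
  have ST : S \proper nbr ha |: S by rewrite properE subsetUr subUset sub1set (negbTE aS).
  have TU : nbr ha |: S \subset U :\ w by rewrite subUset sub1set !inE aw aU SU.
  have [_] := PT _ ST TU; rewrite setU11 (P_cst M aS) => /(_ isT) b8.
  have kb4 := kap_cst [set nbr ha] S wL.
  have [] := P_delE M wU TU; first by apply/card_gt0P; exists (nbr ha); rewrite setU11.
    rewrite dg2211 !in_setU1 vS cS !orbT eqxx (P_cst M aS); move: PS kb4; clear; lia.
  (* Here [nbr ha] is the only vertex besides [w] and [S], so [hb] ends there too. Weight 3 into [S]
     would mean cost 4 into [S] and 4 to [w], a total of 8, below the 9 of [dv9]. *)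
  move=> [E _]; have ba : nbr hb = nbr ha.
    have := bU; rewrite -E !in_setU1 (negbTE bw) (negbTE bS) orbF => /eqP //.
  rewrite addn2 ltnS ltnS leqNgt; apply/negP => k3.
  have nb h : h \in hed L (nbr ha) -> nbr h \in w |: S.
    by move=> hh; have [_ hU hy _] := hedU M hh; move: hU; rewrite -E !in_setU1 (negbTE hy).
  have wS : w \notin S := notin_del SU.
  have [dE _] := cst_total aS aw wS nb.
  have := dv9 M aU; rewrite dE.
  have -> : cst L [set nbr ha] [set w] = dg w [set nbr ha] by rewrite cstC cst_hed ?inE 1?eq_sym.
  rewrite dg2211 ba.
  have E1 y : y \in S -> (y == nbr ha) = false by move=> yS; apply: contraNF aS => /eqP <-.
  by rewrite !inE eqxx !E1 //; move: k3 kb4 b8 PS; clear; lia.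
have [|||g [pg gf gk]] := @extend2 V U L M S (U :\ w) f (nbr ha) (c - ha.2.1) 2%N SU SUv (ne S vS) _ pf _ aS isT (or_introl kaS).
- exact: (card_del M wU (subxx _) SU (ne S vS)).
- by rewrite !inE aw.
- move=> T ST TU; have [b1 b2] := PT T ST TU.
  by case: ifP => [aT|_]; [rewrite aT in b2; have := b2 isT|]; move: b1 PS; clear; lia.
have sv' : start g hv = start f hv by rewrite /start gf.
have sc' : start g hc = start f hc by rewrite /start gf.
have sa : (2 <= (start g ha - start g hv - x)%R)%N.
  by apply: etrans gk; congr (leq _ (nat_of_ord _)); rewrite sv' /c /start; ring.
rewrite -sv' -sc' in x2 x4.
by case/orP: (points_miss (start g hb - start g hv) sa) => /andP[y1 y2]; apply: (no_extension_perm M wU pg ps);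
  [instantiate (1 := start g hv + x) | instantiate (1 := start g hv + (x + 1))];
  rewrite /= !okh_shift subrr subr0 kv2 kc ka kb ?x1 ?x2 ?x3 ?x4 y1 y2.
Qed.

End Type2211.

End Minimal.

(** * A vertex of type (2,2,2) beside one of type (2,2,1,1) *)

Lemma arcs211 (d e : Z5) : exists x : Z5, [&& 2 <= x, 1 <= (x - d)%R & 1 <= (x - e)%R]%N.
Proof. by elim/forall_Z5: d; elim/forall_Z5: e; z5ex. Qed.

Lemma arcs22any (d : Z5) : exists x : Z5, [&& 2 <= x & 2 <= (x - d)%R]%N.
Proof. by elim/forall_Z5: d; z5ex. Qed.

(** A finite search for [beside2211_no_special]: the arcs of length 2 starting at [a] and [b + D]
    leave [x] and [x + 1] free, and the last condition excludes the one value at which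
    [special_gadget] has no solution. *)
Lemma special_colors (D E : Z5) : exists a b x : Z5,
  [&& 3 <= a, 2 <= b, 2 <= (x - a)%R, 2 <= (x + 1 - a)%R, 2 <= (x - (b + D))%R,
      2 <= (x + 1 - (b + D))%R & (x + 1 + E)%R != 3%:R]%N.
Proof.
by elim/forall_Z5: D; elim/forall_Z5: E;
  first [ by exists 3%:R, 2%:R, 0 | by exists 3%:R, 3%:R, 1 | by exists 3%:R, 2%:R, 1
  | by exists 4%:R, 2%:R, 2%:R | by exists 3%:R, 4%:R, 0 | by exists 3%:R, 3%:R, 0 | by exists 3%:R, 4%:R, 1].
Qed.

(** The arcs [m - 1, m] and [m, m + 1] are alternatives, so together they exclude only [m]. Unless
    [m] is the middle one of 2, 3, 4, two consecutive colours remain among these, and with [s] kept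
    off both, one is left besides [t]. *)
Lemma special_gadget (m : Z5) : m != 3%:R -> exists y : Z5, forall s t : Z5, (2 <= (s - y)%R)%N ->
  exists c : Z5, [&& 2 <= c, 1 <= (c - s)%R, 1 <= (c - t)%R &
    (2 <= (c - (m - 1))%R) || (2 <= (c - m)%R)]%N.
Proof.
elim/forall_Z5: m => // _; [exists 3%:R|exists 3%:R|exists 3%:R|exists 2%:R];
  by elim/forall_Z5 => //; elim/forall_Z5 => // _; z5ex.
Qed.

Section Minimal.
Variables (V : finType) (U : {set V}) (L : seq (gedge V)).
Hypothesis M : minimal U L.
Implicit Types (S R Q : {set V}) (u v x y z : V) (h : hedge V) (f : V -> Z5).

Notation P := (pot L).
Let sp : sparse U L := min_sparse M.
Let wL : weighted L := sp_wt sp.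
Local Notation dg := (dg L).
Local Notation dv := (dv L).

Lemma kap_pairE y a b : a != b -> y \notin [set a; b] ->
  kap L [set y] [set a; b] = (kap L [set y] [set a] + kap L [set y] [set b])%N.
Proof.
move=> ab; rewrite !inE negb_or => /andP[ya yb].
rewrite !kap_hed ?inE ?negb_or ?ya ?yb // (bigID (fun h => nbr h == a)) /=.
congr (_ + _)%N; apply: eq_bigl => h; rewrite !inE.
  by case: (eqVneq (nbr h) a); rewrite ?andbF ?andbT.
by case: (eqVneq (nbr h) a) => [->|]; rewrite ?andbF ?andbT // (negbTE ab).
Qed.

Lemma has3_half_edge v (B : {set V}) : has3 L [set v] B -> exists h, [/\ h \in hed L v, nbr h \in B & hk h = 3%N].
Proof.
case/hasP => e eL /andP[/(edge_hed eL)[h hh [hB hk3]] /eqP e3]; exists h; split=> //.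
by rewrite hk3.
Qed.

Lemma has3_pair y a b : has3 L [set y] [set a; b] -> has3 L [set y] [set a] || has3 L [set y] [set b].
Proof.
case/has3_half_edge => h [hh]; rewrite !inE => /orP[] /eqP hn /(has3_hed hh); rewrite hn => -> //.
by rewrite orbT.
Qed.

Lemma kap3_has3 x y : x \in U -> y \in U -> x != y -> (3 <= kap L [set x] [set y])%N -> has3 L [set x] [set y].
Proof.
move=> xU yU xy k3; apply: (single_has3 wL) => //.
have c2 : (#|[set x; y]| = 2)%N by rewrite cards2 xy.
have [|z zU zT] := @small_out V U L M [set x; y] 2 (ltnW (U_gt3 M)); first by rewrite c2.
have := pot_ge6_out M (T := [set x; y]) _ _ zU zT; rewrite subUset !sub1set xU yU c2 (P2 M xy) => /(_ isT isT).
by move: k3; clear; lia.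
Qed.

Lemma pcol1 x f : pcol f [set x] L.
Proof.
by apply/allP => e eL; have := allP (nl M x) _ eL; rewrite /inside !inE => /negbTE ->.
Qed.

Lemma single_edge x y : x != y -> (kap L [set x] [set y] = 2)%N -> (cst L [set x] [set y] = 3)%N ->
  exists h, [/\ hk h = 2%N, nbr h = y & forall h', h' \in hed L x -> nbr h' = y -> h' = h].
Proof.
move=> xy; have xy1 : x \notin [set y] by rewrite inE.
have F (G : hedge V -> nat) : (\sum_(h <- hed L x | nbr h \in [set y]) G h =
    \sum_(h <- [seq h <- hed L x | nbr h \in [set y]]) G h)%N by rewrite big_filter.
rewrite kap_hed // cst_hed // !F {F}.
have mem h : (h \in hed L x) && (nbr h == y) = (h \in [seq h <- hed L x | nbr h \in [set y]]).
  by rewrite mem_filter inE andbC.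
case E : [seq _ <- _ | _] mem => [|h1 [|h2 t]] mem.
- by rewrite big_nil.
- rewrite !big_cons !big_nil !addn0 => k1 _; exists h1; split=> //.
    by have := mem h1; rewrite mem_head => /andP[_ /eqP].
  by move=> h hh hn; have := mem h; rewrite hh hn eqxx inE => /esym/eqP.
rewrite !big_cons.
set b := (\sum_(j <- t) (hk j).+1)%N; set a := (\sum_(j <- t) hk j)%N.
have ab : (a <= b)%N by apply: leq_sum.
by move: ab; clear; lia.
Qed.

Lemma pcol_pair x y f : x != y -> cst L [set x] [set y] = 0%N -> pcol f [set x; y] L.
Proof.
move=> xy c0; apply/allP => e eL; apply/implyP => ie; exfalso.
have := sum_nat_seq_eq0 L (cross [set x] [set y]) (fun e => (wt e).+1).
rewrite -/(cst _ _ _) c0 eqxx => /esym/allP/(_ e eL); rewrite implybF /cross !inE.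
have := allP (nl M x) _ eL; have := allP (nl M y) _ eL; move: ie; rewrite /inside !inE.
by case/andP => /orP[] /eqP -> /orP[] /eqP ->; rewrite ?eqxx ?orbT ?andbT.
Qed.

(** Six costs of at least 9 have sum at most 60 - 6 = 54. *)
Lemma six_vertices_dv9 x : (#|U| = 6)%N -> x \in U -> dv x = 9%N.
Proof.
move=> c6 xU; apply/eqP; rewrite eqn_leq (dv9 M xU) andbT.
have := sum_dv_lt M; rewrite c6 (bigD1 x) //=.
have : (9 * 5 <= \sum_(i in U | i != x) dv i)%N.
  have -> : (9 * 5 = \sum_(i in U | i != x) 9)%N.
    rewrite sum_nat_const mulnC; congr (_ * _)%N.
    rewrite -[RHS](_ : #|U :\ x| = _)%N; first by have := cardsD1 x U; rewrite xU c6; clear; lia.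
    by apply: eq_card => y; rewrite !inE andbC.
  by apply: leq_sum => y /andP[yU _]; exact: (dv9 M yU).
by clear; lia.
Qed.

Section Beside2211.
Variables (v w : V) (hw hp hq hv hc ha hb : hedge V).
Hypotheses (vU : v \in U) (psv : perm_eq (hed L v) [:: hw; hp; hq]).
Hypotheses (kw : hk hw = 2%N) (kp : hk hp = 2%N) (kq : hk hq = 2%N).
Hypotheses (wU : w \in U) (psw : perm_eq (hed L w) [:: hv; hc; ha; hb]).
Hypotheses (kv2 : hk hv = 2%N) (kc : hk hc = 2%N) (ka : hk ha = 1%N) (kb : hk hb = 1%N).
Hypotheses (hwE : nbr hw = w) (hvE : nbr hv = v).

(** An edge of weight 2 gives [w] and [nbr hc] together potential at most 7, so by [seven222] this
    pair cannot contain a second neighbour of [v]. *)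
Lemma beside2211_distinct : [/\ nbr hc \in U, nbr hc != v, nbr hc != w, nbr hc != nbr hp & nbr hc != nbr hq].
Proof.
have [[_ cU _ _] [_ cw _ _] [vc _ _ _ _]] := nbrs2211 M wU psw kv2 kc ka kb.
have [[_ pU qU] [wv pv qv] [wp wq pq]] := nbrs222 M vU psv kw kp kq.
rewrite hwE hvE in vc wv wp wq; have wc3 : (3 <= dg w [set nbr hc])%N.
  by rewrite (dg2211 psw) // !inE eqxx; clear; lia.
have P7 : P [set w; nbr hc] <= 7.
  by rewrite (P2 M) 1?eq_sym // cst_hed ?inE 1?eq_sym //; move: wc3; rewrite /dg; clear; lia.
have ps1 : perm_eq (hed L v) [:: hq; hw; hp].
  by rewrite (perm_trans psv) // -[X in perm_eq _ X]/([:: hq] ++ [:: hw; hp]) perm_sym perm_catC.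
have ps2 : perm_eq (hed L v) [:: hp; hw; hq].
  by rewrite (perm_trans psv) // (perm_catCA [:: hw] [:: hp] [:: hq]).
have SU : [set w; nbr hc] \subset U :\ v.
  by rewrite subUset !sub1set !inE wU cU wv eq_sym vc.
have wS : nbr hw \in [set w; nbr hc] by rewrite hwE !inE eqxx.
split=> //; first by rewrite eq_sym.
  apply/eqP => E; have := seven222 M vU ps1 kq kw kp SU wS; rewrite E !inE eqxx orbT.
  rewrite (eq_sym (nbr hq) w) (eq_sym _ (nbr hp)) (negbTE wq) (negbTE pq) -E => /(_ isT isT).
  by move: P7; clear; lia.
apply/eqP => E; have := seven222 M vU ps2 kp kw kq SU wS; rewrite E !inE eqxx orbT.
rewrite (eq_sym (nbr hp) w) (negbTE wp) (negbTE pq) -E => /(_ isT isT).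
by move: P7; clear; lia.
Qed.

Lemma kap_v y : y != v -> kap L [set y] [set v] = (2 * (nbr hw == y) + 2 * (nbr hp == y) + 2 * (nbr hq == y))%N.
Proof.
move=> yv; have vy : v \notin [set y] by rewrite inE eq_sym.
rewrite kapC kap_hed // (perm_big _ psv) !big_cons big_nil kw kp kq !inE.
by do 3 case: (_ == y).
Qed.

(** Otherwise [w] is deleted, and [v] and [nbr hc] are collapsed with colours for which the arcs of
    [hv] and [hc] at [w] coincide; at most 2 + 1 + 1 colours are then forbidden at [w]. Five
    forbidden differences could arise only at [nbr hp] or [nbr hq], through weight 2 to [v] and
    weight 3 to [nbr hc]. *)
Lemma beside2211_heavy_to_c : has3 L [set nbr hp] [set nbr hc] || has3 L [set nbr hq] [set nbr hc].
Proof.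
have [cU cv cw cp cq] := beside2211_distinct; set c := nbr hc in cU cv cw cp cq *.
have [[_ pU qU] [wv pv qv] [wp wq pq]] := nbrs222 M vU psv kw kp kq.
have [[_ _ aU bU] [_ _ aw bw] [_ va vb ac bc]] := nbrs2211 M wU psw kv2 kc ka kb.
rewrite hwE hvE -/c in wv wp wq va vb ac bc.
have vc0 : cst L [set v] [set c] = 0%N.
  rewrite cst_hed ?inE 1?eq_sym // -[LHS]/(dg v [set c]) (dg222 psv) // !inE hwE.
  by rewrite !(eq_sym _ c) (negbTE cw) (negbTE cp) (negbTE cq).
apply/negPn/negP; rewrite negb_or => /andP[np nq].
pose S := U :\ w; pose R := [set v; c].
have RS : R \subset S by rewrite subUset !sub1set !inE (eq_sym v) wv vU cw cU.
have vR : v \in R by rewrite !inE eqxx.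
have cR : c \in R by rewrite !inE eqxx orbT.
pose phi y : Z5 := if y == v then 0 else hv.2.1 - hc.2.1.
have R0 : (0 < #|R|)%N by apply/card_gt0P; exists v.
have inD y : y \in S :\: R -> [/\ y \in U, y != w, y != v & y != c].
  by rewrite !inE negb_or => /and3P[/andP[-> ->] -> ->].
have n3 y : has3 L [set y] [set v] = false.
  rewrite has3C; apply/negP => /has3_half_edge[h []]; rewrite (perm_mem psv) !inE.
  by case/or3P => /eqP ->; rewrite ?kw ?kp ?kq.
have n3c y : has3 L [set y] R -> has3 L [set y] [set c] by move/has3_pair; rewrite n3.
have [|||||f [pf ff]] := extend (min_IH M) vR RS (card_del M wU (subxx _) RS R0) (phi := phi) (L := L).
- by apply: pcol_pair => //; rewrite eq_sym.
- by apply: sparse_sub sp; apply: subset_trans (subsetDl _ _) (subD1set _ _).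
- move=> T RT TS; have vT := subsetP (proper_sub RT) _ vR; have cT := subsetP (proper_sub RT) _ cR.
  rewrite (P2 M) 1?eq_sym // vc0; have [_ b2] := P_w M wU psw kv2 kc ka kb TS (etrans (congr1 _ hvE) vT) cT.
  case: (boolP ((nbr ha \in T) || (nbr hb \in T))) => [/b2|]; first by clear; lia.
  rewrite negb_or => /andP[aT bT].
  have := seven2211 M wU psw kv2 kc ka kb TS (etrans (congr1 _ hvE) vT) cT aT bT; clear; lia.
- move=> y /inD[yU yw yv yc]; rewrite kap_pairE 1?eq_sym //; last by rewrite !inE negb_or yv.
  have yc4 := sp_kap sp yU cU yc.
  rewrite kap_v // hwE (eq_sym w) (negbTE yw) leqNgt; apply/negP => k5.
  have [E|n1] := eqVneq (nbr hp) y.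
    have qy : (nbr hq == y) = false by rewrite -E eq_sym (negbTE pq).
    move/negP: np; apply; rewrite E; apply: kap3_has3 => //.
    by move: k5; rewrite E eqxx qy; clear; lia.
  have [E|n2] := eqVneq (nbr hq) y; last by move: k5 yc4; rewrite (negbTE n1) (negbTE n2); clear; lia.
  move/negP: nq; apply; rewrite E; apply: kap3_has3 => //.
  by move: k5; rewrite (negbTE n1) E eqxx; clear; lia.
- move=> y z /inD[yU yw yv yc] /inD[zU zw zv zc] yz; apply/negP => /and3P[t1 /n3c t2 /n3c t3].
  by have := sp_tri sp yU zU cU yz zc yc; rewrite t1 t2 t3.
have E : start f hc = start f hv.
  by rewrite /start hvE !ff // /phi eqxx (negbTE cv); ring.
have [x /and3P[x1 x2 x3]] := arcs211 (start f ha - start f hv) (start f hb - start f hv).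
apply: (no_extension_perm M wU pf psw (c := start f hv + x)).
by rewrite /= !okh_shift E subrr subr0 kv2 kc ka kb x1 x2 x3.
Qed.

(** Both [v] and [w] are deleted, and [nbr hp], [nbr hq] are collapsed so that their arcs at [v]
    coincide. Then [w] is coloured while [v] is still free, with 2 + 1 + 1 forbidden colours, and
    [v] last, with 2 + 2. The hypotheses are the local conditions for collapsing. *)
Lemma beside2211_no_merge_pq : cst L [set nbr hp] [set nbr hq] = 0%N ->
  (forall y, y \in U -> y != v -> y != w -> y != nbr hp -> y != nbr hq ->
     (kap L [set y] [set nbr hp] + kap L [set y] [set nbr hq] <= 4)%N) ->
  (forall y z, y \in U -> z \in U -> y != z -> y != nbr hp -> z != nbr hq ->
    ~~ [&& has3 L [set y] [set z], has3 L [set y] [set nbr hp] & has3 L [set z] [set nbr hq]]) -> False.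
Proof.
move=> pq0 hk4 ht3; have [[_ pU qU] [wv pv qv] [wp wq pq]] := nbrs222 M vU psv kw kp kq.
rewrite hwE in wv wp wq; set p := nbr hp in pq0 hk4 ht3 pU pv pq wp *.
set q := nbr hq in pq0 hk4 ht3 qU qv pq wq *.
pose S := (U :\ v) :\ w; pose R := [set p; q].
have SU : S \subset U :\ v := subD1set _ _.
have RS : R \subset S by rewrite subUset !sub1set !inE (eq_sym p w) (eq_sym q w) pv qv wp wq pU qU.
have pR : p \in R by rewrite !inE eqxx.
have qR : q \in R by rewrite !inE eqxx orbT.
have wS : w \notin S by rewrite !inE eqxx.
pose phi y : Z5 := if y == p then 0 else hp.2.1 - hq.2.1.
have R0 : (0 < #|R|)%N by apply/card_gt0P; exists p.
have inD y : y \in S :\: R -> [/\ y \in U, y != w, y != v & y \notin R].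
  by rewrite in_setD !in_setD1 => /andP[-> /and3P[-> -> ->]].
have [|||||f [pf ff]] := extend (min_IH M) pR RS (card_del M vU SU RS R0) (phi := phi) (L := L).
- exact: pcol_pair.
- by apply: sparse_sub sp; apply: subset_trans (subsetDl _ _) (sub_del SU).
- move=> T RT TS; have pT := subsetP (proper_sub RT) _ pR; have qT := subsetP (proper_sub RT) _ qR.
  have wT : nbr hw \notin T by rewrite hwE; apply: contraNN wS; apply: (subsetP TS).
  rewrite (P2 M pq) pq0; have := seven222 M vU psv kw kp kq (subset_trans TS SU) pT qT wT; clear; lia.
- move=> y /inD[yU yw yv yR]; rewrite kap_pairE //; move: yR; rewrite !inE negb_or => /andP[yp yq].
  exact: hk4.
- move=> y z /inD[yU yw yv yR] /inD[zU zw zv zR] yz; apply/negP => /and3P[t1 /has3_pair t2 /has3_pair t3].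
  move: yR zR; rewrite !inE !negb_or => /andP[yp yq] /andP[zp zq].
  case/orP: t2 => t2; case/orP: t3 => t3.
  + by have := sp_tri sp yU zU pU yz zp yp; rewrite t1 t2 t3.
  + by have := ht3 y z yU zU yz yp zq; rewrite t1 t2 t3.
  + by have := ht3 z y zU yU; rewrite eq_sym has3C t1 t2 t3 => /(_ yz zp yq).
  + by have := sp_tri sp yU zU qU yz zq yq; rewrite t1 t2 t3.
have E : start f hq = start f hp.
  by rewrite /start !ff // /phi eqxx eq_sym (negbTE pq); ring.
have [x /and3P[x1 x2 x3]] := arcs211 (start f ha - start f hc) (start f hb - start f hc).
pose g y := if y == w then start f hc + x else f y.
have pg : pcol g (U :\ v) L.
  have -> : U :\ v = w |: S by rewrite setD1K // !inE wv.
  apply: pcol_addv => //; first exact: nl M w.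
  move=> h; rewrite (perm_mem psw) !inE => /or4P[] /eqP -> //; rewrite ?okh_shift ?subrr ?subr0 ?kc ?ka ?kb //.
  by rewrite [v]lock hvE -lock eqxx andbF.
have gp : start g hp = start f hp by rewrite /start /g -/p eq_sym (negbTE wp).
have gq : start g hq = start f hp by rewrite -E /start /g -/q eq_sym (negbTE wq).
have [y /andP[y1 y2]] := arcs22any (start g hw - start g hp).
apply: (no_extension_perm M vU pg psv (c := start g hp + y)).
by rewrite /= !okh_shift gp gq subrr subr0 kw kp kq y1 -gp y2.
Qed.

Section HeavyP.
Variables (gc gv gd : hedge V).
Hypotheses (psp : perm_eq (hed L (nbr hp)) [:: gc; gv; gd]).
Hypotheses (k3 : hk gc = 3%N) (kgv : hk gv = 2%N) (kgd : hk gd = 2%N).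
Hypotheses (gcE : nbr gc = nbr hc) (gvE : nbr gv = v).

Lemma dgP S : dg (nbr hp) S = (4 * (nbr hc \in S) + 3 * (v \in S) + 3 * (nbr gd \in S))%N.
Proof.
have [_ _ ->] := hed_subseq psp; rewrite !big_cons big_nil k3 kgv kgd gcE gvE.
by do 3 case: (_ \in S).
Qed.

Lemma cstP y : y != nbr hp -> cst L [set y] [set nbr hp] = (4 * (nbr hc == y) + 3 * (v == y) + 3 * (nbr gd == y))%N.
Proof.
move=> yp; have py : nbr hp \notin [set y] by rewrite inE eq_sym.
by rewrite cstC cst_hed // -[LHS]/(dg (nbr hp) [set y]) dgP !inE.
Qed.

Lemma kapP y : y != nbr hp -> kap L [set y] [set nbr hp] = (3 * (nbr hc == y) + 2 * (v == y) + 2 * (nbr gd == y))%N.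
Proof.
move=> yp; have py : nbr hp \notin [set y] by rewrite inE eq_sym.
rewrite kapC kap_hed // (perm_big _ psp) !big_cons big_nil k3 kgv kgd gcE gvE !inE.
by do 3 case: (_ == y).
Qed.

(** By [seven222] the pair of [nbr hp] and [nbr hq] has potential at least 8, so edges between them
    cost at most 2, while each half-edge at [nbr hp] costs 3 or 4. Similarly [dg1] excludes a second
    edge to [nbr hc]. *)
Lemma heavyP : cst L [set nbr hp] [set nbr hq] = 0%N /\ nbr gd != nbr hc.
Proof.
have [cU cv cw cp cq] := beside2211_distinct.
have [[_ pU qU] [wv pv qv] [wp wq pq]] := nbrs222 M vU psv kw kp kq.
split; last first.
  apply/eqP => E; have := dg1 M pU cU cp; rewrite dgP !inE E eqxx; clear; lia.
have pqU : [set nbr hp; nbr hq] \subset U :\ v by rewrite subUset !sub1set !inE pv pU qv qU.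
have := seven222 M vU psv kw kp kq pqU (set21 _ _) (set22 _ _); rewrite !inE negb_or wp wq (P2 M pq).
have qp : nbr hq != nbr hp by rewrite eq_sym.
have vq : (v == nbr hq) = false by rewrite eq_sym (negbTE qv).
rewrite cstC (cstP qp) (negbTE cq) vq => /(_ isT).
by case: (_ == _); clear; lia.
Qed.

(** This is the case where collapsing [nbr hp] and [nbr hq] would create weight 3 + 2 at [nbr hc].
    Instead these three vertices receive explicit colours that leave [v] two consecutive options,
    and an extra edge of weight 2 at [nbr ha] ensures that [w] can be coloured for one of them. *)
Lemma beside2211_no_special : nbr ha != nbr hq -> kap L [set nbr hc] [set nbr hq] = 2%N -> False.
Proof.
move=> aq kcq; have [cU cv cw cp cq] := beside2211_distinct; have [pq0 dc] := heavyP.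
have [[_ pU qU] [wv pv qv] [wp wq pq]] := nbrs222 M vU psv kw kp kq.
have [[_ _ aU bU] [_ _ aw bw] [_ va vb ac bc]] := nbrs2211 M wU psw kv2 kc ka kb.
rewrite hwE in wv wp wq; rewrite hvE in va vb.
set c := nbr hc in kcq cU cv cw cp cq dc ac bc *; set p := nbr hp in pq0 dc pU pv wp pq cp *.
set q := nbr hq in aq kcq pq0 qU qv wq pq cq *.
pose S := (U :\ v) :\ w; pose R := q |: (p |: [set c]).
have SU : S \subset U :\ v := subD1set _ _.
have pR : p \in R by rewrite !inE eqxx !orbT.
have qR : q \in R by rewrite !inE eqxx.
have cR : c \in R by rewrite !inE eqxx !orbT.
have RS : R \subset S.
  by rewrite !subUset !sub1set !inE (eq_sym p w) (eq_sym q w) pv qv wp wq pU qU cU cv cw.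
have wS : w \notin S by rewrite !inE eqxx.
have R0 : (0 < #|R|)%N by apply/card_gt0P; exists p.
have pc1 : p \notin [set c] by rewrite inE eq_sym.
have qpc1 : q \notin p |: [set c] by rewrite !inE negb_or eq_sym pq eq_sym.
have cstpc : cst L [set c] [set p] = 4%N.
  by rewrite cstP // eqxx (eq_sym v) (negbTE cv) (negbTE dc).
have P8 (T : {set V}) : p \in T -> q \in T -> T \subset S -> 8 <= P T.
  move=> pT qT TS; apply: (seven222 M vU psv kw kp kq (subset_trans TS SU)) => //.
  by rewrite hwE; apply: contraNN wS; apply: (subsetP TS).
have PR : P R = 11 - (cst L [set c] [set q])%:Z.
  rewrite (P_cst M qpc1) (P_cst M pc1) (P1 M) cst_setU1 // ![cst L [set q] _]cstC pq0.
  by rewrite [cst L [set p] _]cstC cstpc; clear; lia.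
have c3 : cst L [set c] [set q] = 3%N.
  have := P8 R pR qR RS; rewrite PR; have := kap_cst [set c] [set q] wL; rewrite kcq; clear; lia.
have [h0 [k0 n0 u0]] : exists h, [/\ hk h = 2%N, nbr h = c & forall h', h' \in hed L q -> nbr h' = c -> h' = h].
  by apply: single_edge; rewrite ?[kap L [set q] _]kapC ?[cst L [set q] _]cstC // eq_sym.
(* With colour 0 at [nbr hc], the arc of [hp] at [v] starts at [A + xp]; a colour [A + x] of [v]
   puts the arc of [hv] at [w] at distance [x + E] from the arc of [hc]. *)
pose A := gc.2.1 + hp.2.1; pose E := A + hv.2.1 - hc.2.1.
have [xp [xq [x]]] := special_colors (h0.2.1 + hq.2.1 - A) E.
case/and5P => a1 b1 x1 x2 /and3P[x3 x4 mE].
have [y hy] := special_gadget mE.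
pose f1 z : Z5 := if z == p then gc.2.1 + xp else 0.
pose phi z : Z5 := if z == q then h0.2.1 + xq else f1 z.
have pphi : pcol phi R L.
  apply: pcol_addv => //; [apply: pcol_addv => //; [exact: pcol1|exact: (nl M p)|]|exact: (nl M q)|].
    move=> h; rewrite (perm_mem psp) !inE => /or3P[] /eqP ->; rewrite ?gcE ?gvE.
    - move=> _; rewrite /okh k3; apply: etrans a1; congr (leq _ (nat_of_ord _)); rewrite /start; ring.
    - by rewrite eq_sym (negbTE cv).
    - by rewrite (negbTE dc).
  move=> h hh hn; have [_ _ hq' _] := hedU M hh.
  have hc' : nbr h = c.
    move: hn; rewrite !inE => /orP[] /eqP // hp'; exfalso.
    have := cst_hed (S := [set p]) (v := q) L; rewrite inE eq_sym pq => /(_ isT).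
    rewrite cstC pq0 (big_rem h) //= hp' inE eqxx; clear; lia.
  rewrite (u0 h hh hc') /okh k0; apply: etrans b1; congr (leq _ (nat_of_ord _)).
  by rewrite /start n0 /f1 (negbTE cp); ring.
have aR : nbr ha \notin R.
  rewrite !inE !negb_or aq eq_sym (eq_sym _ c) ac andbT; apply/eqP => E'.
  have := hed_sym (L := L) (v := w) (h := ha); rewrite (perm_mem psw) !inE eqxx !orbT -E' (perm_mem psp) !inE.
  move=> /(_ isT) /or3P[] /eqP E2; have := congr1 (@hk V) E2; rewrite [hk (w, _)]ka ?k3 ?kgv ?kgd //.
(* Adding [v] to [T] changes the potential by 5 - 6, and [w] then costs at least 3 + 3 + 2. *)
have Pa (T : {set V}) : R \subset T -> T \subset S -> nbr ha \in T -> 10 <= P T \/ w |: (v |: T) = U /\ 9 <= P T.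
  move=> RT TS aT; have vT : v \notin T by apply/negP => /(subsetP TS); rewrite !inE eqxx andbF.
  have wT : w \notin T by apply: contraNN wS; apply: (subsetP TS).
  have T1 : (0 < #|v |: T|)%N by apply/card_gt0P; exists v; rewrite setU11.
  have TU : v |: T \subset U :\ w.
    rewrite subUset sub1set !inE (eq_sym v) wv vU.
    by apply: (subset_trans TS); rewrite /S; apply: setSD; apply: subD1set.
  have := P_delE M wU TU T1; rewrite (P_add M vT) (dg222 psv) // hwE (negbTE wT).
  rewrite !(subsetP RT _ pR) !(subsetP RT _ qR) (dg2211 psw) // hvE setU11.
  rewrite !in_setU1 (subsetP RT _ cR) aT !orbT (dv2211 psw) //.
  by case=> [b|[-> b]]; [left|right; split=> //]; move: b; clear; lia.
have aS : nbr ha \in S by rewrite !inE aw eq_sym va aU.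
have kaR : (kap L [set nbr ha] R + 2 <= 4)%N.
  have TS : nbr ha |: R \subset S by rewrite subUset sub1set aS.
  have := Pa _ (subsetUr _ _) TS (setU11 _ _); rewrite (P_cst M aR) PR c3.
  have kcb := kap_cst [set nbr ha] R wL; case; first by move: kcb; clear; lia.
  (* If nothing else is left, [U] has six vertices, all of cost 9, but [nbr hp] costs 4 + 3 + 3. *)
  case=> UE _; exfalso; have U6 : (#|U| <= 6)%N.
    rewrite -UE !cardsU1 cards1; do 5 case: (_ \notin _); clear; lia.
  have {}U6 : (#|U| = 6)%N by have := U_gt5 M; move: U6; clear; lia.
  have := six_vertices_dv9 U6 pU; have [_ -> _] := hed_subseq psp; rewrite !big_cons big_nil k3 kgv kgd; clear; lia.
have [|g [pg gf gk]] := @extend2 V U L M R S phi (nbr ha) (y + hc.2.1 - ha.2.1) 2%N RS (sub_del SU) R0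
    (card_del M vU SU RS R0) pphi aS aR isT (or_introl kaR).
- move=> T RT TS; have RT' := proper_sub RT; rewrite PR c3; case: ifP => aT.
    by case: (Pa T RT' TS aT) => [|[_]]; clear; lia.
  by have := P8 T (subsetP RT' _ pR) (subsetP RT' _ qR) TS; clear; lia.
have gcol : g c = 0 by rewrite gf // /phi /f1 (negbTE cq) (negbTE cp).
have gp : start g hp = A + xp.
  by rewrite /start -/p gf // /phi /f1 (negbTE pq) eqxx /A; ring.
have gq : start g hq = h0.2.1 + hq.2.1 + xq.
  by rewrite /start -/q gf // /phi eqxx; ring.
have ghc : start g hc = hc.2.1 by rewrite /start -/c gcol add0r.
have [|t /and4P[t1 t2 t3 t4]] := hy (start g ha - start g hc) (start g hb - start g hc).
  by apply: etrans gk; congr (leq _ (nat_of_ord _)); rewrite ghc /start; ring.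
have fin o : (2 <= (o - start g hp)%R)%N -> (2 <= (o - start g hq)%R)%N ->
    (2 <= (t - (o + hv.2.1 - hc.2.1))%R)%N -> False.
  move=> o1 o2 o3; pose g1 z := if z == v then o else g z.
  have pg1 : pcol g1 (U :\ w) L.
    have -> : U :\ w = v |: S.
      apply/setP => z; rewrite !inE; case: (eqVneq z v) => [->|_] //=.
      by rewrite eq_sym wv vU.
    apply: pcol_addv => //; [by rewrite !inE eqxx andbF|exact: (nl M v)|].
    move=> h; rewrite (perm_mem psv) !inE => /or3P[] /eqP ->; rewrite ?hwE ?eqxx //= /okh.
      by rewrite kp.
    by rewrite kq.
  have E1 h : nbr h != v -> start g1 h = start g h by rewrite /start /g1 => /negbTE ->.
  apply: (no_extension_perm M wU pg1 psw (c := start g1 hc + t)).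
  rewrite /= !okh_shift !(E1 hc, E1 ha, E1 hb) //= 1?eq_sym // 1?eq_sym //.
  rewrite subrr subr0 kv2 kc ka kb t1 t2 t3 !andbT.
  by apply: etrans o3; congr (leq _ (nat_of_ord _)); rewrite ghc /start /g1 hvE eqxx; ring.
case/orP: t4 => t4; [apply: (fin (A + x))|apply: (fin (A + (x + 1)))].
- by apply: etrans x1; congr (leq _ (nat_of_ord _)); rewrite gp; ring.
- by apply: etrans x3; congr (leq _ (nat_of_ord _)); rewrite gq; ring.
- by apply: etrans t4; congr (leq _ (nat_of_ord _)); rewrite /E; ring.
- by apply: etrans x2; congr (leq _ (nat_of_ord _)); rewrite gp; ring.
- by apply: etrans x4; congr (leq _ (nat_of_ord _)); rewrite gq; ring.
- by apply: etrans t4; congr (leq _ (nat_of_ord _)); rewrite /E; ring.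
Qed.

(** Without such an edge, collapsing [nbr hp] and [nbr hq] can be obstructed only at [nbr hc], and
    that case is [beside2211_no_special]. *)
Lemma beside2211_heavy_at_q : nbr ha != nbr hq -> exists z, has3 L [set nbr hq] [set z].
Proof.
move=> aq; have [cU cv cw cp cq] := beside2211_distinct; have [pq0 dc] := heavyP.
have [[_ pU qU] [wv pv qv] [wp wq pq]] := nbrs222 M vU psv kw kp kq.
case: (pickP (fun z => has3 L [set nbr hq] [set z])) => [z hz|no]; first by exists z.
exfalso; have no3 y : y \in U -> y != nbr hq -> (kap L [set y] [set nbr hq] <= 2)%N.
  move=> yU yq; rewrite leqNgt; apply/negP => /(kap3_has3 yU qU yq).
  by rewrite has3C no.
have [E|kn2] := eqVneq (kap L [set nbr hc] [set nbr hq]) 2%N; first exact: beside2211_no_special.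
apply: beside2211_no_merge_pq => //.
- move=> y yU yv yw yp yq; rewrite kapP // (eq_sym v) (negbTE yv); have := no3 y yU yq.
  have [E|_] := eqVneq (nbr hc) y.
    by rewrite -E (negbTE dc); move: (no3 _ cU cq) kn2; clear; lia.
  by case: (_ == y); clear; lia.
- move=> y z yU zU yz yp zq; apply/negP => /and3P[_ _]; rewrite has3C no //.
Qed.

End HeavyP.
End Beside2211.
End Minimal.

(** * Neighbours of type (2,2,2) and (3,2,2) *)

Lemma lobe_options2 (d : Z5) : (2 <= (d - 2%:R)%R)%N ->
  exists x : Z5, [&& 2 <= x, 2 <= (x + 1)%R, 2 <= (x - d)%R & 2 <= (x + 1 - d)%R]%N.
Proof. by elim/forall_Z5: d => // _; z5ex. Qed.

Lemma lobe_options3 (d : Z5) : (3 <= (d - 2%:R)%R)%N ->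
  exists x : Z5, [&& 3 <= x, 3 <= (x + 1)%R, 2 <= (x - d)%R & 2 <= (x + 1 - d)%R]%N.
Proof. by elim/forall_Z5: d => // _; z5ex. Qed.

(** If the far end of an edge of weight 2 has two consecutive options, the arcs [o, o + 1] and
    [o + 1, o + 2] are alternatives and only [o + 1] is forbidden in effect: a lobe acts like an
    edge of weight 1. *)
Lemma two_options (o c : Z5) : (1 <= (c - (o + 1))%R)%N -> (2 <= (c - o)%R)%N || (2 <= (c - (o + 1))%R)%N.
Proof. by elim/forall_Z5: o; elim/forall_Z5: c. Qed.

Section Minimal.
Variables (V : finType) (U : {set V}) (L : seq (gedge V)).
Hypothesis M : minimal U L.
Implicit Types (S R Q : {set V}) (u v x y z : V) (h : hedge V) (f : V -> Z5).

Notation P := (pot L).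
Let sp : sparse U L := min_sparse M.
Let LU : all (inside U) L := min_inside M.
Let wL : weighted L := sp_wt sp.
Local Notation dg := (dg L).
Local Notation dv := (dv L).

(* A neighbour w of u of type (2,2,2) or (3,2,2), joined to u by an edge of
   weight 2: the half-edge from u to w, then the other two half-edges of w. *)
Definition lobe := (hedge V * hedge V * hedge V)%type.
Implicit Types (l : lobe) (I : seq lobe).
Definition lw l := nbr l.1.1.
Definition la l := l.1.2.
Definition lb l := l.2.
Definition lk l := hk (la l).
Definition is_lobe u l := l.1.1 \in hed L u /\ hk l.1.1 = 2%N /\
  exists hu, [/\ perm_eq (hed L (lw l)) [:: hu; la l; lb l], nbr hu = u, hk hu = 2%N, hk (lb l) = 2%N & (2 <= lk l <= 3)%N].
Definition addw I R := foldr (fun l T => lw l |: T) R I.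
(** Replaces the deleted centre of a lobe. It forbids exactly the positions of the two outer arcs,
    of lengths 2, 2 or 3, 2, that do not leave the centre two consecutive colours. *)
Definition lgad l := gad (la l) (lb l) 2%:R (lk l).

Lemma in_addw I R x : (x \in addw I R) = (x \in map lw I) || (x \in R).
Proof. by elim: I => //= l I IH; rewrite !inE IH orbA. Qed.

Lemma is_lobe_dg u l S : is_lobe u l ->
  dg (lw l) S = (3 * (u \in S) + (lk l).+1 * (nbr (la l) \in S) + 3 * (nbr (lb l) \in S))%N.
Proof.
case=> _ [_ [hu [ps eu k1 k2 _]]]; have [_ _ ->] := hed_subseq ps; rewrite !big_cons big_nil k1 k2 eu -/(lk l).
by case: (_ \in S); case: (_ \in S); case: (_ \in S); rewrite ?muln1 ?muln0 ?addn0.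
Qed.

Lemma is_lobe_dv u l : is_lobe u l -> dv (lw l) = (lk l + 7)%N.
Proof.
case=> _ [_ [hu [ps _ k1 k2 _]]]; have [_ -> _] := hed_subseq ps; rewrite !big_cons big_nil k1 k2 -/(lk l).
by clear; lia.
Qed.

Lemma is_lobe_k u l : is_lobe u l -> (2 <= lk l <= 3)%N.
Proof. by case=> _ [_ [hu []]]. Qed.

Lemma is_lobe_nbrs u l : u \in U -> is_lobe u l ->
  [/\ [/\ lw l \in U, nbr (la l) \in U & nbr (lb l) \in U],
      [/\ lw l != u, nbr (la l) != lw l & nbr (lb l) != lw l],
      [/\ nbr (la l) != u, nbr (lb l) != u & nbr (la l) != nbr (lb l)] &
      (3 <= dg u [set lw l])%N].
Proof.
move=> uU hl; have E := is_lobe_dg _ hl; have [h0 [k0 [hu [ps eu k1 k2 k3]]]] := hl.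
have hs h : h \in [:: hu; la l; lb l] -> [/\ nbr h \in U, nbr h != lw l & (dg (lw l) [set nbr h] <= 4)%N].
  by rewrite -(perm_mem ps) => /(hedU M)[wU hU hn _]; split=> //; apply: (dg1 M).
have [_ wU wu _] := hedU M h0.
have [a1 b1 c1] : [/\ nbr hu \in U, nbr hu != lw l & (dg (lw l) [set nbr hu] <= 4)%N] by apply: hs; rewrite !inE eqxx ?orbT.
have [a2 b2 c2] : [/\ nbr (la l) \in U, nbr (la l) != lw l & (dg (lw l) [set nbr (la l)] <= 4)%N] by apply: hs; rewrite !inE eqxx ?orbT.
have [a3 b3 c3] : [/\ nbr (lb l) \in U, nbr (lb l) != lw l & (dg (lw l) [set nbr (lb l)] <= 4)%N] by apply: hs; rewrite !inE eqxx ?orbT.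
rewrite eu in a1 b1 c1; split=> //; last first.
  by rewrite /dg (big_rem l.1.1) //= !inE eqxx k0; clear; lia.
split; apply/eqP => e.
- by move: c1; rewrite E !inE e eqxx; move: k3; clear; lia.
- by move: c1; rewrite E !inE e eqxx; move: k3; clear; lia.
- by move: c2; rewrite E !inE e eqxx; move: k3; clear; lia.
Qed.

Section Lobes.
Variables (u : V) (ls : seq lobe).
Hypothesis uU : u \in U.
Hypothesis lobes : forall l, l \in ls -> is_lobe u l.
Hypothesis uniq_lw : uniq (map lw ls).
Hypothesis sep : forall l l', l \in ls -> l' \in ls -> nbr (la l) != lw l' /\ nbr (lb l) != lw l'.

Definition base := [set x in U | (x != u) && (x \notin map lw ls)].

Lemma base_sub : base \subset U :\ u.
Proof. by apply/subsetP => x; rewrite !inE => /and3P[-> ->]. Qed.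

Lemma lobe_base l : l \in ls -> nbr (la l) \in base /\ nbr (lb l) \in base.
Proof.
move=> hl; have [[wU aU bU] _ [au bu _] _] := is_lobe_nbrs uU (lobes hl).
rewrite !inE aU bU au bu /=; split; apply/mapP => -[l' hl' E]; have [] := sep hl hl'; rewrite E eqxx //.
Qed.

Lemma addw_sub I R : {subset I <= ls} -> R \subset base -> addw I R \subset U :\ u.
Proof.
move=> Il RS; apply/subsetP => x; rewrite in_addw => /orP[/mapP[l hl ->]|/(subsetP RS)/(subsetP base_sub) //].
by have [[wU _ _] [wu _ _] _ _] := is_lobe_nbrs uU (lobes (Il _ hl)); rewrite !inE wu.
Qed.

(** Each centre gains 5 and pays [lk l + 1] and 3 into [R]; each also adds at least 3 to the cost of
    [u]. *)
Lemma P_addw I R : {subset I <= ls} -> uniq (map lw I) -> R \subset base ->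
  (forall l, l \in I -> nbr (la l) \in R /\ nbr (lb l) \in R) ->
  P (addw I R) = P R + (size I)%:Z - (\sum_(l <- I) lk l)%N%:Z /\ (3 * size I <= dg u (addw I R))%N.
Proof.
move=> + + RS; elim: I => [|l I IH] /= Il; first by rewrite big_nil; split=> //; clear; lia.
case/andP => wI uI hR; have lI : {subset I <= ls} by move=> x xI; apply: Il; rewrite inE xI orbT.
have [|E D] := IH lI uI; first by move=> x xI; apply: hR; rewrite inE xI orbT.
have [aR bR] := hR l (mem_head _ _); have ll := lobes (Il _ (mem_head _ _)).
have wT : lw l \notin addw I R.
  rewrite in_addw negb_or wI /=; apply/negP => /(subsetP RS); rewrite !inE => /and3P[_ _].
  by rewrite map_f // Il // mem_head.
have uT : u \notin addw I R := notin_del (addw_sub lI RS).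
split.
  rewrite (P_add M wT) E big_cons (is_lobe_dg _ ll) (negbTE uT) !in_addw aR bR !orbT.
  by move: (\sum_(j <- I) lk j)%N => n; clear; lia.
have [_ _ _ d3] := is_lobe_nbrs uU ll.
have uw : u \notin lw l |: addw I R.
  by rewrite in_setU1 negb_or uT andbT eq_sym; have [_ [] ] := is_lobe_nbrs uU ll.
rewrite /dg -(cst_hed _ uw) (cst_setU1 _ wT uw) [cst L _ (addw I R)](cst_hed _ uT).
have uw1 : u \notin [set lw l] by move: uw; rewrite in_setU1 inE negb_or => /andP[].
by rewrite (cst_hed _ uw1) -/(dg u [set lw l]) -/(dg u (addw I R)); move: d3 D; clear; lia.
Qed.

Definition lin R := [seq l <- ls | (nbr (la l) \in R) && (nbr (lb l) \in R)].

(** The centres of the lobes over [R] are added to [R]. For one lobe the general bound 6 suffices.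
    For several, [u] is taken into account as well, at cost at least 3 per lobe; the hypothesis on
    [dv u] covers the case where this exhausts [U]. These are the bounds that the gadgets need, by
    [pot_gads]. *)
Lemma P_lobes R : R \subset base -> R != set0 ->
  [/\ 3 <= P R, (size (lin R) = 1)%N -> 5 + (\sum_(l <- lin R) lk l)%N%:Z <= P R &
  (1 < size (lin R))%N -> (5 + 2 * size ls <= dv u)%N ->
    3 + (size (lin R))%:Z + (\sum_(l <- lin R) lk l)%N%:Z <= P R].
Proof.
move=> RS R0; have Il : {subset lin R <= ls} by move=> x; rewrite mem_filter => /andP[].
have RU := subset_trans RS (subset_trans base_sub (subD1set _ _)).
have uI : uniq (map lw (lin R)) := subseq_uniq (map_subseq lw (filter_subseq _ ls)) uniq_lw.
have sz : (size (lin R) <= size ls)%N by rewrite size_filter count_size.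
have [|E D] := P_addw Il uI RS; first by move=> l; rewrite mem_filter => /andP[/andP[]].
have TU := addw_sub Il RS; have T0 : (0 < #|addw (lin R) R|)%N.
  by have /set0Pn[x xR] := R0; apply/card_gt0P; exists x; rewrite in_addw xR orbT.
split; first exact: (P_sparse M RU R0).
  move=> s1; case El : (lin R) s1 (P_addw Il uI RS) T0 => [|l [|]] //= _ _ T0; have /set0Pn[x xR] := R0.
  have lI : l \in lin R by rewrite El mem_head.
  have wR : lw l \notin R.
    by apply/negP => /(subsetP RS); rewrite !inE => /and3P[_ _]; rewrite map_f //; exact: Il.
  have T2 : (1 < #|addw (lin R) R|)%N.
    by rewrite El /= cardsU1 wR add1n ltnS; apply/card_gt0P; exists x.
  by have := pot_ge6_out M (sub_del TU) T2 uU (notin_del TU); rewrite E El /= big_cons big_nil; clear; lia.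
move=> s1 hd; have := P_delE M uU TU T0; rewrite E; move: s1 D sz hd.
by move: (\sum_(l <- _) _)%N => n; clear; lia.
Qed.

Lemma pot_gads R : pot (map lgad ls ++ L) R = P R - (size (lin R))%:Z - (\sum_(l <- lin R) lk l)%N%:Z.
Proof.
rewrite /lin; elim: ls => [|l I IH] /=; first by rewrite big_nil; clear; lia.
have E : wt (lgad l) = lk l by [].
rewrite pot_cons IH E /inside /= /src /tgt /=.
case: (_ && _); rewrite /= ?big_cons; clear; lia.
Qed.

Lemma lgad_cross x y l : x != y -> l \in ls ->
  cross [set x] [set y] (lgad l) = (nbr (la l) \in [set x; y]) && (nbr (lb l) \in [set x; y]).
Proof.
move=> xy hl; have [_ _ [_ _ ab] _] := is_lobe_nbrs uU (lobes hl).
have e1 z : (nbr (la l) == z) && (nbr (lb l) == z) = false.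
  by apply/negP => /andP[/eqP <- /eqP e]; rewrite e eqxx in ab.
have e2 z : (z == x) && (z == y) = false by apply/negP => /andP[/eqP -> ]; apply/negP.
have := e1 x; have := e1 y; have := e2 (nbr (la l)); have := e2 (nbr (lb l)).
rewrite /cross /src /tgt /= !inE.
by case: (_ == x); case: (_ == x); case: (_ == y); case: (_ == y).
Qed.

Lemma kap_gads x y : x != y -> kap (map lgad ls ++ L) [set x] [set y] =
  (kap L [set x] [set y] + \sum_(l <- lin [set x; y]) lk l)%N.
Proof.
move=> xy; rewrite /kap big_cat /= addnC; congr (_ + _)%N.
rewrite big_map /lin big_filter big_seq_cond [RHS]big_seq_cond; apply: eq_bigl => l.
by case hl: (l \in ls) => //=; rewrite lgad_cross.
Qed.

Lemma has3_gads x y : x != y -> has3 (map lgad ls ++ L) [set x] [set y] =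
  has (fun l => lk l == 3%N) (lin [set x; y]) || has3 L [set x] [set y].
Proof.
move=> xy; rewrite /has3 has_cat has_map /lin has_filter; congr (_ || _).
rewrite has_filter -filter_predI; congr (_ != _); apply: eq_in_filter => l hl.
by rewrite /= lgad_cross // andbC.
Qed.

Lemma size_lin R : (2 * size (lin R) <= \sum_(l <- lin R) lk l)%N.
Proof.
rewrite mulnC -sum1_size big_distrl /= big_seq [leqRHS]big_seq; apply: leq_sum => l.
by rewrite mem_filter => /andP[_ /lobes/is_lobe_k/andP[]].
Qed.

(** The potential leaves one exception: gadgets of weights 2 and 3 over the same two vertices, with
    no other edge between these. *)
Lemma kap_lobes x y : (5 + 2 * size ls <= dv u)%N -> x \in base -> y \in base -> x != y ->
  (kap (map lgad ls ++ L) [set x] [set y] <= 4)%N \/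
  [/\ size (lin [set x; y]) = 2%N, (\sum_(l <- lin [set x; y]) lk l = 5)%N & cst L [set x] [set y] = 0%N].
Proof.
move=> hd xB yB xy; rewrite kap_gads //; have RS : [set x; y] \subset base by rewrite subUset !sub1set xB.
have R0 : [set x; y] != set0 by apply/set0Pn; exists x; rewrite !inE eqxx.
have [_ p1 p2] := P_lobes RS R0; rewrite (P2 M xy) in p1 p2.
have kc := kap_cst [set x] [set y] wL; have Ks := size_lin [set x; y].
have bU z : z \in base -> z \in U by rewrite inE => /andP[].
have k4 := sp_kap sp (bU x xB) (bU y yB) xy.
have p2' s := p2 s hd; move: p1 p2' kc Ks k4.
case El: (lin [set x; y]) => [|l [|l2 I]].
- by rewrite big_nil addn0; left.
- have : l \in lin [set x; y] by rewrite El mem_head.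
  rewrite mem_filter big_cons big_nil => /andP[_ /lobes/is_lobe_k] hk p1 _ + _ _.
  by have := p1 erefl; move: hk; clear => h1 h2 h3; left; move: h1 h2 h3; lia.
move=> _ /(_ isT); move: (\sum_(_ <- _) _)%N => K; rewrite /= => p2' kc Ks _.
have [h|h] : (kap L [set x] [set y] + K <= 4 \/ 4 < kap L [set x] [set y] + K)%N.
- by clear; lia.
- by left.
- right; split; move: p2' kc Ks h; clear; lia.
Qed.

Lemma sparse_lobes : (5 + 2 * size ls <= dv u)%N ->
  (forall x y, x \in base -> y \in base -> x != y -> (kap (map lgad ls ++ L) [set x] [set y] <= 4)%N) ->
  (forall x y z, x \in base -> y \in base -> z \in base -> x != y -> y != z -> x != z ->
    ~~ [&& has3 (map lgad ls ++ L) [set x] [set y], has3 (map lgad ls ++ L) [set y] [set z]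
         & has3 (map lgad ls ++ L) [set x] [set z]]) ->
  sparse base (map lgad ls ++ L).
Proof.
move=> hd hk ht; split=> //.
- rewrite /weighted all_cat -/(weighted L) wL andbT all_map; apply/allP => l /lobes/is_lobe_k.
  by rewrite /= /wt /=; clear; lia.
- rewrite all_cat all_map; apply/andP; split.
    apply/allP => l hl /=; apply/implyP => _; have [_ _ [_ _ ab] _] := is_lobe_nbrs uU (lobes hl).
    by rewrite /src /tgt.
  by apply/allP => e eL; apply/implyP => _; have /implyP := allP (sp_loop sp) _ eL; apply; exact: (allP LU).
- move=> R RS R0; rewrite pot_gads; have [p0 p1 p2] := P_lobes RS R0; move: p0 p1 (fun s => p2 s hd).
  case: (lin R) => [|l [|l2 I]]; first by rewrite big_nil; clear; lia.
    by move: (\sum_(_ <- _) _)%N => K _ /(_ erefl) + _ /=; clear; lia.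
  by move: (\sum_(_ <- _) _)%N => K _ _ /(_ isT) /=; clear; lia.
Qed.

Lemma colored_lobes : sparse base (map lgad ls ++ L) ->
  exists2 f, pcol f base L & forall l, l \in ls -> exists o : Z5,
    [/\ okh f (la l) o, okh f (lb l) o, okh f (la l) (o + 1) & okh f (lb l) (o + 1)].
Proof.
move=> sp'; have [|f] := min_IH M _ sp'.
  by have := subset_leq_card base_sub; have := cardsD1 u U; rewrite uU; clear; lia.
rewrite /pcol all_cat all_map => /andP[/allP pg pf]; exists f => // l hl.
have := pg l hl; have [aB bB] := lobe_base hl; rewrite /= /inside /src /tgt /= aB bB /= sat_gad.
have [_ [_ [hu [_ _ _ k2 k3]]]] := lobes hl; move: k3; rewrite leq_eqVlt => /andP[/orP[/eqP k E|k2' k3] sg].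
  move: sg; rewrite -k => /lobe_options2[x /and4P[x1 x2 x3 x4]]; exists (start f (la l) + x).
  by rewrite -(addrA (start f (la l))) !okh_shift subrr !subr0 k2 -[hk (la l)]/(lk l) -k x1 x2 x3 x4.
have k : lk l = 3%N by move: k2' k3; clear; lia.
move: sg; rewrite k => /lobe_options3[x /and4P[x1 x2 x3 x4]]; exists (start f (la l) + x).
by rewrite -(addrA (start f (la l))) !okh_shift subrr !subr0 k2 -[hk (la l)]/(lk l) k x1 x2 x3 x4.
Qed.

(** By [sep] the centres are pairwise nonadjacent, and [u] is still uncoloured, so each centre
    chooses its colour independently. *)
Lemma extend_lobes f (Q : lobe -> Z5 -> Prop) : pcol f base L ->
  (forall l, l \in ls -> exists o, [/\ okh f (la l) o, okh f (lb l) o & Q l o]) ->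
  exists g, [/\ pcol g (U :\ u) L, {in base, g =1 f} & forall l, l \in ls -> Q l (g (lw l))].
Proof.
move=> pf hQ; suff H I : {subset I <= ls} -> uniq (map lw I) ->
    exists g, [/\ pcol g (addw I base) L, {in base, g =1 f} & forall l, l \in I -> Q l (g (lw l))].
  have [//|//|g [pg gf gQ]] := H ls; exists g; split=> //.
  have -> : U :\ u = addw ls base => //; apply/setP => x; rewrite in_addw !inE.
  have [/mapP[l hl ->]|] := boolP (x \in map lw ls); last by case: (x == u); case: (x \in U).
  by have [[-> _ _] [-> _ _] _ _] := is_lobe_nbrs uU (lobes hl).
elim: I => [|l I IH] Il /=; first by exists f.
case/andP => wI uI; have lI : {subset I <= ls} by move=> x xI; apply: Il; rewrite inE xI orbT.
have [g [pg gf gQ]] := IH lI uI; have hl : l \in ls := Il _ (mem_head _ _).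
have wB : lw l \notin base by rewrite !inE map_f ?andbF.
have wT : lw l \notin addw I base by rewrite in_addw negb_or wI.
have [o [o1 o2 o3]] := hQ l hl; exists (fun y => if y == lw l then o else g y).
have gB : {in base, (fun y => if y == lw l then o else g y) =1 f}.
  by move=> y yB /=; rewrite -gf //; case: eqP yB wB => // -> ->.
split=> //.
  apply: pcol_addv => //; first exact: (nl M).
  have [_ [_ [hu [ps eu _ _ _]]]] := lobes hl; have [aB bB] := lobe_base hl.
  move=> h; rewrite (perm_mem ps) !inE => /or3P[] /eqP ->.
  - rewrite eu in_addw => /orP[/mapP[l' l'I E]|]; last by rewrite !inE eqxx andbF.
    by have [_ [] ] := is_lobe_nbrs uU (lobes (lI _ l'I)); rewrite E eqxx.
  - by rewrite /okh /start gf.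
  - by rewrite /okh /start gf.
move=> l'; rewrite inE => /orP[/eqP ->|l'I]; first by rewrite eqxx.
case: eqP => [E|_]; last exact: gQ.
by move: wI; rewrite -E map_f.
Qed.

End Lobes.
End Minimal.

(** * Vertices with two or three lobes *)

Lemma exceptional_colors (m s1 : Z5) : exists c0 : Z5, forall s : Z5, (1 <= (s - c0)%R)%N ->
  exists c : Z5, [&& 2 <= (c - s)%R, 1 <= (c - m)%R & 2 <= (c - s1)%R]%N.
Proof.
elim/forall_Z5: m; elim/forall_Z5: s1;
  first [ by exists 0; elim/forall_Z5 => // _; z5ex | by exists 1; elim/forall_Z5 => // _; z5ex
  | by exists 2%:R; elim/forall_Z5 => // _; z5ex | by exists 3%:R; elim/forall_Z5 => // _; z5ex
  | by exists 4%:R; elim/forall_Z5 => // _; z5ex ].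
Qed.

Lemma arcs1111 (d e g : Z5) : exists x : Z5, [&& 1 <= x, 1 <= (x - d)%R, 1 <= (x - e)%R & 1 <= (x - g)%R]%N.
Proof. by elim/forall_Z5: d; elim/forall_Z5: e; elim/forall_Z5: g; z5ex. Qed.

Section Minimal.
Variables (V : finType) (U : {set V}) (L : seq (gedge V)).
Hypothesis M : minimal U L.
Implicit Types (S R Q : {set V}) (u v x y z : V) (h : hedge V) (f : V -> Z5) (l : lobe V).

Notation P := (pot L).
Let sp : sparse U L := min_sparse M.
Let wL : weighted L := sp_wt sp.
Local Notation dg := (dg L).
Local Notation dv := (dv L).

Section TwoLobes.
Variables (v : V) (l1 l2 : lobe V) (he : hedge V).
Hypotheses (vU : v \in U) (ps : perm_eq (hed L v) [:: l1.1.1; l2.1.1; he]).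
Hypotheses (L1 : is_lobe L v l1) (L2 : is_lobe L v l2) (ke : hk he = 2%N).

Let ls := [:: l1; l2].
Let B := base U v ls.
Let k1 : hk l1.1.1 = 2%N. Proof. by case: L1 => _ []. Qed.
Let k2 : hk l2.1.1 = 2%N. Proof. by case: L2 => _ []. Qed.
Let lobes l : l \in ls -> is_lobe L v l.
Proof. by rewrite !inE => /orP[] /eqP ->. Qed.

Lemma two_lobes_neq : uniq (map (@lw V) ls) /\ nbr he != lw l1 /\ nbr he != lw l2.
Proof.
by have [_ _ [h1 h2 h3]] := nbrs222 M vU ps k1 k2 ke; rewrite /= inE andbT; split=> //; rewrite !(eq_sym (nbr he)).
Qed.

(** By [seven222] the two centres have potential at least 8, so edges between them cost at most 2,
    while the half-edges of a lobe cost 3 or 4. *)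
Lemma two_lobes_sep l l' : l \in ls -> l' \in ls -> nbr (la l) != lw l' /\ nbr (lb l) != lw l'.
Proof.
have [[w1U w2U eU] [w1v w2v ev] [h1 h2 h3]] := nbrs222 M vU ps k1 k2 ke.
have ps' : perm_eq (hed L v) [:: he; l1.1.1; l2.1.1].
  by rewrite (perm_trans ps) // -[X in perm_eq _ X]/([:: he] ++ [:: l1.1.1; l2.1.1]) perm_sym perm_catC.
have SU : [set lw l1; lw l2] \subset U :\ v by rewrite subUset !sub1set !inE w1U w2U w1v w2v.
have := seven222 M vU ps' ke k1 k2 SU (set21 _ _) (set22 _ _).
rewrite !inE negb_or !(eq_sym (nbr he)) h2 h3 (P2 M h1) => /(_ isT).
rewrite -/(lw l1) -/(lw l2) => P8.
have H l0 w' : is_lobe L v l0 -> lw l0 != w' -> (cst L [set lw l0] [set w'] <= 2)%N ->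
    nbr (la l0) != w' /\ nbr (lb l0) != w'.
  move=> hl ne; rewrite cst_hed ?inE // -[X in (X <= _)%N]/(dg (lw l0) [set w']) (is_lobe_dg _ hl) !inE.
  have := is_lobe_k hl; case: (_ == w'); case: (_ == w'); case: (_ == w'); clear; lia.
have c12 : (cst L [set lw l1] [set lw l2] <= 2)%N by move: P8; clear; lia.
have [_ [_ s1 s2] _ _] := is_lobe_nbrs M vU L1; have [_ [_ t1 t2] _ _] := is_lobe_nbrs M vU L2.
move=> /orP[] /eqP -> /orP[] /eqP -> //.
  exact: H.
by apply: H => //; [rewrite eq_sym | rewrite cstC].
Qed.

Let un := two_lobes_neq.1.
Let sep := two_lobes_sep.

Lemma dv_v : (5 + 2 * size ls <= dv v)%N.
Proof. by have [_ -> _] := hed_subseq ps; rewrite !big_cons big_nil k1 k2 ke. Qed.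

Lemma he_base : nbr he \in B.
Proof.
have [[w1U w2U eU] [w1v w2v ev] _] := nbrs222 M vU ps k1 k2 ke.
by have [_ [n1 n2]] := two_lobes_neq; rewrite !inE eU ev negb_or n1 n2.
Qed.

Lemma finish_lobes f c : pcol f B L -> (2 <= (c - start f he)%R)%N ->
  (forall l, l \in ls -> exists o : Z5, [/\ okh f (la l) o, okh f (lb l) o & (2 <= (c - (o + l.1.1.2.1))%R)%N]) -> False.
Proof.
move=> pf ce hQ; have [g [pg gf gQ]] := extend_lobes M vU lobes un sep pf hQ.
apply: (no_extension_perm M vU pg ps (c := c)).
have e3 : start g he = start f he by rewrite /start gf ?he_base.
have e1 : (2 <= (c - start g l1.1.1)%R)%N by apply: gQ; rewrite inE eqxx.
have e2 : (2 <= (c - start g l2.1.1)%R)%N by apply: gQ; rewrite !inE eqxx orbT.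
by rewrite /= /okh k1 k2 ke e1 e2 e3 ce.
Qed.

Lemma lin_all R : lin ls R = ls -> [/\ nbr (la l1) \in R, nbr (lb l1) \in R, nbr (la l2) \in R & nbr (lb l2) \in R].
Proof.
by rewrite /lin => /all_filterP /=; rewrite andbT => /andP[/andP[-> ->] /andP[-> ->]].
Qed.

Lemma lin_cases R : nbr (la l2) \in R -> nbr (lb l2) \in R -> lin ls R = [:: l2] \/ lin ls R = ls.
Proof. by rewrite /lin /= => -> ->; case: ifP => _; [right|left]. Qed.

Lemma lin_cases1 R : nbr (la l1) \in R -> nbr (lb l1) \in R -> lin ls R = [:: l1] \/ lin ls R = ls.
Proof. by rewrite /lin /= => -> ->; case: ifP => _; [right|left]. Qed.

Let PB R : R \subset B -> R != set0 ->
  (lin ls R = [:: l1] -> 5 + (lk l1)%:Z <= P R) /\ (lin ls R = [:: l2] -> 5 + (lk l2)%:Z <= P R) /\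
  (lin ls R = ls -> 5 + (lk l1 + lk l2)%N%:Z <= P R).
Proof.
move=> RB R0; have [_ p1 p2] := P_lobes M vU lobes un RB R0.
split; [|split] => E; move: p1 p2; rewrite E ?big_cons ?big_nil ?addn0 /=.
- by move=> /(_ erefl).
- by move=> /(_ erefl).
by move=> _ /(_ isT dv_v).
Qed.

(** Over such a small dense set the two gadgets cannot be used together. [R] is coloured by itself,
    with the full gadget for [l2] but only an edge of weight 1 for [l1], which secures one option
    instead of two. The lobes then forbid 1 + 2 colours at [v]; together with the arc of [he] this
    covers Z5 for at most one position of that arc, which is avoided by an extra edge of weight 1
    when [R] is collapsed. *)
Lemma exceptional_lobes R : R \subset B -> lin ls R = ls -> lk l2 = 3%N ->
  P R <= 5 + (lk l1 + lk l2)%N%:Z -> (#|R| <= 3)%N -> False.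
Proof.
move=> RB Rl k3 PR R3; have [a1R b1R a2R b2R] := lin_all Rl.
have BU : B \subset U :\ v := base_sub U v ls; have RU := subset_trans RB BU.
have R0 : (0 < #|R|)%N by apply/card_gt0P; exists (nbr (la l1)).
have ne0 x (T : {set V}) : x \in T -> T != set0 by move=> xT; apply/set0Pn; exists x.
have lk1 := is_lobe_k L1.
have [_ _ [_ _ ab1] _] := is_lobe_nbrs M vU L1; have [_ _ [_ _ ab2] _] := is_lobe_nbrs M vU L2.
have sR : sparse R L by apply: sparse_sub sp; apply: sub_del RU.
(* For [l1] a single free colour suffices: arcs of lengths 3 and 2 cover Z5 only in position 3, and
   two arcs of length 2 never do. *)
pose G := lgad l2; pose G' := gad (la l1) (lb l1) 3%:R 1.
have PG (T : {set V}) : T \subset R -> nbr (la l2) \in T -> nbr (lb l2) \in T -> 8 <= P T.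
  move=> TR aT bT; have [_ [p1 p2]] := PB (subset_trans TR RB) (ne0 _ _ aT).
  by case: (lin_cases aT bT) => E; [have := p1 E|have := p2 E]; rewrite k3; move: lk1; clear; lia.
have PG' (T : {set V}) : T \subset R -> nbr (la l1) \in T -> nbr (lb l1) \in T ->
    7 <= P T /\ ((nbr (la l2) \in T) && (nbr (lb l2) \in T) -> 10 <= P T).
  move=> TR aT bT; have [p1 [_ p2]] := PB (subset_trans TR RB) (ne0 _ _ aT).
  case: (lin_cases1 aT bT) => E.
    have := p1 E; move: E; rewrite /lin /= aT bT /=; case: ifP => // _ _.
    by move: lk1; clear => h1 h2; split=> //; lia.
  by have := p2 E; rewrite k3; move: lk1; clear => h1 h2; split=> //; lia.
have pS x y (T : {set V}) : x \in T -> y \in T -> [set x; y] \subset T by rewrite subUset !sub1set => -> ->.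
have sG : sparse R (G :: L).
  apply: sparse_cons => //.
  - by rewrite [wt G]k3.
  - move=> T TR; rewrite [src G]/(nbr (la l2)) [tgt G]/(nbr (lb l2)) [wt G]k3 => aT bT.
    by have := PG T TR aT bT; clear; lia.
  - rewrite [wt G]k3; suff: (kap L [set nbr (la l2)] [set nbr (lb l2)] + 3 <= 4)%N by [].
    have := PG _ (pS _ _ _ a2R b2R) (set21 _ _) (set22 _ _); rewrite (P2 M ab2).
    by have := kap_cst [set nbr (la l2)] [set nbr (lb l2)] wL; clear; lia.
  - move=> _ t tR.
    suff: ~~ (has3 L [set nbr (la l2)] [set t] && has3 L [set nbr (lb l2)] [set t]) by [].
    apply/negP => /andP[h3a h3b].
    have tab : t \notin [set nbr (la l2); nbr (lb l2)].
      by rewrite !inE negb_or eq_sym (has3_neq M h3a) eq_sym (has3_neq M h3b).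
    have := PG (t |: [set nbr (la l2); nbr (lb l2)]); rewrite (P_cst M tab) cst_pair // (P2 M ab2).
    rewrite subUset sub1set tR (pS _ _ _ a2R b2R) !inE !eqxx !orbT => /(_ isT isT isT).
    rewrite ![cst L [set t] _]cstC; have := has3_cst h3a; have := has3_cst h3b; clear; lia.
have sG' : sparse R (G' :: G :: L).
  apply: sparse_cons => //.
  - move=> T TR; rewrite [src G']/(nbr (la l1)) [tgt G']/(nbr (lb l1)) => aT bT.
    have iG : inside T G = (nbr (la l2) \in T) && (nbr (lb l2) \in T) by [].
    have [p7 p10] := PG' T TR aT bT; rewrite pot_cons [wt G]k3 iG.
    suff: 5 <= P T - (if (nbr (la l2) \in T) && (nbr (lb l2) \in T) then 4%N else 0%N)%:Z by [].
    by case: (_ && _) p10 => [/(_ isT)|_]; move: p7; clear; lia.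
  - suff: (kap (G :: L) [set nbr (la l1)] [set nbr (lb l1)] + 1 <= 4)%N by [].
    rewrite kap_cons [wt G]k3.
    rewrite (lgad_cross M vU lobes ab1) ?inE ?eqxx ?orbT //.
    have [p7 p10] := PG' _ (pS _ _ _ a1R b1R) (set21 _ _) (set22 _ _); move: p7 p10; rewrite (P2 M ab1) !inE.
    have := kap_cst [set nbr (la l1)] [set nbr (lb l1)] wL.
    case: ifP => _; first by move=> h _ /(_ isT); move: h; clear; lia.
    by clear; lia.
have [|f] := min_IH M _ sG'; first by have := subset_leq_card RU; have := cardsD1 v U; rewrite vU; clear; lia.
rewrite !pcol_cons {1}[inside R G']/(_ && _) {1}[inside R G]/(_ && _) /= /src /tgt /= a1R b1R a2R b2R /=.
rewrite !sat_gad => /and3P[s1 s2 pf].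
have [o1 o1a o1b] : exists2 o, okh f (la l1) o & okh f (lb l1) o.
  have [_ [_ [hu [_ _ _ kb _]]]] := L1.
  have [E|E] : (lk l1 = 2%N \/ lk l1 = 3%N) by move: lk1; clear; lia.
    have [x /andP[x1 x2]] := arcs22any (start f (lb l1) - start f (la l1)).
    by exists (start f (la l1) + x); rewrite okh_shift ?subrr ?subr0 ?kb // -[hk _]/(lk l1) E.
  have [x /andP[x1 x2]] := loc32 s1.
  by exists (start f (la l1) + x); rewrite okh_shift ?subrr ?subr0 ?kb // -[hk _]/(lk l1) E.
have [o2 [o2a o2b o2c o2d]] : exists o : Z5, [/\ okh f (la l2) o, okh f (lb l2) o, okh f (la l2) (o + 1) & okh f (lb l2) (o + 1)].
  have [_ [_ [hu [_ _ _ kb _]]]] := L2; move: s2; rewrite k3 => /lobe_options3[x /and4P[x1 x2 x3 x4]].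
  exists (start f (la l2) + x).
  by rewrite -(addrA (start f (la l2))) !okh_shift subrr !subr0 kb -[hk (la l2)]/(lk l2) k3 x1 x2 x3 x4.
have [c0 hc0] := exceptional_colors (o2 + 1 + l2.1.1.2.1) (o1 + l1.1.1.2.1).
have eR : nbr he \notin R.
  apply/negP => eR; have Il : {subset ls <= ls} by [].
  have [|E D] := P_addw M vU lobes Il un RB; first by move=> l; rewrite !inE => /orP[] /eqP ->.
  have TU := addw_sub M vU lobes Il RB.
  have T0 : (0 < #|addw ls R|)%N by apply/card_gt0P; exists (lw l1); rewrite in_addw /= inE eqxx.
  have dgv : dg v (addw ls R) = 9%N.
    rewrite (dg222 ps) // !in_addw eR /= !inE [nbr l1.1.1]/(lw l1) [nbr l2.1.1]/(lw l2) !eqxx !orbT //.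
  move: E; rewrite !big_cons big_nil addn0 /= => E.
  have := P_delE M vU TU T0; rewrite dgv E; case; first by move: PR; clear; lia.
  (* At most [v], two centres and three vertices of [R] are present; then all costs are 9, but
     [lw l2] costs 10. *)
  case=> UE _; have U6 : (#|U| <= 6)%N.
    by rewrite -UE /= !cardsU1; move: R3; do 3 case: (_ \notin _); clear; lia.
  have {}U6 : (#|U| = 6)%N by have := U_gt5 M; move: U6; clear; lia.
  have [[w2U _ _] _ _ _] := is_lobe_nbrs M vU L2.
  by have := six_vertices_dv9 M U6 w2U; rewrite (is_lobe_dv L2) k3.
have [|g [pg gf gk]] := @extend2 V U L M R B f (nbr he) (c0 - he.2.1) 1%N RB (sub_del BU) R0
    (card_del M vU BU RB R0) pf he_base eR isT (or_intror erefl).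
  move=> T RT TB; have RT' := proper_sub RT.
  have Tl : lin ls T = ls by rewrite /lin /= !(subsetP RT').
  have [_ [_ p2]] := PB TB (ne0 _ _ (subsetP RT' _ a1R)); have := p2 Tl; move: PR.
  by case: ifP; clear; lia.
have [|c /and3P[c1 c2 c3]] := hc0 (start g he).
  by apply: etrans gk; congr (leq _ (nat_of_ord _)); rewrite /start; ring.
have sg h : nbr h \in R -> start g h = start f h by move=> hR; rewrite /start gf.
apply: (finish_lobes pg c1) => l; rewrite !inE => /orP[] /eqP ->.
  by exists o1; rewrite /okh !sg.
have E o : o + 1 + l2.1.1.2.1 = o + l2.1.1.2.1 + 1 by ring.
by rewrite E in c2; case/orP: (two_options c2) => c4; [exists o2|exists (o2 + 1)]; rewrite /okh !sg //; rewrite E.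
Qed.

End TwoLobes.
End Minimal.

Lemma pot_three3 (V : finType) (L : seq (gedge V)) x y z :
  all (fun e => src e != tgt e) L -> x != y -> y != z -> x != z ->
  has3 L [set x] [set y] -> has3 L [set y] [set z] -> has3 L [set x] [set z] ->
  pot L (x |: [set y; z]) <= 3.
Proof.
move=> nl xy yz xz h1 h2 h3.
have nl' v : all (fun e => ~~ ((src e == v) && (tgt e == v))) L.
  by apply: sub_all nl => e; apply: contraNN => /andP[/eqP -> /eqP ->].
have xyz : x \notin [set y; z] by rewrite !inE negb_or xy.
have yz1 : y \notin [set z] by rewrite inE.
rewrite (pot_addv xyz (nl' x)) (pot_addv yz1 (nl' y)) cst_pair //.
have -> : pot L [set z] = 5.
  rewrite -[[set z]]setU0 pot_addv ?inE // /cst big1 => [|e]; last by rewrite /cross !inE !andbF.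
  by rewrite /pot cards0 /cost big1 => [|e] //; rewrite /inside !inE.
by have := has3_cst h1; have := has3_cst h2; have := has3_cst h3; clear; lia.
Qed.

Section Minimal.
Variables (V : finType) (U : {set V}) (L : seq (gedge V)).
Hypothesis M : minimal U L.
Implicit Types (S R Q : {set V}) (u v x y z : V) (h : hedge V) (f : V -> Z5) (l : lobe V).

Notation P := (pot L).
Let sp : sparse U L := min_sparse M.
Local Notation dg := (dg L).
Local Notation dv := (dv L).

Lemma lobe_gads_loopless u (ls : seq (lobe V)) : u \in U -> (forall l, l \in ls -> is_lobe L u l) ->
  all (fun e => src e != tgt e) (map (@lgad V) ls ++ L).
Proof.
move=> uU lobes; rewrite all_cat all_map; apply/andP; split.
  by apply/allP => l hl /=; have [_ _ [_ _ ab] _] := is_lobe_nbrs M uU (lobes l hl).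
by apply/allP => e eL; have := allP (nl M (tgt e)) _ eL; rewrite eqxx andbT.
Qed.

Lemma lin_sub (ls : seq (lobe V)) R R' : R \subset R' -> {subset lin ls R <= lin ls R'}.
Proof.
by move=> RR l; rewrite !mem_filter => /andP[/andP[aR bR] ->]; rewrite !(subsetP RR).
Qed.

(** Each lobe forbids one colour at [v] and [he] two, so a fifth is free. If the gadgets destroy
    sparseness, both lie over a set of two or three vertices and one has weight 3, which is the case
    of [exceptional_lobes]. *)
Lemma two_lobes_le v l1 l2 he : v \in U -> perm_eq (hed L v) [:: l1.1.1; l2.1.1; he] ->
  is_lobe L v l1 -> is_lobe L v l2 -> hk he = 2%N -> (lk l1 <= lk l2)%N -> False.
Proof.
move=> vU ps L1 L2 ke k12; pose ls := [:: l1; l2]; pose B := base U v ls.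
have lobes l : l \in ls -> is_lobe L v l by rewrite !inE => /orP[] /eqP ->.
have [un _] := two_lobes_neq M vU ps L1 L2 ke; have hd := dv_v ps L1 L2 ke.
have sep := two_lobes_sep M vU ps L1 L2 ke.
have lin2 R : size (lin ls R) = 2%N -> lin ls R = ls by rewrite /lin /=; case: ifP; case: ifP.
have kk1 := is_lobe_k L1; have kk2 := is_lobe_k L2.
have bU z : z \in B -> z \in U by rewrite inE => /andP[].
have [|f pf hf] := colored_lobes M vU lobes sep.
  apply: (sparse_lobes M vU lobes un hd).
  - move=> x y xB yB xy; have [//|[s2 K5 c0]] := kap_lobes M vU lobes un hd xB yB xy.
    exfalso; have Rl := lin2 _ s2; move: K5; rewrite Rl !big_cons big_nil addn0 => K5.
    apply: (exceptional_lobes M vU ps L1 L2 ke (R := [set x; y])) => //.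
    + by rewrite subUset !sub1set xB.
    + by move: K5 kk1 kk2 k12; clear; lia.
    + by rewrite (P2 M xy) c0 K5.
    + by rewrite cards2; case: (_ == _).
  - move=> x y z xB yB zB xy yz xz; apply/negP => /and3P[t1 t2 t3].
    have := pot_three3 (lobe_gads_loopless vU lobes) xy yz xz t1 t2 t3.
    set R := x |: [set y; z]; rewrite pot_gads => PR.
    have RB : R \subset B by rewrite !subUset !sub1set xB yB.
    have R0 : R != set0 by apply/set0Pn; exists x; rewrite !inE eqxx.
    have [_ p1 p2] := P_lobes M vU lobes un RB R0.
    have tri : (forall l, l \in lin ls R -> lk l != 3%N) -> False.
      move=> no3; have r3 a b : a \in R -> b \in R -> a != b -> has3 (map (@lgad V) ls ++ L) [set a] [set b] -> has3 L [set a] [set b].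
        move=> aR bR ab; rewrite (has3_gads M vU lobes ab) => /orP[/hasP[l hl /eqP k3]|//].
        by have := no3 l; rewrite k3 => /(_ (lin_sub _ hl)); rewrite subUset !sub1set aR bR => /(_ isT).
      have := sp_tri sp (bU x xB) (bU y yB) (bU z zB) xy yz xz.
      by rewrite !r3 // !inE ?eqxx ?orbT.
    case: (ltngtP (size (lin ls R)) 1) => s.
    + by apply: tri; move: s; rewrite ltnS leqn0 size_eq0 => /eqP ->.
    + have Rl : lin ls R = ls.
        by move: s; rewrite /lin /=; case: ifP; case: ifP.
      have [E3|n3] := eqVneq (lk l2) 3%N; last first.
        by apply: tri => l; rewrite Rl !inE => /orP[] /eqP ->; move: n3 k12 kk1 kk2; clear; lia.
      apply: (exceptional_lobes M vU ps L1 L2 ke RB Rl E3).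
        by move: PR; rewrite Rl !big_cons big_nil /= addn0; clear; lia.
      by rewrite cardsU1 cards2; case: (_ \notin _); case: (_ == _).
    + by have := p1 s; move: PR; rewrite s; clear; lia.
have [o1 [a1 b1 a1' b1']] := hf l1 (mem_head _ _).
have [|o2 [a2 b2 a2' b2']] := hf l2; first by rewrite !inE eqxx orbT.
have [x /and3P[x1 x2 x3]] := arcs211 (o1 + l1.1.1.2.1 + 1 - start f he) (o2 + l2.1.1.2.1 + 1 - start f he).
apply: (finish_lobes M vU ps L1 L2 ke pf (c := start f he + x)).
  by apply: etrans x1; congr (leq _ (nat_of_ord _)); ring.
have E (o d c : Z5) : (1 <= (x - (o + d + 1 - start f he))%R)%N -> c = start f he + x ->
    (2 <= (c - (o + d))%R)%N || (2 <= (c - (o + 1 + d))%R)%N.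
  move=> h ->; rewrite (_ : o + 1 + d = o + d + 1); last by ring.
  by apply: two_options; apply: etrans h; congr (leq _ (nat_of_ord _)); ring.
move=> l; rewrite !inE => /orP[] /eqP ->.
  by case/orP: (E _ _ _ x2 erefl) => h; [exists o1|exists (o1 + 1)].
by case/orP: (E _ _ _ x3 erefl) => h; [exists o2|exists (o2 + 1)].
Qed.

Lemma two_lobes v l1 l2 he : v \in U -> perm_eq (hed L v) [:: l1.1.1; l2.1.1; he] ->
  is_lobe L v l1 -> is_lobe L v l2 -> hk he = 2%N -> False.
Proof.
move=> vU ps L1 L2 ke; have [k12|k21] := leqP (lk l1) (lk l2); first exact: (two_lobes_le vU ps L1 L2 ke).
apply: (two_lobes_le vU _ L2 L1 ke (ltnW k21)).
by rewrite (perm_trans ps) // (perm_catCA [:: l1.1.1] [:: l2.1.1] [:: he]).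
Qed.

Section ThreeLobes.
Variables (u : V) (l1 l2 l3 : lobe V) (he : hedge V).
Hypotheses (uU : u \in U) (ps : perm_eq (hed L u) [:: l1.1.1; l2.1.1; l3.1.1; he]).
Hypotheses (L1 : is_lobe L u l1) (L2 : is_lobe L u l2) (L3 : is_lobe L u l3) (ke : hk he = 1%N).
Hypotheses (k1 : lk l1 = 2%N) (k2 : lk l2 = 2%N) (k3 : lk l3 = 2%N).

Let ls := [:: l1; l2; l3].
Let B := base U u ls.
Let lobes l : l \in ls -> is_lobe L u l.
Proof. by rewrite !inE => /or3P[] /eqP ->. Qed.
Let lk2 l : l \in ls -> lk l = 2%N.
Proof. by rewrite !inE => /or3P[] /eqP ->. Qed.

Let dgu S : dg u S = (3 * (lw l1 \in S) + 3 * (lw l2 \in S) + 3 * (lw l3 \in S) + 2 * (nbr he \in S))%N.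
Proof.
have [_ [e1 _]] := L1; have [_ [e2 _]] := L2; have [_ [e3 _]] := L3.
have [_ _ ->] := hed_subseq ps; rewrite !big_cons big_nil e1 e2 e3 ke -/(lw l1) -/(lw l2) -/(lw l3).
by do 4 case: (_ \in S).
Qed.

Lemma three_lobes_uniq : uniq (map (@lw V) ls) /\ nbr he \in B.
Proof.
have hl l : l \in ls -> (dg u [set lw l] <= 4)%N.
  by move=> hl; have [[wU _ _] [wu _ _] _ _] := is_lobe_nbrs M uU (lobes hl); apply: (dg1 M).
have d1 := hl l1; have d2 := hl l2; have d3 := hl l3; move: d1 d2 d3; rewrite !dgu !inE !eqxx !orbT.
move=> /(_ isT) + /(_ isT) + /(_ isT).
have hh : he \in hed L u by rewrite (perm_mem ps) !inE eqxx !orbT.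
have [_ eU eu _] := hedU M hh; rewrite /= !inE eU eu /=.
rewrite (eq_sym (lw l2) (lw l1)) (eq_sym (lw l3) (lw l1)) (eq_sym (lw l3) (lw l2)).
case: (lw l1 == lw l2); case: (lw l1 == lw l3); case: (lw l2 == lw l3);
case: (nbr he == lw l1); case: (nbr he == lw l2); case: (nbr he == lw l3); clear; move=> h1 h2 h3; split=> //; exfalso; lia.
Qed.

Lemma three_lobes_sep l l' : l \in ls -> l' \in ls -> nbr (la l) != lw l' /\ nbr (lb l) != lw l'.
Proof.
move=> hl hl'; have [[wU aU bU] [wu aw bw] [au bu ab] d3] := is_lobe_nbrs M uU (lobes hl).
have [[wU' _ _] [wu' _ _] _ d3'] := is_lobe_nbrs M uU (lobes hl').
have [h0 [_ [hu [psw eu khu kb _]]]] := lobes hl; have ka : hk (la l) = 2%N := lk2 hl.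
have uw' : u != lw l' by rewrite eq_sym.
have P7 : P [set u; lw l'] <= 7.
  by rewrite (P2 M uw') cst_hed ?inE //; move: d3'; rewrite /dg; clear; lia.
have SU y : y \in U -> y != lw l -> [set u; y] \subset U :\ lw l.
  by move=> yU yw; rewrite subUset !sub1set !inE uU yU yw eq_sym wu.
have p1 : perm_eq (hed L (lw l)) [:: lb l; hu; la l].
  by rewrite (perm_trans psw) // -[X in perm_eq _ X]/([:: lb l] ++ [:: hu; la l]) perm_sym perm_catC.
have p2 : perm_eq (hed L (lw l)) [:: la l; hu; lb l].
  by rewrite (perm_trans psw) // (perm_catCA [:: hu] [:: la l] [:: lb l]).
have ba : (nbr (lb l) == nbr (la l)) = false by rewrite eq_sym (negbTE ab).
split; apply/eqP => E.
  have := seven222 M wU p1 kb khu ka (SU _ aU aw); rewrite eu !inE !eqxx orbT (negbTE bu) ba.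
  by move=> /(_ isT isT isT); rewrite E; move: P7; clear; lia.
have := seven222 M wU p2 ka khu kb (SU _ bU bw); rewrite eu !inE !eqxx orbT (negbTE au) (negbTE ab).
by move=> /(_ isT isT isT); rewrite E; move: P7; clear; lia.
Qed.

(** The three lobes and [he] forbid one colour each. All gadgets have weight 2, so neither the
    exception of [kap_lobes] nor a new weight 3 triangle occurs. *)
Lemma three_lobes : False.
Proof.
have [un eB] := three_lobes_uniq; have sep := three_lobes_sep.
have lk2' R l : l \in lin ls R -> lk l = 2%N by rewrite mem_filter => /andP[_ /lk2].
have [_ [e1 _]] := L1; have [_ [e2 _]] := L2; have [_ [e3 _]] := L3.
have hd : (5 + 2 * size ls <= dv u)%N.
  by have [_ -> _] := hed_subseq ps; rewrite !big_cons big_nil ke e1 e2 e3.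
have bU z : z \in B -> z \in U by rewrite inE => /andP[].
have [|f pf hf] := colored_lobes M uU lobes sep.
  apply: (sparse_lobes M uU lobes un hd).
  - move=> x y xB yB xy; have [//|[s2 + _]] := kap_lobes M uU lobes un hd xB yB xy.
    by rewrite big_seq (eq_bigr (fun=> 2%N) (lk2' _)) -big_seq big_const_seq count_predT s2.
  - move=> x y z xB yB zB xy yz xz; rewrite !(has3_gads M uU lobes) //.
    have no R : has (fun l => lk l == 3%N) (lin ls R) = false.
      by apply/negP => /hasP[l /lk2' ->].
    by rewrite !no; apply: (sp_tri sp (bU x xB) (bU y yB) (bU z zB) xy yz xz).
have [o1 [a1 b1 a1' b1']] : exists o, [/\ okh f (la l1) o, okh f (lb l1) o, okh f (la l1) (o + 1) & okh f (lb l1) (o + 1)].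
  by apply: hf; rewrite !inE eqxx ?orbT.
have [o2 [a2 b2 a2' b2']] : exists o, [/\ okh f (la l2) o, okh f (lb l2) o, okh f (la l2) (o + 1) & okh f (lb l2) (o + 1)].
  by apply: hf; rewrite !inE eqxx ?orbT.
have [o3 [a3 b3 a3' b3']] : exists o, [/\ okh f (la l3) o, okh f (lb l3) o, okh f (la l3) (o + 1) & okh f (lb l3) (o + 1)].
  by apply: hf; rewrite !inE eqxx ?orbT.
have [x /and4P[x0 x1 x2 x3]] := arcs1111 (o1 + l1.1.1.2.1 + 1 - start f he)
  (o2 + l2.1.1.2.1 + 1 - start f he) (o3 + l3.1.1.2.1 + 1 - start f he).
pose c := start f he + x.
have E (o d : Z5) : (1 <= (x - (o + d + 1 - start f he))%R)%N ->
    (2 <= (c - (o + d))%R)%N || (2 <= (c - (o + 1 + d))%R)%N.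
  move=> h; rewrite (_ : o + 1 + d = o + d + 1); last by ring.
  by apply: two_options; apply: etrans h; rewrite /c; congr (leq _ (nat_of_ord _)); ring.
have hQ l : l \in ls -> exists o : Z5, [/\ okh f (la l) o, okh f (lb l) o & (2 <= (c - (o + l.1.1.2.1))%R)%N].
  rewrite !inE => /or3P[] /eqP ->.
  - by case/orP: (E _ _ x1) => h; [exists o1|exists (o1 + 1)].
  - by case/orP: (E _ _ x2) => h; [exists o2|exists (o2 + 1)].
  - by case/orP: (E _ _ x3) => h; [exists o3|exists (o3 + 1)].
have [g [pg gf gQ]] := extend_lobes M uU lobes un sep pf hQ.
apply: (no_extension_perm M uU pg ps (c := c)).
have q0 : start g he = start f he by rewrite /start gf.
have q1 : (2 <= (c - start g l1.1.1)%R)%N by apply: gQ; rewrite !inE eqxx ?orbT.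
have q2 : (2 <= (c - start g l2.1.1)%R)%N by apply: gQ; rewrite !inE eqxx ?orbT.
have q3 : (2 <= (c - start g l3.1.1)%R)%N by apply: gQ; rewrite !inE eqxx ?orbT.
rewrite /= /okh e1 e2 e3 ke q1 q2 q3 q0 andbT /=.
by apply: etrans x0; rewrite /c; congr (leq _ (nat_of_ord _)); ring.
Qed.

End ThreeLobes.
End Minimal.

(** * Discharging *)

Lemma perm_map_lift (T S : eqType) (f : T -> S) (s : seq T) (t : seq S) :
  perm_eq (map f s) t -> exists2 s', perm_eq s s' & map f s' = t.
Proof.
elim: t s => [|y t IH] s ps.
  by exists [::]; move/perm_size: ps; rewrite size_map // => /size0nil ->.
have /mapP[x xs E] : y \in map f s by rewrite (perm_mem ps) mem_head.
have px := perm_to_rem xs; have [s' p1 p2] : exists2 s', perm_eq (rem x s) s' & map f s' = t.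
  apply: IH; rewrite -(perm_cons y); apply: perm_trans ps.
  by rewrite E -map_cons perm_sym perm_map.
by exists (x :: s'); [rewrite (permPl px) perm_cons | rewrite /= p2 E].
Qed.

Section Minimal.
Variables (V : finType) (U : {set V}) (L : seq (gedge V)).
Hypothesis M : minimal U L.
Implicit Types (S R Q : {set V}) (u v x y z : V) (h : hedge V) (f : V -> Z5) (l : lobe V).

Definition ks v : seq nat := map (@hk V) (hed L v).
Definition type222 v := perm_eq (ks v) [:: 2; 2; 2]%N.
Definition type322 v := perm_eq (ks v) [:: 3; 2; 2]%N.
Definition type2211 v := perm_eq (ks v) [:: 2; 2; 1; 1]%N.
Definition type2221 v := perm_eq (ks v) [:: 2; 2; 2; 1]%N.
Definition type2222 v := perm_eq (ks v) [:: 2; 2; 2; 2]%N.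
(** These vertices can pay 2 along every half-edge of weight 2, by [full_giver_dv]. *)
Definition full_giver v := ((3%N \in ks v) && ~~ type322 v) || (4 < size (ks v))%N.

Lemma hed_type v h t : h \in hed L v -> perm_eq (ks v) (hk h :: t) ->
  exists2 s, perm_eq (hed L v) (h :: s) & map (@hk V) s = t.
Proof.
move=> hh pk; have px := perm_to_rem hh.
have [s' p1 p2] : exists2 s', perm_eq (rem h (hed L v)) s' & map (@hk V) s' = t.
  apply: perm_map_lift; rewrite -(perm_cons (hk h)); apply: perm_trans pk.
  by rewrite -map_cons perm_sym perm_map.
by exists s' => //; rewrite (permPl px) perm_cons.
Qed.

Lemma flip_hed v h : h \in hed L v -> exists h', [/\ h' \in hed L (nbr h), nbr h' = v & hk h' = hk h].
Proof. by move=> hh; exists (v, flip h.2); split=> //; exact: hed_sym. Qed.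

Lemma type222_hk v h : h \in hed L v -> type222 (nbr h) -> hk h = 2%N.
Proof.
move=> /flip_hed[h' [hh _ <-]] pB; have : hk h' \in ks (nbr h) by apply: map_f.
by rewrite (perm_mem pB) !inE => /or3P[] /eqP.
Qed.

Lemma lobe_of v h : h \in hed L v -> hk h = 2%N -> type222 (nbr h) || type322 (nbr h) ->
  exists l, [/\ l.1.1 = h, is_lobe L v l & type222 (nbr h) -> lk l = 2%N].
Proof.
move=> hh k2; have [h' [hh' n' k']] := flip_hed hh; rewrite k2 in k'.
have [pB _|nB /= p1] := boolP (type222 (nbr h)).
  have [|s ps] := @hed_type _ h' [:: 2; 2]%N hh'; first by rewrite k'.
  case: s ps => [|a [|b [|]]] //= ps [ka kb]; exists (h, a, b); split=> //.
  by split=> //; split=> //; exists h'; split; rewrite // /lk /la /= ka.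
have [|s ps] := @hed_type _ h' [:: 3; 2]%N hh'.
  by rewrite k' (permPl p1) (perm_catCA [:: 3%N] [:: 2%N] [:: 2%N]).
case: s ps => [|a [|b [|]]] //= ps [ka kb]; exists (h, a, b); split=> //.
by split=> //; split=> //; exists h'; split; rewrite // /lk /la /= ka.
Qed.

Lemma type222_hed v h : type222 v -> h \in hed L v ->
  exists h1 h2, [/\ perm_eq (hed L v) [:: h; h1; h2], hk h = 2%N, hk h1 = 2%N & hk h2 = 2%N].
Proof.
move=> pB hh; have k2 : hk h = 2%N.
  have : hk h \in ks v by apply: map_f.
  by rewrite (perm_mem pB) !inE => /or3P[] /eqP.
have [|s ps] := @hed_type v h [:: 2; 2]%N hh; first by rewrite k2.
by case: s ps => [|a [|b [|]]] //= ps [ka kb]; exists a, b.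
Qed.

Lemma type222_pair v h1 h2 h3 : v \in U -> type222 v -> perm_eq (hed L v) [:: h1; h2; h3] ->
  type222 (nbr h1) || type322 (nbr h1) -> type222 (nbr h2) || type322 (nbr h2) -> False.
Proof.
move=> vU pB ps t1 t2; have k h : h \in [:: h1; h2; h3] -> h \in hed L v /\ hk h = 2%N.
  by rewrite -(perm_mem ps) => hh; have [_ [_ [_ k2 _ _]]] := type222_hed pB hh.
have [hh1 k1] : h1 \in hed L v /\ hk h1 = 2%N by apply: k; rewrite !inE eqxx.
have [hh2 k2] : h2 \in hed L v /\ hk h2 = 2%N by apply: k; rewrite !inE eqxx orbT.
have [hh3 k3] : h3 \in hed L v /\ hk h3 = 2%N by apply: k; rewrite !inE eqxx !orbT.
have [l1 [e1 L1 _]] := lobe_of hh1 k1 t1; have [l2 [e2 L2 _]] := lobe_of hh2 k2 t2.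
by apply: (two_lobes M (l1 := l1) (l2 := l2) vU _ L1 L2 k3); rewrite e1 e2.
Qed.

Lemma has3_mem u B : has3 L [set u] B -> 3%N \in ks u.
Proof. by case/has3_half_edge => h [hh _ <-]; apply: map_f. Qed.

(** A weight 3 edge makes [nbr hp] a full giver unless its type is (3,2,2). In that case [nbr hq]
    has a weight 3 edge as well, and by [type222_pair] it is not of type (3,2,2) too. *)
Lemma beside2211_full v hw hp hq hv hc ha hb : v \in U -> type222 v -> perm_eq (hed L v) [:: hw; hp; hq] ->
  perm_eq (hed L (nbr hw)) [:: hv; hc; ha; hb] -> nbr hv = v ->
  hk hv = 2%N -> hk hc = 2%N -> hk ha = 1%N -> hk hb = 1%N ->
  has3 L [set nbr hp] [set nbr hc] -> full_giver (nbr hp) || full_giver (nbr hq).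
Proof.
move=> vU pB psv psw nv kv2 kc ka kb h3; have m3 := has3_mem h3.
rewrite /full_giver m3 /=; have [p1|] := boolP (type322 (nbr hp)); last by [].
have hhp : hp \in hed L v by rewrite (perm_mem psv) !inE eqxx orbT.
have k h : h \in [:: hw; hp; hq] -> h \in hed L v /\ hk h = 2%N.
  by rewrite -(perm_mem psv) => hh; have [_ [_ [_ k2 _ _]]] := type222_hed pB hh.
have [hhw kw] : hw \in hed L v /\ hk hw = 2%N by apply: k; rewrite !inE eqxx.
have [_ kp] : hp \in hed L v /\ hk hp = 2%N by apply: k; rewrite !inE eqxx orbT.
have [hhq kq] : hq \in hed L v /\ hk hq = 2%N by apply: k; rewrite !inE eqxx !orbT.
have wU : nbr hw \in U by have [] := hedU M hhw.
have [gc [hgc /set1P ngc kgc]] := has3_half_edge h3.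
have [gv [hgv ngv kgv]] := flip_hed hhp; rewrite kp in kgv.
have [gd psp kgd] : exists2 gd, perm_eq (hed L (nbr hp)) [:: gc; gv; gd] & hk gd = 2%N.
  have [|s ps ms] := @hed_type _ gc [:: 2; 2]%N hgc; first by rewrite kgc.
  have : gv \in s.
    by move: hgv; rewrite (perm_mem ps) inE => /orP[/eqP E|//]; rewrite E kgc in kgv.
  case: s ps ms => [|a [|b [|]]] //= ps [ea eb]; rewrite !inE => /orP[] /eqP E.
    by exists b; rewrite ?E.
  by exists a => //; rewrite (permPl ps) E perm_cons (perm_catC [:: a] [:: b]).
have [z hz] : exists z, has3 L [set nbr hq] [set z].
  have [aq|/negbNE/eqP aq] := boolP (nbr ha != nbr hq).
    exact: (beside2211_heavy_at_q M vU psv kw kp kq wU psw kv2 kc ka kb erefl nv psp kgc kgv kgd ngc ngv).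
  have psw' : perm_eq (hed L (nbr hw)) [:: hv; hc; hb; ha].
    by rewrite (permPl psw) !perm_cons (perm_catC [:: ha] [:: hb]).
  apply: (beside2211_heavy_at_q M vU psv kw kp kq wU psw' kv2 kc kb ka erefl nv psp kgc kgv kgd ngc ngv).
  (* If both light half-edges of [nbr hw] ended at [nbr hq], then [v], [nbr hw] and [nbr hq] would
     have potential at most 15 - 3 - 3 - 4 = 5. *)
  apply/eqP => bq; have [[_ pU qU] [wv pv qv] [wp wq pq]] := nbrs222 M vU psv kw kp kq.
  have wqn : nbr hw \notin [set nbr hq] by rewrite inE.
  have vwq : v \notin nbr hw |: [set nbr hq] by rewrite !inE negb_or eq_sym wv eq_sym qv.
  have := @pot_ge6_out V U L M (v |: (nbr hw |: [set nbr hq])) (nbr hp); rewrite !subUset !sub1set vU wU qU pU.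
  rewrite !inE !negb_or pv (eq_sym _ (nbr hw)) wp pq cardsU1 vwq cardsU1 wqn cards1 => /(_ isT isT isT isT).
  rewrite (P_add M vwq) (P_add M wqn) (P1 M) (dg222 psv) // (dg2211 psw) // !inE aq bq !eqxx orbT.
  by clear; lia.
rewrite (has3_mem hz) /=; have [q1|_] := boolP (type322 (nbr hq)); last by rewrite orbT.
exfalso.
have ps' : perm_eq (hed L v) [:: hp; hq; hw].
  by rewrite (permPl psv) -[X in perm_eq X _]/([:: hw] ++ [:: hp; hq]) perm_catC.
by apply: (type222_pair vU pB ps'); rewrite ?p1 ?q1 orbT.
Qed.

Lemma type222_type2211 v h : v \in U -> type222 v -> h \in hed L v -> type2211 (nbr h) ->
  exists2 h', h' \in hed L v & full_giver (nbr h').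
Proof.
move=> vU pB hh p2; have [hp [hq [psv kw kp kq]]] := type222_hed pB hh.
have [hv [hhv nv kv2]] := flip_hed hh; rewrite kw in kv2.
have wU : nbr h \in U by have [] := hedU M hh.
have [|s psw] := @hed_type _ hv [:: 2; 1; 1]%N hhv; first by rewrite kv2.
case: s psw => [|hc [|ha [|hb [|]]]] //= psw [kc ka kb].
have psv' : perm_eq (hed L v) [:: h; hq; hp] by rewrite (permPl psv) perm_cons (perm_catC [:: hp] [:: hq]).
have [hhp hhq] : hp \in hed L v /\ hq \in hed L v by rewrite !(perm_mem psv) !inE !eqxx !orbT.
case/orP: (beside2211_heavy_to_c M vU psv kw kp kq wU psw kv2 kc ka kb erefl nv) => h3.
  by case/orP: (beside2211_full vU pB psv psw nv kv2 kc ka kb h3); [exists hp|exists hq].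
by case/orP: (beside2211_full vU pB psv' psw nv kv2 kc ka kb h3); [exists hq|exists hp].
Qed.

End Minimal.

Section Minimal.
Variables (V : finType) (U : {set V}) (L : seq (gedge V)).
Hypothesis M : minimal U L.
Implicit Types (S R Q : {set V}) (u v x y z : V) (h : hedge V) (f : V -> Z5) (l : lobe V).

Let LU : all (inside U) L := min_inside M.
Local Notation dv := (dv L).
Local Notation ks := (ks L).
Local Notation type222 := (type222 L).
Local Notation type322 := (type322 L).
Local Notation type2211 := (type2211 L).
Local Notation type2221 := (type2221 L).
Local Notation type2222 := (type2222 L).
Local Notation full_giver := (full_giver L).

(* Charge 2 (dv v - 10), of negative total since P U > 0. Only type (2,2,2) is in
   debt, by 2; full givers send 2 and half givers 1 to each neighbour of that type. *)
Definition half_giver v := type2221 v || type2222 v.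
Definition gives v := if full_giver v then 2%N else if half_giver v then 1%N else 0%N.

Lemma ks_dv v s : perm_eq (ks v) s -> dv v = (\sum_(k <- s) k.+1)%N.
Proof. by move=> p; rewrite -(perm_big _ p) /= /ks big_map. Qed.

Lemma ks_range v k : k \in ks v -> (1 <= k <= 3)%N.
Proof. by case/mapP => h /(hedU M)[_ _ _ hk3] ->. Qed.

Lemma ks_size v : v \in U -> (3 <= size (ks v))%N.
Proof. by move=> vU; rewrite size_map; exact: (deg3 M vU). Qed.

(** Cost 9 means three half-edges, hence type (2,2,2) by [dv9_deg3], or four, hence type (2,1,1,1),
    excluded by [no2111]. *)
Lemma dv10 v : v \in U -> ~~ type222 v -> (10 <= dv v)%N.
Proof.
move=> vU nB; rewrite ltn_neqAle (dv9 M vU) andbT; apply/eqP => d9.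
have s3 := deg3 M vU; have kd := dv_kv L v; have k5 := kv5 M vU.
have [s ps _] := perm_sorted L v; have sz := perm_size ps.
have [E|E] : (size (hed L v) = 3 \/ size (hed L v) = 4)%N by move: s3 kd k5; rewrite -d9; clear; lia.
  have s3' : size s = 3%N by rewrite -sz.
  have := dv9_deg3 M vU (esym d9) s3' ps; case: s ps s3' {sz} => [|a [|b [|c [|]]]] //= ps _.
  rewrite andbT => /and3P[/eqP ka /eqP kb /eqP kc]; move/negP: nB; apply.
  by rewrite /type222 /ks; apply: (perm_trans (perm_map (@hk V) ps)); rewrite /= ka kb kc.
have {s ps sz} [s ps ss] := perm_sorted L v; have sz : size s = 4%N by rewrite -(perm_size ps).
have hs h : h \in s -> (1 <= hk h <= 3)%N by rewrite -(perm_mem ps) => /(hedU M)[].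
have [kE _ _] := hed_subseq ps; move: kd; rewrite -d9 E kE.
case: s ps ss hs sz {kE} => [|a [|b [|c [|d [|]]]]] //= ps; rewrite andbT => /and3P[ab bc cd] hs _.
have ha : (1 <= hk a <= 3)%N by apply: hs; rewrite !inE eqxx ?orbT.
have hb : (1 <= hk b <= 3)%N by apply: hs; rewrite !inE eqxx ?orbT.
have hc : (1 <= hk c <= 3)%N by apply: hs; rewrite !inE eqxx ?orbT.
have hd : (1 <= hk d <= 3)%N by apply: hs; rewrite !inE eqxx ?orbT.
rewrite !big_cons big_nil => kd; apply: (no2111 M vU ps); move: ab bc cd ha hb hc hd kd; clear; lia.
Qed.

Lemma sorted_ks v : v \in U -> exists s : seq nat, [/\ perm_eq (ks v) s, sorted geq s, all (fun k => 1 <= k <= 3)%N s & (3 <= size s)%N].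
Proof.
move=> vU; exists (sort geq (ks v)); split.
- by rewrite perm_sym perm_sort.
- by apply: sort_sorted => a b; exact: leq_total.
- by apply/allP => k; rewrite mem_sort; exact: ks_range.
- by rewrite size_sort; exact: ks_size.
Qed.

Lemma classify v : v \in U -> 2%N \in ks v -> ~~ full_giver v ->
  [|| type222 v, type322 v, type2211 v, type2221 v | type2222 v].
Proof.
move=> vU m2; rewrite /full_giver negb_or -leqNgt => /andP[nf s4].
have [B|/(dv10 vU)] := boolP (type222 v); first by [].
have [P1|nP1] := boolP (type322 v); first by [].
rewrite nP1 andbT in nf; have [s [p ss rs s3]] := sorted_ks vU.
rewrite (ks_dv p) /type2211 /type2221 /type2222 !(permPl p).
rewrite (perm_mem p) in m2; rewrite (perm_mem p) in nf; rewrite (perm_size p) in s4.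
move: m2 nf; case: s s3 s4 ss rs {p} => [|a [|b [|c [|d [|]]]]] //= _ _.
  rewrite !andbT !inE !big_cons big_nil => /andP[ab bc] /and3P[ha hb hc] h2 h3 h10; exfalso.
  by move: ab bc ha hb hc h3 h10; clear; lia.
rewrite !andbT !inE !big_cons big_nil => /and3P[ab bc cd] /and4P[ha hb hc hd] h2 h3 h10.
have : [\/ [/\ a = 2, b = 2, c = 1 & d = 1], [/\ a = 2, b = 2, c = 2 & d = 1] | [/\ a = 2, b = 2, c = 2 & d = 2]]%N.
  have E : (a = 2 /\ b = 2)%N by move: ab bc cd ha hb hc hd h2 h3 h10; clear; lia.
  have E' : (c = 1 /\ d = 1 \/ c = 2 /\ d = 1 \/ c = 2 /\ d = 2)%N by move: cd E bc hc hd; clear; lia.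
  by case: E => -> ->; case: E' => [[-> ->]|[[-> ->]|[-> ->]]]; [apply: Or31|apply: Or32|apply: Or33].
by case=> -[-> -> -> ->].
Qed.

(** Every half-edge costs at least 2, and one more for weight 2; five half-edges, or four including
    one of weight 3, already give 10 before this surplus. Three half-edges are checked by cases. *)
Lemma full_giver_dv u : u \in U -> ~~ type222 u -> full_giver u -> (10 + count (pred1 2%N) (ks u) <= dv u)%N.
Proof.
move=> uU /(dv10 uU); have [s [p ss rs s3]] := sorted_ks uU.
rewrite (ks_dv p) /full_giver /type322 !(permPl p) (perm_mem p) (perm_size p) (permP p) => d10.
have large t : all (fun k => 1 <= k <= 3)%N t -> (2 * size t + count (pred1 2%N) t <= \sum_(k <- t) k.+1)%N.
  elim: t => [|k t IH]; first by rewrite big_nil.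
  by case/andP => hk /IH; rewrite big_cons /=; move: hk; case: (eqVneq k 2%N) => [->|]; clear; lia.
have lg := large _ rs; have [s5 _|s4] := ltnP 4 (size s); first by apply: leq_trans lg; rewrite leq_add2r; exact: (leq_mul (leqnn 2) s5).
rewrite orbF; case: s s3 s4 ss rs d10 {lg p} => [|a [|b [|c [|d [|]]]]] //= _ _.
  rewrite !andbT !inE !big_cons big_nil => /andP[ab bc] /and3P[ha hb hc] d10 /andP[h3].
  have Ea : a = 3%N by move: h3 ab bc ha; clear; lia.
  have : (b = 1 \/ b = 2 \/ b = 3)%N by move: hb; clear; lia.
  have : (c = 1 \/ c = 2 \/ c = 3)%N by move: hc; clear; lia.
  by case=> [Ec|[Ec|Ec]]; case=> [Eb|[Eb|Eb]]; move: bc d10; rewrite Ea Ec Eb.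
rewrite !andbT !inE !big_cons big_nil => /and3P[ab bc cd] /and4P[ha hb hc hd] d10 /andP[h3 _].
have -> : a = 3%N by move: h3 ab bc cd ha; clear; lia.
have := large [:: b; c; d]; rewrite /= hb hc hd !big_cons big_nil => /(_ isT); clear; lia.
Qed.

(** Without a full giver nearby, type (2,2,1,1) is excluded as a neighbour, so each neighbour is a
    half giver or of type (2,2,2) or (3,2,2). At most one is of the last two types, which leaves two
    half givers. *)
Lemma receives v : v \in U -> type222 v -> (2 <= \sum_(h <- hed L v) gives (nbr h))%N.
Proof.
move=> vU pB; have [h0 hh0] : exists h, h \in hed L v.
  have := deg3 M vU; case: (hed L v) => [|h t] // _; exists h; exact: mem_head.
have one h : h \in hed L v -> full_giver (nbr h) -> (2 <= \sum_(h <- hed L v) gives (nbr h))%N.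
  by move=> hh fu; rewrite (big_rem h) //= {1}/gives fu; clear; lia.
have [h1 [h2 [ps k0 k1 k2]]] := type222_hed pB hh0.
have [hh1 hh2] : h1 \in hed L v /\ h2 \in hed L v by rewrite !(perm_mem ps) !inE !eqxx !orbT.
have [f0|n0] := boolP (full_giver (nbr h0)); first exact: one f0.
have [f1|n1] := boolP (full_giver (nbr h1)); first exact: one f1.
have [f2|n2] := boolP (full_giver (nbr h2)); first exact: one f2.
have nofull h : h \in hed L v -> ~~ full_giver (nbr h).
  by rewrite (perm_mem ps) !inE => /or3P[] /eqP ->.
have cl h : h \in hed L v -> (type222 (nbr h) || type322 (nbr h)) || half_giver (nbr h).
  move=> hh; have [h' [hh' n' k']] := flip_hed hh; have [_ nU _ _] := hedU M hh.
  have k2h : hk h = 2%N by have [? [? []]] := type222_hed pB hh.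
  have m2 : 2%N \in ks (nbr h) by apply/mapP; exists h'; rewrite // k' k2h.
  have := classify nU m2 (nofull h hh); rewrite /half_giver => /or4P[->|->|p2|->] //; rewrite ?orbT //.
  by have [h3 hh3] := type222_type2211 M vU pB hh p2; rewrite (negbTE (nofull _ hh3)).
have ps1 : perm_eq (hed L v) [:: h1; h2; h0].
  by rewrite (permPl ps) -[X in perm_eq X _]/([:: h0] ++ [:: h1; h2]) perm_catC.
have ps2 : perm_eq (hed L v) [:: h0; h2; h1] by rewrite (permPl ps) perm_cons (perm_catC [:: h1] [:: h2]).
have b01 := type222_pair M vU pB ps; have b12 := type222_pair M vU pB ps1; have b02 := type222_pair M vU pB ps2.
rewrite (perm_big _ ps) !big_cons big_nil /gives (negbTE n0) (negbTE n1) (negbTE n2).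
move: (cl h0 hh0) (cl h1 hh1) (cl h2 hh2).
case: (half_giver (nbr h0)); case: (half_giver (nbr h1)); case: (half_giver (nbr h2)); rewrite ?orbF //.
- by move=> _ t1 t2; case: (b12 t1 t2).
- by move=> t0 _ t2; case: (b02 t0 t2).
- by move=> t0 t1 _; case: (b01 t0 t1).
- by move=> t0 t1 _; case: (b01 t0 t1).
Qed.

Lemma count_type222 u : (count (fun h => type222 (nbr h)) (hed L u) <= count (pred1 2%N) (ks u))%N.
Proof.
rewrite /ks count_map; have : {subset hed L u <= hed L u} by [].
elim: {1 3 4}(hed L u) => //= h t IH sub; apply: leq_add; last first.
  by apply: IH => x xt; apply: sub; rewrite inE xt orbT.
by case: (boolP (type222 (nbr h))) => // hB; rewrite (type222_hk (sub _ (mem_head _ _)) hB).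
Qed.

Lemma count_type2221 u : u \in U -> type2221 u -> (count (fun h => type222 (nbr h)) (hed L u) <= 2)%N.
Proof.
move=> uU p3; have [s ps ms] := perm_map_lift p3; rewrite (permP ps).
have hs h : h \in s -> h \in hed L u by rewrite (perm_mem ps).
case: s ps ms hs => [|h1 [|h2 [|h3 [|he [|]]]]] //= ps [k1 k2 k3 ke] hs.
have hh1 : h1 \in hed L u by apply: hs; rewrite !inE eqxx ?orbT.
have hh2 : h2 \in hed L u by apply: hs; rewrite !inE eqxx ?orbT.
have hh3 : h3 \in hed L u by apply: hs; rewrite !inE eqxx ?orbT.
have hhe : he \in hed L u by apply: hs; rewrite !inE eqxx ?orbT.
have [/(type222_hk hhe)|_] := boolP (type222 (nbr he)); first by rewrite ke.
case: (boolP (type222 (nbr h1))) => [B1|_]; case: (boolP (type222 (nbr h2))) => [B2|_];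
  case: (boolP (type222 (nbr h3))) => [B3|_] //; exfalso.
have [l1 [e1 L1 q1]] : exists l, [/\ l.1.1 = h1, is_lobe L u l & type222 (nbr h1) -> lk l = 2%N].
  by apply: lobe_of => //; rewrite B1.
have [l2 [e2 L2 q2]] : exists l, [/\ l.1.1 = h2, is_lobe L u l & type222 (nbr h2) -> lk l = 2%N].
  by apply: lobe_of => //; rewrite B2.
have [l3 [e3 L3 q3]] : exists l, [/\ l.1.1 = h3, is_lobe L u l & type222 (nbr h3) -> lk l = 2%N].
  by apply: lobe_of => //; rewrite B3.
by apply: (three_lobes M (l1 := l1) (l2 := l2) (l3 := l3) uU _ L1 L2 L3 ke (q1 B1) (q2 B2) (q3 B3)); rewrite e1 e2 e3.
Qed.

(** Type (2,2,2) has 18 and receives 2. A full giver pays 2 for at most as many neighbours as it has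
    half-edges of weight 2. Type (2,2,2,1) has 22 and at most two creditors, type (2,2,2,2) has 24
    and at most four. *)
Lemma spends u : u \in U ->
  (20 + \sum_(h <- hed L u) type222 (nbr h) * gives u <=
   2 * dv u + \sum_(h <- hed L u) type222 u * gives (nbr h))%N.
Proof.
move=> uU; rewrite -big_distrl -big_distrr /=.
have -> : (\sum_(h <- hed L u) type222 (nbr h) = count (fun h => type222 (nbr h)) (hed L u))%N.
  by rewrite -sum1_count [RHS]big_mkcond /=; apply: eq_bigr => h _; case: (type222 _).
have [B|nB] := boolP (type222 u).
  have d9 : dv u = 9%N by rewrite (ks_dv B) !big_cons big_nil.
  have -> : gives u = 0%N.
    rewrite /gives /half_giver /full_giver /type322 /type2221 /type2222 (perm_mem B) (perm_size B).
    by rewrite !(permPl B).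
  by rewrite d9 mul1n; have := receives uU B; clear; lia.
rewrite mul0n addn0 /gives; have d10 := dv10 uU nB; have cB := count_type222 u.
have [fu|_] := boolP (full_giver u); first by have := full_giver_dv uU nB fu; move: cB; clear; lia.
have [|_] := boolP (half_giver u); last by rewrite muln0; move: d10; clear; lia.
case/orP => p; first by rewrite (ks_dv p) !big_cons big_nil; have := count_type2221 uU p; clear; lia.
rewrite (ks_dv p) !big_cons big_nil; move: cB; rewrite (permP p) /=; clear; lia.
Qed.

Lemma handshake2 (F : V -> V -> nat) :
  (\sum_(v in U) \sum_(h <- hed L v) F v (nbr h) = \sum_(v in U) \sum_(h <- hed L v) F (nbr h) v)%N.
Proof.
have E (G : V -> V -> nat) : (\sum_(v in U) \sum_(h <- hed L v) G v (nbr h) =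
    \sum_(e <- L) (G (tgt e) (src e) + G (src e) (tgt e)))%N.
  have E1 v : (\sum_(h <- hed L v) G v (nbr h) =
      \sum_(e <- L) ((tgt e == v) * G v (src e) + (src e == v) * G v (tgt e)))%N.
    rewrite /hed big_cat /= !big_map !big_filter big_split /=; congr (_ + _)%N.
      by rewrite big_mkcond; apply: eq_bigr => e _; case: eqP; rewrite ?mul1n ?mul0n.
    by rewrite big_mkcond; apply: eq_bigr => e _; case: eqP; rewrite ?mul1n ?mul0n.
  rewrite (eq_bigr _ (fun v _ => E1 v)) exchange_big /=.
  apply: eq_big_seq => e /(allP LU) /andP[sU tU].
  rewrite big_split /= (bigD1 (tgt e)) //= eqxx (bigD1 (src e) (P := fun v => v \in U)) //= eqxx.
  rewrite !big1 => [|v /andP[_ /negbTE]|v /andP[_ /negbTE]]; first by clear; lia.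
    by rewrite eq_sym => ->.
  by rewrite eq_sym => ->.
by rewrite E (E (fun x y => F y x)); apply: eq_bigr => e _; rewrite addnC.
Qed.

Lemma no_minimal : False.
Proof.
have := sum_dv_lt M.
have : (\sum_(u in U) (20 + \sum_(h <- hed L u) type222 (nbr h) * gives u) <=
    \sum_(u in U) (2 * dv u + \sum_(h <- hed L u) type222 u * gives (nbr h)))%N.
  by apply: leq_sum => u uU; exact: spends.
rewrite big_split [leqRHS]big_split /= (handshake2 (fun u v => type222 u * gives v)%N) sum_nat_const.
have -> : (\sum_(i in U) 2 * dv i = 2 * \sum_(i in U) dv i)%N by rewrite big_distrr.
move: (\sum_(i in U) \sum_(h <- _) _)%N (\sum_(i in U) dv i)%N => a b; clear; lia.
Qed.

End Minimal.

Lemma sparse_inside (V : finType) (S : {set V}) (L : seq (gedge V)) :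
  sparse S L -> sparse S (filter (inside S) L).
Proof.
move=> [wL nl hp hk ht]; have crS x y e : x \in S -> y \in S -> cross [set x] [set y] e -> inside S e.
  by move=> xS yS /cross1[[E1 E2]|[E1 E2]]; rewrite /inside -E1 -E2 xS yS.
split.
- by rewrite /weighted all_filter; apply: sub_all wL => e h; apply/implyP.
- by rewrite all_filter; apply: sub_all nl => e h; apply/implyP.
- move=> R RS R0; rewrite /pot /cost big_filter_cond (eq_bigl (inside R)); first exact: hp.
  by move=> e; rewrite andb_idl // => /andP[sR tR]; rewrite /inside !(subsetP RS).
- move=> x y xS yS xy; rewrite /kap big_filter_cond (eq_bigl (cross [set x] [set y])); first exact: hk.
  by move=> e; rewrite andb_idl //; exact: crS.
move=> x y z xS yS zS xy yz xz; apply: contra (ht x y z xS yS zS xy yz xz).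
have h3 a b : has3 (filter (inside S) L) [set a] [set b] -> has3 L [set a] [set b].
  by case/hasP => e; rewrite mem_filter => /andP[_ eL] c; apply/hasP; exists e.
by case/and3P => /h3 -> /h3 -> /h3 ->.
Qed.

(** Edges leaving [S] are dropped first, as [minimal] wants all edges inside; finite functions make
    colourability decidable. *)
Theorem sparse_colorable (V : finType) (S : {set V}) (L : seq (gedge V)) : sparse S L -> colorable S L.
Proof.
move: {2}(#|S|)%N (leqnn #|S|) => n; elim: n S L => [|n IH] S L.
  rewrite leqn0 cards_eq0 => /eqP -> _; exists (fun=> 0); apply/allP => e _.
  by rewrite /inside inE.
move=> cS /sparse_inside spS; set L' := filter _ L in spS.
case: (pickP (fun f : {ffun V -> Z5} => pcol f S L')) => [f /allP pf|no].
  exists f; apply/allP => e eL; apply/implyP => ie; have := pf e; rewrite mem_filter ie eL => /(_ isT).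
  exact.
exfalso; apply: (@no_minimal V S L'); split=> //.
- by move=> S' L'' c; apply: IH; rewrite -ltnS; apply: leq_trans c _.
- exact: filter_all.
- case=> f pf; have := no [ffun x => f x]; rewrite (_ : pcol _ _ _ = true) //.
  by rewrite -{}pf; apply: eq_all => e; rewrite /sat !ffunE.
Qed.

(** * From gain graphs to homomorphisms to the 5-cycle *)

(** Adjacency in the 5-cycle, scaled so that the non-neighbours 4, 0, 1 of 0 are consecutive. *)
Definition steps (d : Z5) : bool := (2 <= d <= 3)%N.

Lemma stepsN d : steps (- d) = steps d.
Proof. by elim/forall_Z5: d. Qed.

Lemma steps_sat d : steps d = (3 <= (d - 4%:R)%R)%N.
Proof. by elim/forall_Z5: d. Qed.

Lemma steps2 d e : steps d -> steps e -> ~~ steps (d + e).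
Proof. by elim/forall_Z5: d => //; elim/forall_Z5: e. Qed.

Lemma steps3 d e g : steps d -> steps e -> steps g -> d + e + g != 0.
Proof. by elim/forall_Z5: d => //; elim/forall_Z5: e => //; elim/forall_Z5: g. Qed.

Lemma steps2_inv d : ~~ steps d -> exists2 e, steps e & steps (d - e).
Proof. by elim/forall_Z5: d => // _; [exists 2%:R | exists 3%:R | exists 2%:R]. Qed.

Lemma steps3_inv d : d != 0 -> exists e g, [/\ steps e, steps g & steps (d - e - g)].
Proof. by elim/forall_Z5: d => // _; [exists 2%:R, 2%:R|exists 2%:R,3%:R|exists 2%:R,3%:R|exists 3%:R,3%:R]. Qed.

(** Lets a single colouring of [G] realise, by negation and translation, every admissible pair of
    colours on an edge. *)
Lemma steps_eqN d e : steps d -> steps e -> e = d \/ e = - d.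
Proof. by elim/forall_Z5: d => //; elim/forall_Z5: e => // _ _; [left|right|right|left]; apply/val_inj. Qed.

Section GraphColoring.
Variable G : sgraph.
Implicit Types (u v x y : G) (S R : {set G}) (f : G -> Z5).

Definition edge_set : {set G * G} := [set p : G * G | edge p.1 p.2 && (enum_rank p.1 < enum_rank p.2)%N].
Definition gain_edges : seq (gedge G) := [seq (p.1, p.2, (4%:R, 3%N)) | p <- enum edge_set].
Definition edges_in S : nat := #|[set p in edge_set | (p.1 \in S) && (p.2 \in S)]|.
Notation L := gain_edges.
Notation P := (pot L).

Definition good f S := forall u v, u \in S -> v \in S -> edge u v -> steps (f v - f u).

Lemma gain_edgeP e : e \in L -> [/\ edge (src e) (tgt e), gain e = 4%:R & wt e = 3%N].
Proof. by case/mapP => p; rewrite mem_enum inE => /andP[pe _] ->. Qed.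

Lemma gain_edge_ex u v : edge u v -> exists2 e, e \in L & cross [set u] [set v] e.
Proof.
move=> uv; have uv' : enum_rank u != enum_rank v.
  by apply: contraTneq uv => /enum_rank_inj ->; rewrite edge_irrefl.
case/orP: (leq_total (enum_rank u) (enum_rank v)); rewrite leq_eqVlt.
  case/orP => [/eqP/val_inj E|lt]; first by rewrite E eqxx in uv'.
  exists (u, v, (4%:R, 3%N)); last by rewrite /cross !inE !eqxx.
  by apply/mapP; exists (u, v); rewrite // mem_enum inE uv.
case/orP => [/eqP/val_inj E|lt]; first by rewrite E eqxx in uv'.
exists (v, u, (4%:R, 3%N)); last by rewrite /cross !inE !eqxx orbT.
by apply/mapP; exists (v, u); rewrite // mem_enum inE edge_sym uv.
Qed.

Lemma pcol_good f S : pcol f S L <-> good f S.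
Proof.
split=> [/allP pf u v uS vS /gain_edge_ex[e eL c]|gf].
  have [_ ge we] := gain_edgeP eL; have := pf e eL; rewrite /sat ge we /inside.
  case/cross1: c uS vS => -[-> ->] -> ->; rewrite -steps_sat //=.
  by rewrite -stepsN opprB.
apply/allP => e eL; have [ee ge we] := gain_edgeP eL; apply/implyP => /andP[sS tS].
by rewrite /sat ge we -steps_sat; apply: gf.
Qed.

Lemma cost_edges S : cost S L = (4 * edges_in S)%N.
Proof.
rewrite /cost /edges_in -sum1_card big_distrr /= big_map big_enum_cond /=.
rewrite [RHS](eq_bigl (fun p => (p \in edge_set) && ((p.1 \in S) && (p.2 \in S)))); first by apply: eq_bigr.
by move=> p; rewrite inE.
Qed.

Hypothesis sparse_G : forall S, S != set0 -> (4 * edges_in S + minn 10 (#|S| + 4) <= 5 * #|S|)%N.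

Lemma P_min S : S != set0 -> (minn 10 (#|S| + 4))%:Z <= P S.
Proof. by move/sparse_G; rewrite /pot cost_edges; lia. Qed.

Lemma weighted_G : weighted L.
Proof. by apply/allP => e /gain_edgeP[_ _ ->]. Qed.

Lemma loopless_G v : all (fun e => ~~ ((src e == v) && (tgt e == v))) L.
Proof.
apply/allP => e /gain_edgeP[ee _ _]; apply: contraTN ee => /andP[/eqP -> /eqP ->].
by rewrite edge_irrefl.
Qed.

Lemma P_addG y R : y \notin R -> P (y |: R) = P R + 5 - (cst L [set y] R)%:Z.
Proof. by move=> yR; apply: pot_addv => //; apply: loopless_G. Qed.

Lemma P1G y : P [set y] = 5.
Proof.
rewrite -[[set y]]setU0 P_addG ?inE // /cst big1 => [|e]; last by rewrite /cross !inE !andbF.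
by rewrite /pot cards0 /cost big1 => [|e] //; rewrite /inside !inE.
Qed.

Lemma cst_edge y z R : z \in R -> edge y z -> (4 <= cst L [set y] R)%N.
Proof.
move=> zR /gain_edge_ex[e eL c]; rewrite /cst (big_rem e) //=.
have -> : cross [set y] R e.
  by case/cross1: c zR => -[-> ->] zR; rewrite /cross !inE eqxx zR ?orbT.
by have [_ _ ->] := gain_edgeP eL; clear; lia.
Qed.

Lemma P_adj y z R : y \notin R -> z \in R -> edge y z -> P (y |: R) <= P R + 1.
Proof. by move=> yR zR yz; rewrite P_addG //; have := cst_edge zR yz; lia. Qed.

Lemma has3_edge y R : has3 L [set y] R -> exists2 z, z \in R & edge y z.
Proof.
case/hasP => e eL /andP[]; have [ee _ _] := gain_edgeP eL.
rewrite /cross !inE => /orP[/andP[/eqP <- tR]|/andP[sR /eqP <-]] _; first by exists (tgt e).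
by exists (src e) => //; rewrite edge_sym.
Qed.

Lemma has3_edge1 y z : has3 L [set y] [set z] -> edge y z.
Proof. by case/has3_edge => t /set1P ->. Qed.

Lemma sparse_all S : sparse S L.
Proof.
have wL := weighted_G; split=> //.
- apply/allP => e eL; apply/implyP => _; have [ee _ _] := gain_edgeP eL.
  by apply: contraTneq ee => ->; rewrite edge_irrefl.
- move=> R _ R0; have R1 : (0 < #|R|)%N by rewrite card_gt0.
  by apply: le_trans (P_min R0); move: R1; clear; lia.
- move=> x y _ _ xy; have := kap_cst [set x] [set y] wL.
  have xy1 : x \notin [set y] by rewrite inE.
  have := @P_min (x |: [set y]); rewrite P_addG // P1G cardsU1 xy1 cards1.
  have -> : x |: [set y] != set0 by apply/set0Pn; exists x; rewrite !inE eqxx.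
  by move=> /(_ isT); lia.
move=> x y z _ _ _ xy yz xz; apply/negP => /and3P[h1 h2 h3].
have := pot_three3 (L := L) _ xy yz xz h1 h2 h3; have := @P_min (x |: [set y; z]).
have -> : x |: [set y; z] != set0 by apply/set0Pn; exists x; rewrite !inE eqxx.
have -> : #|x |: [set y; z]| = 3%N by rewrite cardsU1 cards2 yz !inE negb_or xy xz.
move=> /(_ isT) h /(_ _); rewrite leNgt; case: (boolP (all _ _)) => [_ /(_ isT)|/negP[]].
  by move: h; lia.
by apply/allP => e eL; have := allP (loopless_G (tgt e)) _ eL; rewrite eqxx andbT.
Qed.

Lemma good_all : exists f, good f setT.
Proof. by have [f /pcol_good gf] := sparse_colorable (sparse_all setT); exists f. Qed.

Lemma extend_good R f : R != set0 -> good f R ->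
  (forall R', R \proper R' -> P R - 2 <= P R') ->
  (forall y, y \notin R -> (kap L [set y] R <= 4)%N) ->
  (forall y z, y \notin R -> z \notin R -> y != z ->
     ~~ [&& has3 L [set y] [set z], has3 L [set y] R & has3 L [set z] R]) ->
  exists g, good g setT /\ {in R, g =1 f}.
Proof.
case/set0Pn => x0 x0R /pcol_good pf hP hk ht.
have [||||||g [pg gf]] := extend (n := (#|[set: G]|.+2)%N) (S := setT) (fun S' L' _ => @sparse_colorable _ S' L') x0R _ _ pf.
- exact: subsetT.
- by rewrite !ltnS; apply: subset_leq_card; apply: subsetT.
- exact: sparse_all.
- by move=> R' RR' _; exact: hP.
- by move=> y; rewrite inE => /andP[yR _]; exact: hk.
- by move=> y z; rewrite !inE => /andP[yR _] /andP[zR _]; exact: ht.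
by exists g; split=> //; apply/pcol_good.
Qed.

(* Collapsing a connected R: the two local conditions follow from the first. *)
Lemma extend_good1 R f : R != set0 -> good f R ->
  (forall R', R \proper R' -> P R - 1 <= P R') -> exists g, good g setT /\ {in R, g =1 f}.
Proof.
move=> R0 gf hP; have wL := weighted_G; apply: extend_good => //.
- by move=> R' /hP; lia.
- move=> y yR; rewrite leqNgt; apply/negP => k5.
  have := hP (y |: R); rewrite properE subsetUr subUset sub1set (negbTE yR) P_addG // => /(_ isT).
  by have := kap_cst [set y] R wL; lia.
- move=> y z yR zR yz; apply/negP => /and3P[h1 h2 h3].
  have zyR : z \notin y |: R by rewrite !inE negb_or eq_sym yz.
  have := hP (z |: (y |: R)); rewrite properE !subUset !sub1set (negbTE yR) andbF andbT.
  have -> : R \subset z |: (y |: R) by rewrite setUA subsetUr.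
  move=> /(_ isT); rewrite P_addG // P_addG // cst_setU1 //.
  rewrite [cst L [set z] [set y]]cstC; have := has3_cst h1; have := has3_cst h2; have := has3_cst h3; lia.
Qed.

Lemma good_shift f c S : good f S -> good (fun x => f x + c) S.
Proof. by move=> gf u v uS vS uv; rewrite opprD addrACA subrr addr0; exact: gf. Qed.

Lemma good_opp f S : good f S -> good (fun x => - f x) S.
Proof. by move=> gf u v uS vS uv; rewrite -stepsN opprD !opprK; exact: gf. Qed.

Lemma good1 f x : good f [set x].
Proof. by move=> u v /set1P -> /set1P ->; rewrite edge_irrefl. Qed.

Lemma good_add f y R : good f R -> (forall z, z \in R -> edge z y -> steps (f y - f z)) -> good f (y |: R).
Proof.
move=> gf hy u v; rewrite !in_setU1 => /orP[/eqP ->|uR] /orP[/eqP ->|vR]; first by rewrite edge_irrefl.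
- by rewrite edge_sym => /(hy _ vR); rewrite -stepsN opprB.
- exact: hy.
- exact: gf.
Qed.

(** [R] has the smallest potential its size admits, and the minimum for larger sets is no
    smaller. *)
Lemma extend_path R f : R != set0 -> (#|R| < 6)%N -> P R <= #|R|%:Z + 4 -> good f R ->
  exists g, good g setT /\ {in R, g =1 f}.
Proof.
move=> R0 R6 PR gf; apply: extend_good1 => // R' RR'; have := proper_card RR'.
have := P_min (R0 : R != set0); have := @P_min R'.
have -> : R' != set0.
  by have /set0Pn[x xR] := R0; apply/set0Pn; exists x; apply: (subsetP (proper_sub RR')).
by move=> /(_ isT); move: R6 PR; clear; lia.
Qed.

Lemma path2_good v1 v2 x d1 d2 : edge v1 x -> edge x v2 -> v1 != v2 -> ~~ edge v1 v2 -> ~~ steps (d2 - d1) ->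
  exists f, [/\ good f setT, f v1 = d1 & f v2 = d2].
Proof.
move=> e1 e2 v12 n12 /steps2_inv[e se se'].
have ne u v : edge u v -> (u == v) = false by apply: contraTF => /eqP ->; rewrite edge_irrefl.
have n1 := ne _ _ e1; have n2 := ne _ _ e2; have n3 := negbTE v12.
pose f y := if y == x then d1 + e else if y == v1 then d1 else d2.
have fx : f x = d1 + e by rewrite /f eqxx.
have f1 : f v1 = d1 by rewrite /f n1 eqxx.
have f2 : f v2 = d2 by rewrite /f eq_sym n2 eq_sym n3.
pose R := v2 |: (x |: [set v1]).
have x1 : x \notin [set v1] by rewrite inE eq_sym n1.
have x2 : v2 \notin x |: [set v1] by rewrite !inE negb_or eq_sym n2 eq_sym n3.
have cR : #|R| = 3%N by rewrite cardsU1 x2 cardsU1 x1 cards1.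
have [|||| g [gg gf]] := @extend_path R f.
- by apply/set0Pn; exists v2; rewrite !inE eqxx.
- by rewrite cR.
- have p1 : P (x |: [set v1]) <= P [set v1] + 1.
    by apply: (P_adj x1 (set11 v1)); rewrite edge_sym.
  have p2 : P R <= P (x |: [set v1]) + 1.
    by apply: (P_adj x2 (setU11 x _)); rewrite edge_sym.
  by move: p1 p2; rewrite cR P1G; clear; lia.
- apply: good_add; first apply: good_add; first exact: good1.
    by move=> z /set1P -> _; rewrite fx f1 addrAC subrr add0r.
  move=> z; rewrite !inE => /orP[] /eqP -> h.
    by rewrite f2 fx opprD addrA.
  by rewrite h in n12.
by exists g; rewrite !gf ?inE ?eqxx ?orbT.
Qed.

Lemma path3_good v1 v2 x y d1 d2 : edge v1 x -> edge x y -> edge y v2 -> v1 != v2 ->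
  ~~ edge v1 v2 -> ~~ edge v1 y -> ~~ edge x v2 -> d1 != d2 ->
  exists f, [/\ good f setT, f v1 = d1 & f v2 = d2].
Proof.
move=> e1 e2 e3 v12 n12 n1y nx2; rewrite eq_sym -subr_eq0 => /steps3_inv[e [g [se sg se']]].
have ne u v : edge u v -> (u == v) = false by apply: contraTF => /eqP ->; rewrite edge_irrefl.
have n1 := ne _ _ e1; have n2 := ne _ _ e2; have n3 := ne _ _ e3; have n4 := negbTE v12.
have n5 : (v1 == y) = false by apply: contraNF n12 => /eqP ->.
have n6 : (x == v2) = false by apply: contraNF n12 => /eqP <-.
pose f z := if z == x then d1 + e else if z == y then d1 + e + g else if z == v1 then d1 else d2.
have fx : f x = d1 + e by rewrite /f eqxx.
have fy : f y = d1 + e + g by rewrite /f eq_sym n2 eqxx.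
have f1 : f v1 = d1 by rewrite /f n1 n5 eqxx.
have f2 : f v2 = d2 by rewrite /f eq_sym n6 eq_sym n3 eq_sym n4.
pose R := v2 |: (y |: (x |: [set v1])).
have x1 : x \notin [set v1] by rewrite inE eq_sym n1.
have x2 : y \notin x |: [set v1] by rewrite !inE negb_or eq_sym n2 eq_sym n5.
have x3 : v2 \notin y |: (x |: [set v1]) by rewrite !inE !negb_or eq_sym n3 eq_sym n6 eq_sym n4.
have cR : #|R| = 4%N by rewrite cardsU1 x3 cardsU1 x2 cardsU1 x1 cards1.
have [|||| h [gg gf]] := @extend_path R f.
- by apply/set0Pn; exists v2; rewrite !inE eqxx.
- by rewrite cR.
- have p1 : P (x |: [set v1]) <= P [set v1] + 1.
    by apply: (P_adj x1 (set11 v1)); rewrite edge_sym.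
  have p2 : P (y |: (x |: [set v1])) <= P (x |: [set v1]) + 1.
    by apply: (P_adj x2 (setU11 x _)); rewrite edge_sym.
  have p3 : P R <= P (y |: (x |: [set v1])) + 1.
    by apply: (P_adj x3 (setU11 y _)); rewrite edge_sym.
  by move: p1 p2 p3; rewrite cR P1G; clear; lia.
- apply: good_add; first apply: good_add; first apply: good_add; first exact: good1.
  + by move=> z /set1P -> _; rewrite fx f1 addrAC subrr add0r.
  + move=> z; rewrite !inE => /orP[] /eqP -> k; first by rewrite fy fx addrAC subrr add0r.
    by rewrite k in n1y.
  + move=> z; rewrite !inE => /or3P[] /eqP -> k.
    * by rewrite f2 fy !opprD !addrA.
    * by rewrite k in nx2.
    * by rewrite k in n12.
by exists h; rewrite !gf ?inE ?eqxx ?orbT.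
Qed.

Lemma kap_edge y z : (0 < kap L [set y] [set z])%N -> edge y z.
Proof.
move=> k0; have := gain_edgeP; case: (boolP (has (cross [set y] [set z]) L)) => [/hasP[e eL c] /(_ e eL)[ee _ _]|].
  by case/cross1: c => -[-> ->] //; rewrite edge_sym.
move/hasPn => no _; move: k0; rewrite /kap big_seq_cond big1 // => e /andP[/no/negbTE -> //].
Qed.

Lemma kap_cst_eq y R : (3 * cst L [set y] R = 4 * kap L [set y] R)%N.
Proof.
rewrite /cst /kap !big_distrr /= big_seq_cond [RHS]big_seq_cond; apply: eq_bigr => e /andP[eL _].
by have [_ _ ->] := gain_edgeP eL.
Qed.

(** The pair has potential 10 and sets of four or more vertices at least 8, which uses up the slack
    of [extend_good]. Distance at least 4 excludes precisely the local obstructions: a common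
    neighbour would see weight 6 after collapsing, and a path of length 3 would become a weight 3
    triangle. *)
Lemma far_good v1 v2 d1 d2 : v1 != v2 -> ~~ edge v1 v2 ->
  (forall x, ~~ (edge v1 x && edge x v2)) -> (forall x y, ~~ [&& edge v1 x, edge x y & edge y v2]) ->
  exists f, [/\ good f setT, f v1 = d1 & f v2 = d2].
Proof.
move=> v12 n12 n2 n3; pose R := [set v1; v2]; pose f y := if y == v1 then d1 else d2.
have v12' : v1 \notin [set v2] by rewrite inE.
have PR : P R <= 10 by rewrite P_addG // P1G; lia.
have cR : #|R| = 2%N by rewrite cards2 v12.
have k4 y : y \notin R -> (kap L [set y] R <= 4)%N.
  move=> yR; rewrite kap_pairE //; have [y1 y2] : y != v1 /\ y != v2.
    by move: yR; rewrite !inE negb_or => /andP[].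
  have k1 := sp_kap (sparse_all setT) (in_setT y) (in_setT v1) y1.
  have k2 := sp_kap (sparse_all setT) (in_setT y) (in_setT v2) y2.
  case: (posnP (kap L [set y] [set v1])) => [-> //|/kap_edge e1].
  case: (posnP (kap L [set y] [set v2])) => [->|/kap_edge e2]; first by rewrite addn0.
  by have := n2 y; rewrite edge_sym e1 e2.
have R0 : R != set0 by apply/set0Pn; exists v1; rewrite !inE eqxx.
have [||||g [gg gf]] := @extend_good R f R0.
- apply: good_add => [|z /set1P ->]; first exact: good1.
  by rewrite edge_sym (negbTE n12).
- move=> R' RR'; have /properP[_ [y yR' yR]] := RR'.
  (* One additional vertex has at most one edge to the pair, since all weights are 3 and their sum
     is at most 4; so the potential does not drop. Otherwise [R'] has at least four vertices. *)
  have [E|nE] := eqVneq (y |: R) R'.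
    by rewrite -E P_addG //; have := kap_cst_eq y R; have := k4 y yR; clear; lia.
  have RyR : y |: R \proper R' by rewrite properEneq nE subUset sub1set yR' proper_sub.
  have := proper_card RyR; rewrite cardsU1 yR cR => c4.
  have R'0 : R' != set0 by apply/set0Pn; exists y.
  by have := P_min R'0; move: c4 PR; clear; lia.
- exact: k4.
- move=> y z yR zR yz; apply/negP => /and3P[t1 /has3_edge[a aR ya] /has3_edge[b bR zb]].
  have yz' := has3_edge1 t1; have h3 u v : edge u v -> has3 L [set u] [set v].
    by case/gain_edge_ex => e eL c; apply/hasP; exists e => //; have [_ _ ->] := gain_edgeP eL; rewrite c.
  have tri w : edge y w -> edge z w -> False.
    move=> yw zw; have nee u v : edge u v -> u != v by apply: contraTneq => ->; rewrite edge_irrefl.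
    have := sp_tri (sparse_all setT) (in_setT y) (in_setT z) (in_setT w) yz (nee _ _ zw) (nee _ _ yw).
    by rewrite !h3.
  move: aR bR ya zb; rewrite !inE => /orP[] /eqP -> /orP[] /eqP -> ya zb.
  + exact: tri ya zb.
  + by have := n3 y z; rewrite edge_sym ya yz' zb.
  + by have := n3 z y; rewrite edge_sym zb edge_sym yz' ya.
  + exact: tri ya zb.
by exists g; rewrite !gf ?inE ?eqxx ?orbT // /f eqxx eq_sym (negbTE v12).
Qed.

Lemma good_plausible v1 v2 d1 d2 : (exists f, [/\ good f setT, f v1 = d1 & f v2 = d2]) <->
  (v1 = v2 /\ d1 = d2) \/ (edge v1 v2 /\ steps (d2 - d1)) \/
  (dist_exactly v1 v2 2 /\ ~ steps (d2 - d1)) \/ (dist_exactly v1 v2 3 /\ d1 <> d2) \/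
  dist_at_least v1 v2 4.
Proof.
split.
  case=> f [gf <- <-]; have gs u v : edge u v -> steps (f v - f u) by apply: gf.
  have [->|v12] := eqVneq v1 v2; first by left.
  have [e12|n12] := boolP (edge v1 v2); first by right; left; split=> //; exact: gs.
  have atl2 : dist_at_least v1 v2 2.
    by case=> [|x [|y p]] //; rewrite /is_walk /= ?andbT; [rewrite (negbTE v12)|case/andP => e /eqP E; rewrite -E e in n12].
  case: (pickP (fun x => edge v1 x && edge x v2)) => [x /andP[e1 e2]|n2].
    right; right; left; split; first by split=> //; exists [:: x; v2]; rewrite // /is_walk /= e1 e2 eqxx.
    by rewrite -(subrKA (f x)) addrC; apply/negP; apply: steps2; apply: gs.
  have atl3 : dist_at_least v1 v2 3.
    move=> p w; have := atl2 p w; case: p w => [|x [|y [|z p]]] //; rewrite /is_walk /= andbT => /andP[/andP[e1 e2] /eqP E] _.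
    by have := n2 x; rewrite -E e1 e2.
  case: (pickP (fun p : G * G => [&& edge v1 p.1, edge p.1 p.2 & edge p.2 v2])) => [[x y] /= /and3P[e1 e2 e3]|n3].
    right; right; right; left; split; first by split=> //; exists [:: x; y; v2]; rewrite // /is_walk /= e1 e2 e3 eqxx.
    move=> E; have := steps3 (gs _ _ e1) (gs _ _ e2) (gs _ _ e3).
    by rewrite E (_ : _ + _ + _ = 0) ?eqxx //; ring.
  right; right; right; right => p w; have := atl3 p w.
  case: p w => [|x [|y [|z [|t p]]]] //; rewrite /is_walk /= andbT => /andP[/and3P[e1 e2 e3] /eqP E] _.
  by have := n3 (x, y); rewrite /= -E e1 e2 e3.
have atl u v k p : dist_at_least u v k -> is_walk u v p -> (k <= size p)%N by move=> h; apply: h.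
case=> [[-> <-]|[[e12 s12]|[[[[p w sz] al] n12]|[[[[p w sz] al] n12]|al]]]].
- have [f gf] := good_all; exists (fun x => f x + (d1 - f v2)); rewrite addrCA subrr addr0.
  by split=> //; exact: good_shift.
- have [f gf] := good_all; have sf : steps (f v2 - f v1) by exact: gf.
  have [E|E] := steps_eqN sf s12.
    exists (fun x => f x + (d1 - f v1)); split; first exact: good_shift.
      by rewrite addrCA subrr addr0.
    by rewrite (_ : _ + _ = (f v2 - f v1) + d1); [rewrite -E subrK|ring].
  exists (fun x => - f x + (d1 + f v1)); split; first exact: (good_shift _ (good_opp gf)).
    by ring.
  by rewrite (_ : _ + _ = - (f v2 - f v1) + d1); [rewrite -E subrK|ring].
- case: p w sz => [|x [|y [|z p]]] //; rewrite /is_walk /= andbT => /andP[/andP[e1 e2] /eqP E] _.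
  rewrite E in e2; apply: (path2_good e1 e2); last by apply/negP.
    by apply/eqP => h; have := atl _ _ _ [::] al; rewrite /is_walk h /= eqxx => /(_ isT).
  by apply/negP => h; have := atl _ _ _ [:: v2] al; rewrite /is_walk /= h eqxx => /(_ isT).
- case: p w sz => [|x [|y [|z [|t p]]]] //; rewrite /is_walk /= andbT => /andP[/and3P[e1 e2 e3] /eqP E] _.
  rewrite E in e3; apply: (path3_good e1 e2 e3).
  + by apply/eqP => h; have := atl _ _ _ [::] al; rewrite /is_walk h /= eqxx => /(_ isT).
  + by apply/negP => h; have := atl _ _ _ [:: v2] al; rewrite /is_walk /= h eqxx => /(_ isT).
  + by apply/negP => h; have := atl _ _ _ [:: y; v2] al; rewrite /is_walk /= h e3 eqxx => /(_ isT).
  + by apply/negP => h; have := atl _ _ _ [:: x; v2] al; rewrite /is_walk /= h e1 eqxx => /(_ isT).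
  + exact/eqP.
apply: far_good.
- by apply/eqP => h; have := atl _ _ _ [::] al; rewrite /is_walk h /= eqxx => /(_ isT).
- by apply/negP => h; have := atl _ _ _ [:: v2] al; rewrite /is_walk /= h eqxx => /(_ isT).
- by move=> x; apply/negP => /andP[h h']; have := atl _ _ _ [:: x; v2] al; rewrite /is_walk /= h h' eqxx => /(_ isT).
- by move=> x y; apply/negP => /and3P[h h' h'']; have := atl _ _ _ [:: x; y; v2] al; rewrite /is_walk /= h h' h'' eqxx => /(_ isT).
Qed.

End GraphColoring.

(** * The vertices of a 5-cycle as elements of Z5 *)

Lemma cycle5_colors (C : sgraph) : is_cycle_graph C 5 ->
  exists (phi : C -> Z5) (psi : Z5 -> C), [/\ cancel phi psi, cancel psi phi &
    forall x y, edge x y = steps (phi y - phi x)].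
Proof.
case=> c [cc sz all_c ec]; have uc : uniq c by case/and3P: cc.
(* The multiples of 2 in order, so that consecutive vertices differ by 2. *)
pose t : seq Z5 := [:: 0; 2%:R; 4%:R; 1; 3%:R].
case: c sz cc all_c ec uc => [|a [|b [|d [|e [|g [|]]]]]] // _ _.
set c := [:: a; b; d; e; g] => all_c ec uc.
have ix x : (index x c < 5)%N by have := all_c x; rewrite -index_mem.
have ti z : z \in t by elim/forall_Z5: z.
have iz z : (index z t < 5)%N by have := ti z; rewrite -index_mem.
exists (fun x => nth 0 t (index x c)), (fun z => nth a c (index z t)); split.
- by move=> x; rewrite index_uniq //; rewrite nth_index.
- by move=> z; rewrite index_uniq // nth_index.
have nx x : next c x = nth a c ((index x c).+1 %% 5).
  rewrite next_nth all_c; move: (ix x).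
  by case: (index x c) => [|[|[|[|[|]]]]].
have E x y : (y == next c x) = (index y c == (index x c).+1 %% 5)%N.
  by rewrite nx -{1}(nth_index a (all_c y)) nth_uniq // ltn_mod.
move=> x y; rewrite ec !E; have := ix x; have := ix y.
by case: (index x c) => [|[|[|[|[|]]]]] //; case: (index y c) => [|[|[|[|[|]]]]].
Qed.

Theorem coloring_criterion (G C : sgraph) (v1 v2 : G) (c1 c2 : C) :
  (forall S : {set G}, S != set0 -> (4 * edges_in S + minn 10 (#|S| + 4) <= 5 * #|S|)%N) ->
  is_cycle_graph C 5 ->
  (exists psi : G -> C, homomorphism psi /\ psi v1 = c1 /\ psi v2 = c2) <->
  plausible v1 v2 c1 c2.
Proof.
move=> sG /cycle5_colors[phi [psi [pK psK ep]]].
have hP := good_plausible sG v1 v2 (phi c1) (phi c2); rewrite -ep in hP.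
have phiE x y : (phi x = phi y) <-> (x = y) by split=> [/(can_inj pK)|->].
have -> : (exists f : G -> C, homomorphism f /\ f v1 = c1 /\ f v2 = c2) <->
    exists f, [/\ good f [set: G], f v1 = phi c1 & f v2 = phi c2].
  split=> [[f [hf [<- <-]]]|[f [gf f1 f2]]].
    by exists (fun x => phi (f x)); split=> // u v _ _ uv; rewrite -ep; exact: hf.
  exists (fun x => psi (f x)); rewrite f1 f2 !pK; split=> // u v uv.
  by rewrite ep !psK; apply: gf.
by rewrite hP /plausible !phiE.
Qed.

#[local] Arguments nat_of_ord : simpl nomatch.

(** * Euler's inequality for graphs represented by connected sets in a grid *)

Lemma F2P (x : 'F_2) : x = 0 \/ x = 1.
Proof. by case: x => [[|[|n]] Hx]; [left|right|]; try exact/val_inj. Qed.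

Lemma F2D (x : 'F_2) : x + x = 0.
Proof. by case: (F2P x) => ->; apply/val_inj. Qed.

Lemma F2_eq (x y : 'F_2) : x + y = 0 -> x = y.
Proof. by move/eqP; rewrite addr_eq0 => /eqP ->; apply/eqP; rewrite eq_sym -addr_eq0 F2D. Qed.

Section Grid.
Notation F := 'F_2.

(* A grid edge is given by its lower left end and its direction (true for
   horizontal); the unit square with upper right corner c is called cell c. *)
Definition pt := (nat * nat)%type.
Definition ge := (bool * (nat * nat))%type.
Implicit Types (e : ge) (p q : pt) (x : ge -> F) (chi : pt -> F) (D : pred pt).

Definition end1 e : pt := e.2.
Definition end2 e : pt := if e.1 then (e.2.1.+1, e.2.2) else (e.2.1, e.2.2.+1).
Definition side1 e : pt := (e.2.1.+1, e.2.2.+1).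
Definition side2 e : pt := end2 e.
(** The boundary at [p], summed over its four grid edges. Predecessors are truncated on the axes, so
    it is meaningful for positive coordinates only; [in_grid] keeps the sets there. *)
Definition bd x p := x (true, p) + x (true, (p.1.-1, p.2)) + x (false, p) + x (false, (p.1, p.2.-1)).
Definition cobd chi e := chi (side1 e) + chi (side2 e).

Lemma bd_cobd chi i j : bd (cobd chi) (i.+1, j.+1) = 0.
Proof.
rewrite /bd /cobd /side1 /side2 /end2 /=.
case: (F2P (chi (i.+2, j.+2))) => ->; case: (F2P (chi (i.+2, j.+1))) => ->;
case: (F2P (chi (i.+1, j.+2))) => ->; case: (F2P (chi (i.+1, j.+1))) => ->; exact/val_inj.
Qed.

(** The plane has no holes: a cycle is the boundary of the cells it encloses. [chi] counts, modulo
    2, the horizontal edges of the cycle below a cell in its column. *)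
Lemma fill x : (forall i j, bd x (i.+1, j.+1) = 0) ->
  (forall e, (end1 e).1 = 0%N \/ (end1 e).2 = 0%N -> x e = 0) ->
  exists chi, forall e, x e = cobd chi e.
Proof.
move=> hb h0; pose chi (p : pt) := if p.1 is i.+1 then \sum_(j < p.2) x (true, (i, j : nat)) else 0.
have hT i j : x (true, (i, j)) = chi (i.+1, j.+1) + chi (i.+1, j).
  by rewrite /chi /= big_ord_recr /= addrAC F2D add0r.
exists chi => -[[] [i j]]; first exact: hT.
rewrite /cobd /side1 /side2 /end2 /=; elim: j => [|j IH].
  rewrite /chi /= big_ord1 h0; last by right.
  by case: i => [|i]; rewrite ?big_ord1 !h0 ?addr0 //; right.
case: i IH => [|i] IH.
  rewrite h0; last by left.
  by rewrite /chi /= big1 ?addr0 // => k _; rewrite h0 //; left.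
have := hb i j; rewrite /bd /= !hT IH.
case: (F2P (chi (i.+2, j.+2))) => ->; case: (F2P (chi (i.+2, j.+1))) => ->;
case: (F2P (chi (i.+1, j.+2))) => ->; case: (F2P (chi (i.+1, j.+1))) => ->;
case: (F2P (x (false, (i.+1, j.+1)))) => ->; by [move/(congr1 val)|move=> _; apply/val_inj].
Qed.

Lemma sum_shift N (f : nat -> F) : f 0%N = 0 -> f N = 0 -> \sum_(i < N) f i = \sum_(i < N) f i.+1.
Proof.
move=> f0 fN; have := big_ord_recr N f (idx := 0) (op := +%R).
by rewrite big_ord_recl /= f0 fN add0r addr0 => <-; apply: eq_bigr.
Qed.

Definition ind D p : F := (D p)%:R.

Definition in_grid N D := forall p, D p -> (0 < p.1 < N)%N && (0 < p.2 < N)%N.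

(** Summation by edges instead of points; the terms produced by shifting an index vanish because [D]
    stays away from the border. *)
Lemma deg_sum N D x : in_grid N D ->
  \sum_(i < N) \sum_(j < N) ind D (i : nat, j : nat) * bd x (i : nat, j : nat) =
  \sum_(b : bool) \sum_(i < N) \sum_(j < N)
    (ind D (end1 (b, (i : nat, j : nat))) + ind D (end2 (b, (i : nat, j : nat)))) * x (b, (i : nat, j : nat)).
Proof.
move=> hD; have d0 p : ~~ ((0 < p.1 < N)%N && (0 < p.2 < N)%N) -> ind D p = 0.
  by rewrite /ind; case Dp: (D p) => //; rewrite hD.
rewrite big_bool /end1 /end2 /=.
transitivity (\sum_(i < N) \sum_(j < N) ind D (i : nat, j : nat) * x (true, (i : nat, j : nat)) +
  \sum_(i < N) \sum_(j < N) ind D (i.+1, j : nat) * x (true, (i : nat, j : nat)) +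
  (\sum_(i < N) \sum_(j < N) ind D (i : nat, j : nat) * x (false, (i : nat, j : nat)) +
  \sum_(i < N) \sum_(j < N) ind D (i : nat, j.+1) * x (false, (i : nat, j : nat)))); last first.
  rewrite -!big_split /=; apply: eq_bigr => i _; rewrite -!big_split /=; apply: eq_bigr => j _.
  by rewrite !mulrDl.
rewrite [X in _ + X + _](_ : _ = \sum_(i < N) \sum_(j < N) ind D (i : nat, j : nat) * x (true, (i.-1, j : nat))); last first.
  rewrite (sum_shift (f := fun i => \sum_(j < N) ind D (i, j : nat) * x (true, (i.-1, j : nat)))) //;
  by rewrite big1 // => j _; rewrite d0 ?mul0r //= ?ltnn ?andbF.
rewrite [X in _ + (_ + X)](_ : _ = \sum_(i < N) \sum_(j < N) ind D (i : nat, j : nat) * x (false, (i : nat, j.-1))); last first.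
  apply: eq_bigr => i _; rewrite (sum_shift (f := fun j => ind D (i : nat, j) * x (false, (i : nat, j.-1)))) //;
  by rewrite d0 ?mul0r //= ?ltnn ?andbF.
rewrite -!big_split /=; apply: eq_bigr => i _; rewrite -!big_split /=; apply: eq_bigr => j _.
by rewrite /bd /= !mulrDr !addrA.
Qed.

Definition adj p q := ((p.1 == q.1) && ((q.2 == p.2.+1) || (p.2 == q.2.+1))) ||
  ((p.2 == q.2) && ((q.1 == p.1.+1) || (p.1 == q.1.+1))).

Lemma adj_edge p q : adj p q -> exists e, (end1 e = p /\ end2 e = q) \/ (end1 e = q /\ end2 e = p).
Proof.
case: p q => [i j] [k l]; rewrite /adj /end1 /end2 /=.
case/orP => /andP[/eqP -> /orP[] /eqP ->].
- by exists (false, (k, j)); left.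
- by exists (false, (k, l)); right.
- by exists (true, (i, l)); left.
- by exists (true, (k, l)); right.
Qed.

Definition delta e : ge -> F := fun e' => (e' == e)%:R.

Lemma bd_delta e p : (0 < p.1)%N -> (0 < p.2)%N -> bd (delta e) p = (end1 e == p)%:R + (end2 e == p)%:R.
Proof.
case: e p => [[] [k l]] [[|i] [|j]] // _ _; rewrite /bd /delta /end1 /end2 /= !xpair_eqE /= !eqSS ?addr0 ?add0r.
  by rewrite (eq_sym k i.+1) (eq_sym l) (eq_sym k i) .
by rewrite (eq_sym k) (eq_sym l j.+1) (eq_sym l j).
Qed.

Lemma bdD x y p : bd (fun e => x e + y e) p = bd x p + bd y p.
Proof. by rewrite /bd; ring. Qed.

Lemma bd_sum (I : Type) (r : seq I) (Q : pred I) (X : I -> ge -> F) p :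
  bd (fun e => \sum_(i <- r | Q i) X i e) p = \sum_(i <- r | Q i) bd (X i) p.
Proof. by rewrite /bd -!big_split. Qed.

Lemma bdZ (a : F) x p : bd (fun e => a * x e) p = a * bd x p.
Proof. by rewrite /bd; ring. Qed.

Definition gconn D := forall p q, D p -> D q -> exists s, [/\ path adj p s, last p s = q & all D s].

Definition supp_in D x := forall e, x e != 0 -> D (end1 e) && D (end2 e).

Lemma path_chain N D p s : in_grid N D -> D p -> path adj p s -> all D s ->
  exists2 x, supp_in D x & forall q, (0 < q.1)%N -> (0 < q.2)%N -> bd x q = (p == q)%:R + (last p s == q)%:R.
Proof.
move=> hD; elim: s p => [|r s IH] p Dp /=.
  move=> _ _; exists (fun=> 0) => [e|q _ _]; first by rewrite eqxx.
  by rewrite F2D /bd !addr0.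
case/andP => /adj_edge[e he] ps /andP[Dr Ds]; have [x sx bx] := IH r Dr ps Ds.
exists (fun e' => delta e e' + x e') => [e'|q q1 q2].
  have [/eqP x0|/sx //] := boolP (x e' == 0); rewrite x0 addr0 /delta.
  case: (eqVneq e' e) => [-> _|_]; last by rewrite eqxx.
  by case: he => [[-> ->]|[-> ->]]; rewrite Dp Dr.
rewrite bdD bd_delta // bx //; case: he => [[-> ->]|[-> ->]].
  by rewrite addrA -(addrA (p == q)%:R) F2D addr0.
by rewrite addrA (addrC (r == q)%:R) -(addrA (p == q)%:R) F2D addr0.
Qed.

(** A T-join: the sum of paths from a fixed root to the points where [tau] is 1. Their contributions
    at the root cancel because [tau] has sum 0. *)
Lemma tjoin N D (tau : pt -> F) : in_grid N D -> gconn D ->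
  \sum_(i < N) \sum_(j < N) ind D (i : nat, j : nat) * tau (i : nat, j : nat) = 0 ->
  exists2 x, supp_in D x & forall q, D q -> bd x q = tau q.
Proof.
move=> hD cD; rewrite pair_bigA /= => st.
pose pos (k : 'I_N * 'I_N) : pt := (k.1 : nat, k.2 : nat).
have posD q : D q -> exists k, pos k = q.
  by move=> /hD /andP[/andP[_ h1] /andP[_ h2]]; exists (Ordinal h1, Ordinal h2); case: q h1 h2.
case: (pickP (fun k => D (pos k))) => [r Dr|no]; last first.
  exists (fun=> 0) => [e|q Dq]; first by rewrite eqxx.
  by have [k E] := posD q Dq; have := no k; rewrite E Dq.
have hx k : exists x, D (pos k) -> supp_in D x /\
    forall q, (0 < q.1)%N -> (0 < q.2)%N -> bd x q = (pos r == q)%:R + (pos k == q)%:R.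
  have [Dk|_] := boolP (D (pos k)); last by exists (fun=> 0).
  have [s [ps ls Ds]] := cD _ _ Dr Dk; have [x sx bx] := path_chain hD Dr ps Ds.
  by exists x => _; split=> // q q1 q2; rewrite bx // ls.
have [X hX] : exists X : 'I_N * 'I_N -> ge -> F, forall k, D (pos k) -> supp_in D (X k) /\
    forall q, (0 < q.1)%N -> (0 < q.2)%N -> bd (X k) q = (pos r == q)%:R + (pos k == q)%:R.
  have := fin_all_exists hx; case=> X hX; by exists X.
exists (fun e => \sum_(k | D (pos k)) tau (pos k) * X k e) => [e|q Dq].
  apply: contraR => nD; rewrite big1 // => k Dk; have [sX _] := hX k Dk.
  by case: (eqVneq (X k e) 0) => [->|/sX]; rewrite ?mulr0 // (negbTE nD).
have /andP[/andP[q1 _] /andP[q2 _]] := hD q Dq; rewrite bd_sum.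
transitivity (\sum_(k | D (pos k)) (tau (pos k) * (pos r == q)%:R + tau (pos k) * (pos k == q)%:R)).
  by apply: eq_bigr => k Dk; rewrite bdZ (hX k Dk).2 // mulrDr.
rewrite big_split /= -mulr_suml.
have -> : \sum_(k | D (pos k)) tau (pos k) = 0.
  by rewrite -[RHS]st [LHS]big_mkcond; apply: eq_bigr => k _; rewrite /ind -/(pos k); case: ifP; rewrite ?mul1r ?mul0r.
have [k E] := posD q Dq; rewrite mul0r add0r (bigD1 k) ?E //= eqxx mulr1 big1 ?addr0 // => i /andP[_ ik].
case: eqP => [E'|_]; rewrite ?mulr0 //; case/eqP: ik; case: i k E E' => [a b] [c d]; rewrite /pos /= => <- [].
by move=> /val_inj -> /val_inj ->.
Qed.

End Grid.

(** * Even edge sets and girth *)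

Section Cycles.
Variables (T : finType) (f : rel T).
Hypothesis f_sym : symmetric f.
Hypothesis f_irr : irreflexive f.
Hypothesis f_deg : forall u v, f u v -> exists2 w, w != v & f u w.

(* The first vertex of a longest path has another neighbour on the path. *)
Lemma even_cycle u v : f u v -> exists c, [/\ cycle f c, uniq c & (2 < size c)%N].
Proof.
move=> uv; suff H n x y p : (#|T| < size p + n)%N -> path f x (y :: p) -> uniq (x :: y :: p) ->
    exists c, [/\ cycle f c, uniq c & (2 < size c)%N].
  apply: (H #|T|.+1 u v [::]) => //=; first by rewrite uv.
  by rewrite inE andbT; apply: contraTneq uv => ->; rewrite f_irr.
elim: n x y p => [|n IH] x y p hn pp up.
  have := max_card (mem (x :: y :: p)); rewrite (card_uniqP up) /= => h.
  by exfalso; move: hn; rewrite addn0 ltnNge => /negP[]; apply: leq_trans h; rewrite leqW.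
have /= /andP[xy pp'] := pp; have [w wy xw] := f_deg xy.
have wx : w != x by apply: contraTneq xw => ->; rewrite f_irr.
have [wp|wp] := boolP (w \in p); last first.
  apply: (IH w x (y :: p)); first by move: hn => /=; rewrite addnS addSn.
    by rewrite /= f_sym xw xy.
  by rewrite cons_uniq up andbT !inE !negb_or wx wy.
case/splitPr: wp pp' up => p1 p2; rewrite cat_path /= => /and3P[q1 q2 _] up.
exists (x :: y :: rcons p1 w); split.
- by rewrite /= xy rcons_path rcons_path q1 q2 last_rcons f_sym xw.
- have : uniq ((x :: y :: rcons p1 w) ++ p2) by rewrite !cat_cons cat_rcons.
  by rewrite cat_uniq => /andP[].
- by rewrite -[size _]/(size (rcons p1 w)).+2 size_rcons.
Qed.

Lemma next2_neq (c : seq T) x : uniq c -> (2 < size c)%N -> x \in c -> next c (next c x) != x.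
Proof.
move=> uc sc xc; have [i c' E] := rot_to xc.
have ur : uniq (x :: c') by rewrite -E rot_uniq.
have sr : size (x :: c') = size c by rewrite -E size_rot.
rewrite -(next_rot i uc) -(next_rot i uc) E.
case: c' ur sr {E} => [|y [|z s]]; try by move=> _ E; rewrite -E in sc.
move=> /= /and3P[]; rewrite !inE !negb_or => /and3P[xy xz xs] _ _ _.
have yx : (y == x) = false by rewrite eq_sym (negbTE xy).
by rewrite ?eqxx ?(negbTE xy) ?yx ?eqxx eq_sym.
Qed.

End Cycles.

(** Even degrees leave no vertex of degree 1, so a nonempty set contains a cycle. *)
Lemma even_edges_girth (G : sgraph) (X : {set G * G}) g : girth_at_least G g ->
  X \subset edge_set G -> X != set0 ->
  (forall u, \sum_(eps in X) ((eps.1 == u)%:R + (eps.2 == u)%:R) = 0 :> 'F_2) -> (g <= #|X|)%N.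
Proof.
move=> hg /subsetP XE X0 ev; pose f : rel G := fun u v => ((u, v) \in X) || ((v, u) \in X).
have rk eps : eps \in X -> edge eps.1 eps.2 /\ (enum_rank eps.1 < enum_rank eps.2)%N.
  by move/XE; rewrite inE => /andP[].
have fs : symmetric f by move=> u v; rewrite /f orbC.
have fe u v : f u v -> edge u v by case/orP => /rk [] //; rewrite edge_sym.
have fi : irreflexive f by move=> u; apply/negP => /fe; rewrite edge_irrefl.
have asym u v : (u, v) \in X -> (v, u) \in X -> False.
  by move=> /rk[_ /= h1] /rk[_ /= h2]; move: h1 h2; lia.
have fd u v : f u v -> exists2 w, w != v & f u w.
  move=> uv; case: (pickP (fun w => (w != v) && f u w)) => [w /andP[]|no]; first by exists w.
  exfalso; have uniq_v w : f u w -> w = v by move=> uw; have := no w; rewrite uw andbT => /negbFE/eqP.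
  have ne : (v == u) = false by apply: contraTF uv => /eqP ->; rewrite fi.
  have [eps Xe he] : exists2 eps, eps \in X & (eps.1 == u)%:R + (eps.2 == u)%:R = 1 :> 'F_2 /\
      (forall eps', eps' \in X -> eps' != eps -> (eps'.1 == u) = false /\ (eps'.2 == u) = false).
    have [h|h] := orP uv; [exists (u, v) | exists (v, u)] => //=; rewrite ne eqxx ?addr0 ?add0r; split=> //.
      case=> a b Xab; rewrite xpair_eqE /= => nab; split; apply/eqP => E; subst u.
        by have := uniq_v b; rewrite /f Xab => /(_ isT) E; rewrite E !eqxx in nab.
      by have := uniq_v a; rewrite /f Xab orbT => /(_ isT) E; subst a; exact: asym h Xab.
    case=> a b Xab; rewrite xpair_eqE /= => nab; split; apply/eqP => E; subst u.
      by have := uniq_v b; rewrite /f Xab => /(_ isT) E; subst b; exact: asym h Xab.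
    by have := uniq_v a; rewrite /f Xab orbT => /(_ isT) E; rewrite E !eqxx in nab.
  have := ev u; rewrite (bigD1 eps) //= he.1 big1 ?addr0; first by move/(congr1 val).
  by move=> e' /andP[Xe' ne']; have [-> ->] := he.2 e' Xe' ne'; rewrite addr0.
have [[a b] Xab] := set0Pn _ X0; have fab : f a b by rewrite /f Xab.
have [c [cc uc sc]] := even_cycle fs fi fd fab.
have : is_cycle c by rewrite /is_cycle uc sc (sub_cycle fe).
(* Each edge of the cycle is stored in one orientation, which [h] selects; [h] is injective since
   the cycle has more than two vertices. *)
move/hg/leq_trans; apply; pose h x := if (x, next c x) \in X then (x, next c x) else (next c x, x).
have hX x : x \in c -> h x \in X.
  by move=> xc; rewrite /h; case: ifP => // n1; have := next_cycle cc xc; rewrite /f n1.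
have hinj : {in c &, injective h}.
  move=> x y xc yc; rewrite /h; case: ifP => _; case: ifP => _ [] // E1 E2.
    by have := next2_neq uc sc yc; rewrite -E1 E2 eqxx.
  by have := next2_neq uc sc yc; rewrite -E2 E1 eqxx.
rewrite -(size_map h); have um : uniq (map h c) by rewrite map_inj_in_uniq.
rewrite -(card_uniqP um); apply/subset_leq_card/subsetP => e /mapP[x xc ->]; exact: hX.
Qed.

(** * The cycle space is spanned by face boundaries *)

Section Euler.
Variables (G : sgraph) (n : nat) (D : G -> pred pt) (S : {set G}).
Let N := n.+1.
Hypothesis Dint : forall u, in_grid N (D u).
Hypothesis Dconn : forall u, gconn (D u).
Hypothesis Ddisj : forall u v p, D u p -> D v p -> u = v.
Hypothesis Dadj : forall u v, edge u v -> exists p q, [/\ D u p, D v q & adj p q].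
Notation F := 'F_2.
Notation R := (bool * ('I_N * 'I_N))%type.

Definition E_S : {set G * G} := [set p in edge_set G | (p.1 \in S) && (p.2 \in S)].
Implicit Types (eps : G * G) (u v : G) (e : ge) (p q : pt) (x : ge -> F).

Lemma E_SP eps : eps \in E_S -> [/\ edge eps.1 eps.2, eps.1 \in S, eps.2 \in S & (enum_rank eps.1 < enum_rank eps.2)%N].
Proof. by rewrite !inE => /andP[/andP[-> ->] /andP[-> ->]]. Qed.

Definition gpos (k : R) : ge := (k.1, (k.2.1 : nat, k.2.2 : nat)).

Lemma gpos_inj : injective gpos.
Proof. by case=> a [b c] [a' [b' c']] [-> /val_inj -> /val_inj ->]. Qed.

Lemma gpos_range e : ((end1 e).1 < N)%N -> ((end1 e).2 < N)%N -> exists k, gpos k = e.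
Proof. by case: e => d [i j] /= h1 h2; exists (d, (Ordinal h1, Ordinal h2)). Qed.

Definition represents (k : R) eps :=
  (D eps.1 (end1 (gpos k)) /\ D eps.2 (end2 (gpos k))) \/ (D eps.1 (end2 (gpos k)) /\ D eps.2 (end1 (gpos k))).

Lemma representatives : exists rep : G * G -> R, forall eps, eps \in E_S -> represents (rep eps) eps.
Proof.
have [] := @fin_all_exists (G * G)%type (fun=> R) (fun eps k => eps \in E_S -> represents k eps) _; last by move=> rep h; exists rep.
move=> eps; have [/E_SP[ee _ _ _]|_] := boolP (eps \in E_S); last by exists (true, (ord0, ord0)).
have [p [q [Dp Dq /adj_edge[e he]]]] := Dadj ee.
have [/Dint/andP[/andP[_ p1] /andP[_ p2]] /Dint/andP[/andP[_ q1] /andP[_ q2]]] := (Dp, Dq).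
have [k hk] : exists k, gpos k = e by apply: gpos_range; case: he => [[-> _]|[-> _]].
by exists k => _; rewrite /represents hk; case: he => [[-> ->]|[-> ->]]; [left|right].
Qed.

(* H consists of the grid edges inside some D u together with one grid edge for
   each edge of G; its faces are the classes of cells joined across non-H edges. *)
Variable rep : G * G -> R.
Hypothesis repP : forall eps, eps \in E_S -> represents (rep eps) eps.
Let grep eps := gpos (rep eps).

Lemma rep_inj : {in E_S &, injective rep}.
Proof.
move=> a b Ea Eb E; have [_ _ _ ra] := E_SP Ea; have [_ _ _ rb] := E_SP Eb.
have := repP Ea; have := repP Eb; rewrite /represents E.
case: a b ra rb {Ea Eb E} => [a1 a2] [b1 b2] /= ra rb.
case=> [[h1 h2]|[h1 h2]] [[h3 h4]|[h3 h4]].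
- by rewrite (Ddisj h1 h3) (Ddisj h2 h4).
- by move: ra rb; rewrite (Ddisj h1 h4) (Ddisj h2 h3); lia.
- by move: ra rb; rewrite (Ddisj h1 h4) (Ddisj h2 h3); lia.
- by rewrite (Ddisj h1 h3) (Ddisj h2 h4).
Qed.

Lemma rep_ind u eps : eps \in E_S ->
  ind (D u) (end1 (grep eps)) + ind (D u) (end2 (grep eps)) = (eps.1 == u)%:R + (eps.2 == u)%:R.
Proof.
move=> Ee; have i v p : D v p -> ind (D u) p = (v == u)%:R.
  move=> Dv; rewrite /ind; case: eqP => [<-|ne]; first by rewrite Dv.
  by case Du : (D u p) => //; case: ne; exact: Ddisj Dv Du.
by case: (repP Ee) => -[/i h1 /i h2]; rewrite /grep h1 h2 // addrC.
Qed.

Definition inner e := [exists u in S, D u (end1 e) && D u (end2 e)].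
Definition isH e := inner e || [exists eps in E_S, grep eps == e].

Lemma rep_notinner eps : eps \in E_S -> ~~ inner (grep eps).
Proof.
move=> Ee; apply/existsP => -[u /and3P[_ d1 d2]]; have [ee _ _ _] := E_SP Ee.
suff E : eps.1 = eps.2 by rewrite E edge_irrefl in ee.
case: (repP Ee) => -[h1 h2]; first by rewrite (Ddisj h1 d1) (Ddisj h2 d2).
by rewrite (Ddisj h1 d2) (Ddisj h2 d1).
Qed.

(** Grid edges inside [D u] count twice and those inside other sets not at all, so only the
    representatives of edges at [u] remain. *)
Lemma rep_sum x u : (forall k : R, ~~ isH (gpos k) -> x (gpos k) = 0) -> u \in S ->
  \sum_(i < N) \sum_(j < N) ind (D u) (i : nat, j : nat) * bd x (i : nat, j : nat) =
  \sum_(eps in E_S) ((eps.1 == u)%:R + (eps.2 == u)%:R) * x (grep eps).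
Proof.
move=> hx uS; rewrite deg_sum //.
under eq_bigr => b _ do rewrite pair_bigA.
rewrite pair_bigA /=.
rewrite (bigID (fun k => k \in rep @: E_S)) /= addrC big1 ?add0r; last first.
  case=> b [i j] nk; set k : R := (b, (i, j)); rewrite -[(b, (nat_of_ord i, nat_of_ord j))]/(gpos k).
  have [Hk|/hx ->] := boolP (isH (gpos k)); last by rewrite mulr0.
  case/orP: Hk => [/existsP[w /and3P[wS d1 d2]]|/existsP[eps /andP[Ee /eqP /gpos_inj E]]].
    suff -> : ind (D u) (end1 (gpos k)) = ind (D u) (end2 (gpos k)) by rewrite F2D mul0r.
    rewrite /ind; have [<-|ne] := eqVneq w u; first by rewrite d1 d2.
    have no p : D w p -> D u p = false by move=> Dw; apply: contra_neqF ne => Du; exact: Ddisj Dw Du.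
    by rewrite !no.
  by case/negP: nk; rewrite -[X in X \in _]/k -E imset_f.
rewrite big_imset /=; last exact: rep_inj.
by apply: eq_bigr => eps Ee; rewrite -[(_, (_, _))]/(grep eps) -rep_ind.
Qed.

Lemma bd_outside (A : pred pt) x p : supp_in A x -> ~~ A p -> (0 < p.1)%N -> (0 < p.2)%N -> bd x p = 0.
Proof.
case: p => [[|i] [|j]] // sx nA _ _; have z e : (end1 e == (i.+1, j.+1)) || (end2 e == (i.+1, j.+1)) -> x e = 0.
  move=> he; apply: contraNeq nA => /sx /andP[A1 A2].
  by case/orP: he => /eqP <-.
by rewrite /bd /= !z ?addr0 // /end1 /end2 /= eqxx ?orbT.
Qed.

Lemma lift_even (z : G * G -> F) :
  (forall u, u \in S -> \sum_(eps in E_S) ((eps.1 == u)%:R + (eps.2 == u)%:R) * z eps = 0) ->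
  exists x, [/\ forall e, ~~ isH e -> x e = 0, {in E_S, forall eps, x (grep eps) = z eps} &
     forall i j, bd x (i.+1, j.+1) = 0].
Proof.
move=> hz; pose x0 e := \sum_(eps in E_S) z eps * delta (grep eps) e.
have x0r eps : eps \in E_S -> x0 (grep eps) = z eps.
  move=> Ee; rewrite /x0 (bigD1 eps) //= /delta eqxx mulr1 big1 ?addr0 // => e' /andP[Ee' ne].
  case: (eqVneq (grep eps) (grep e')) => [/gpos_inj/(rep_inj Ee Ee') E|_]; last by rewrite mulr0.
  by rewrite E eqxx in ne.
have x0H e : ~~ isH e -> x0 e = 0.
  move=> nH; rewrite /x0 big1 // => eps Ee; rewrite /delta; case: eqP => [E|_]; rewrite ?mulr0 //.
  by case/negP: nH; rewrite E; apply/orP; right; apply/existsP; exists eps; rewrite Ee eqxx.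
have hx u : exists x, u \in S -> supp_in (D u) x /\ forall q, D u q -> bd x q = bd x0 q.
  have [uS|_] := boolP (u \in S); last by exists (fun=> 0).
  have [|x sx bx] := tjoin (tau := bd x0) (@Dint u) (@Dconn u).
    rewrite rep_sum // => [|k /x0H //]; rewrite -[RHS](hz u uS).
    by apply: eq_bigr => eps Ee; rewrite x0r.
  by exists x.
have [X hX] : exists X : G -> ge -> F, forall u, u \in S -> supp_in (D u) (X u) /\ forall q, D u q -> bd (X u) q = bd x0 q.
  by have [X hX] := fin_all_exists hx; exists X.
exists (fun e => x0 e + \sum_(u in S) X u e); split.
- move=> e nH; rewrite x0H // add0r big1 // => u uS; have [sX _] := hX u uS.
  apply: contraNeq nH => /sX /andP[d1 d2]; apply/orP; left; apply/existsP; exists u.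
  by rewrite uS d1 d2.
- move=> eps Ee; rewrite x0r // big1 ?addr0 // => u uS; have [sX _] := hX u uS.
  apply: contraNeq (rep_notinner Ee) => /sX /andP[d1 d2]; apply/existsP; exists u.
  by rewrite uS d1 d2.
move=> i j; set p := (i.+1, j.+1); rewrite bdD bd_sum.
case: (pickP (fun u => (u \in S) && D u p)) => [u /andP[uS Du]|no].
  rewrite (bigD1 u) //= (hX u uS).2 // addrA F2D add0r big1 // => w /andP[wS wu].
  apply: (bd_outside (hX w wS).1) => //; apply: contraNN wu => Dw; apply/eqP; exact: Ddisj Dw Du.
rewrite big1 ?addr0 => [|u uS]; last first.
  by apply: (bd_outside (hX u uS).1) => //; have := no u; rewrite uS => /= ->.
rewrite /x0 bd_sum big1 // => eps Ee; rewrite bdZ bd_delta //.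
have [_ s1 s2 _] := E_SP Ee; have nD v q : v \in S -> D v q -> (q == p) = false.
  by move=> vS Dv; apply/eqP => E; have := no v; rewrite vS -E Dv.
by case: (repP Ee) => -[h1 h2]; rewrite (nD _ _ _ h1) ?(nD _ _ _ h2) // addr0 mulr0.
Qed.

Notation T := ('I_N.+1 * 'I_N.+1)%type.
Definition cpos (c : T) : pt := (c.1 : nat, c.2 : nat).
Definition cl p : T := (inord p.1, inord p.2).
Definition in_range p := (p.1 <= N)%N && (p.2 <= N)%N.

Lemma clK p : in_range p -> cpos (cl p) = p.
Proof. by case: p => i j /andP[hi hj]; rewrite /cpos /cl /= !inordK. Qed.

Definition crel (c d : T) := [exists k : R, ~~ isH (gpos k) &&
  (((side1 (gpos k) == cpos c) && (side2 (gpos k) == cpos d)) ||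
   ((side1 (gpos k) == cpos d) && (side2 (gpos k) == cpos c)))].

Lemma crel_sym : connect_sym crel.
Proof. by apply: sym_connect_sym => c d; apply: eq_existsb => k; rewrite orbC. Qed.

Definition rt p : T := fingraph.root crel (cl p).
Definition face (c : T) : ge -> F := cobd (fun p => (rt p == c)%:R).

Lemma side_range (k : R) : in_range (side1 (gpos k)) /\ in_range (side2 (gpos k)).
Proof.
by case: k => -[] [i j]; rewrite /in_range /side1 /side2 /end2 /=; have := ltn_ord i; have := ltn_ord j; rewrite /N; clear; lia.
Qed.

Lemma face_nonH c (k : R) : ~~ isH (gpos k) -> face c (gpos k) = 0.
Proof.
move=> nH; have [r1 r2] := side_range k; rewrite /face /cobd.
suff -> : rt (side1 (gpos k)) = rt (side2 (gpos k)) by rewrite F2D.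
apply/eqP; rewrite /rt root_connect ?connect1 //; last exact: crel_sym.
by apply/existsP; exists k; rewrite nH !clK // !eqxx.
Qed.

Lemma face_even c u : u \in S ->
  \sum_(eps in E_S) ((eps.1 == u)%:R + (eps.2 == u)%:R) * face c (grep eps) = 0.
Proof.
move=> uS; rewrite -rep_sum //; last exact: face_nonH.
rewrite big1 // => i _; rewrite big1 // => j _; rewrite /ind.
case Du : (D u (i : nat, j : nat)); last by rewrite mul0r.
have [a [b E]] : exists a b, (i : nat, j : nat) = (a.+1, b.+1).
  by have := Dint Du; case: (i : nat) (j : nat) => [|a] [|b] //= h; first [by exists a, b | by rewrite andbF in h].
by rewrite E /face bd_cobd mulr0.
Qed.

(** The lifted cycle is filled by cells. The filling changes only across edges of the cycle, which
    belong to [H], so it is constant on faces and gives the coefficients. *)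
Lemma faces_span (z : G * G -> F) :
  (forall u, u \in S -> \sum_(eps in E_S) ((eps.1 == u)%:R + (eps.2 == u)%:R) * z eps = 0) ->
  exists a : T -> F, {in E_S, forall eps, z eps = \sum_c a c * face c (grep eps)}.
Proof.
move=> /lift_even[x [xH xr bx]]; have [|chi hchi] := fill bx.
  move=> e he; apply: xH; apply/negP => /orP[/existsP[u /and3P[_ /Dint/andP[/andP[h1 _] /andP[h2 _]] _]]|].
    by case: he => E; [rewrite E in h1|rewrite E in h2].
  case/existsP => eps /andP[Ee /eqP E]; have := repP Ee; rewrite /represents -/(grep eps) E.
  by case=> -[] => [/Dint/andP[/andP[h1 _] /andP[h2 _]] _|_ /Dint/andP[/andP[h1 _] /andP[h2 _]]];
    case: he => E'; [rewrite E' in h1|rewrite E' in h2|rewrite E' in h1|rewrite E' in h2].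
pose a c := chi (cpos c); exists a => eps Ee.
have const c d : connect crel c d -> a c = a d.
  case/connectP => s; elim: s c => [|b s IH] c /=; first by move=> _ ->.
  case/andP => /existsP[k /andP[nH hs]] ps E; rewrite -(IH b ps E).
  have := hchi (gpos k); rewrite xH // /cobd => /esym/F2_eq.
  by rewrite /a; case/orP: hs => /andP[/eqP -> /eqP ->].
have arep p : in_range p -> chi p = a (rt p).
  by move=> hp; rewrite -(const _ _ (connect_root _ _)) /a clK.
rewrite -xr // hchi /cobd /face; have [r1 r2] := side_range (rep eps).
rewrite !arep //; under eq_bigr => c _ do rewrite mulrDr.
have S1 p : \sum_c a c * (rt p == c)%:R = a (rt p).
  by rewrite (bigD1 (rt p)) //= eqxx mulr1 big1 ?addr0 // => c; rewrite eq_sym => /negbTE ->; rewrite mulr0.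
by rewrite big_split /= !S1.
Qed.

Definition faces : {set T} := [set c | [exists eps in E_S, face c (grep eps) != 0]].

Lemma faces_two eps : (#|[set c | (face c (grep eps) != 0)%R]| <= 2)%N.
Proof.
apply: leq_trans (_ : #|[set rt (side1 (grep eps)); rt (side2 (grep eps))]| <= 2)%N; last first.
  by rewrite cards2; case: (_ == _).
apply/subset_leq_card/subsetP => c; rewrite !inE /face /cobd; apply: contraR; rewrite negb_or.
by rewrite !(eq_sym c) => /andP[/negbTE -> /negbTE ->].
Qed.

Lemma faces_sum eps : \sum_c face c (grep eps) = 0.
Proof.
rewrite /face /cobd big_split /=; have S1 p : \sum_c (rt p == c)%:R = 1 :> F.
  by rewrite (bigD1 (rt p)) //= eqxx big1 ?addr0 // => c; rewrite eq_sym => /negbTE ->.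
by rewrite !S1 F2D.
Qed.

Lemma rank_ones (m : nat) : (0 < m)%N -> \rank (const_mx 1 : 'M[F]_(1, m)) = 1%N.
Proof.
case: m => // m _; apply/eqP; rewrite eqn_leq rank_leq_row lt0n mxrank_eq0; apply/eqP => /matrixP/(_ 0 0).
by rewrite !mxE.
Qed.

(** A rank count. The incidence matrix [M] kills the all-ones vector, so its rank is at most
    [#|S| - 1]. Its kernel lies in the span of the face boundaries; these have sum 0, so their rank
    is at most [#|faces| - 1], or 0 without faces. *)
Lemma edges_faces : S != set0 ->
  (#|E_S| < #|S|)%N \/ ((0 < #|faces|)%N /\ (#|E_S| + 2 <= #|S| + #|faces|)%N).
Proof.
move=> S0; have Sp : (0 < #|S|)%N by rewrite card_gt0.
pose M : 'M[F]_(#|E_S|, #|S|) := \matrix_(i, j)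
  (((enum_val i).1 == enum_val j)%:R + ((enum_val i).2 == enum_val j)%:R).
pose B : 'M[F]_(#|faces|, #|E_S|) := \matrix_(k, i) face (enum_val k) (grep (enum_val i)).
have rM : (\rank M + 1 <= #|S|)%N.
  have M0 : M *m (const_mx 1 : 'M[F]_(1, #|S|))^T = 0.
    apply/matrixP => i j; rewrite !mxE; under eq_bigr => k _ do rewrite !mxE mulr1.
    have [_ s1 s2 _] := E_SP (enum_valP i).
    have S1 u : u \in S -> \sum_(k < #|S|) (u == enum_val k)%:R = 1 :> F.
      move=> uS; rewrite -(big_enum_val (fun v => (u == v)%:R)) /= (bigD1 u) //= eqxx.
      by rewrite big1 ?addr0 // => v /andP[_]; rewrite eq_sym => /negbTE ->.
    by rewrite big_split /= !S1 // F2D.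
  by have := mulmx0_rank_max M0; rewrite mxrank_tr rank_ones.
have KB : (kermx M <= B)%MS.
  apply/row_subP => r; set zr := row r (kermx M).
  have zM : zr *m M = 0 by apply/sub_kermxP; exact: row_sub.
  (* The row vector read as a function on all pairs, with default value 0 outside [E_S]. *)
  pose z eps : F := if @idP (eps \in E_S) is ReflectT h then zr 0 (enum_rank_in h eps) else 0.
  have zE i : z (enum_val i) = zr 0 i.
    by rewrite /z; case: {-}_ / idP => [h|/(_ (enum_valP i)) //]; rewrite enum_valK_in.
  have [u uS|a ha] := faces_span (z := z).
    have := congr1 (fun A : 'M[F]_(1, #|S|) => A 0 (enum_rank_in uS u)) zM; rewrite !mxE => E.
    rewrite -[RHS]E (big_enum_val (fun eps => ((eps.1 == u)%:R + (eps.2 == u)%:R) * z eps)) /=.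
    by apply: eq_bigr => i _; rewrite zE [M _ _]mxE enum_rankK_in // mulrC.
  have -> : zr = (\row_k a (enum_val k)) *m B.
    apply/rowP => i; rewrite -zE ha ?enum_valP // [RHS]mxE.
    under [RHS]eq_bigr => k _ do rewrite !mxE.
    rewrite -(big_enum_val (fun c => a c * face c (grep (enum_val i)))) /=.
    rewrite [RHS]big_mkcond /=; apply: eq_bigr => c _; case: ifP => // /negbT; rewrite inE => /existsPn/(_ (enum_val i)).
    by rewrite enum_valP /= negbK => /eqP ->; rewrite mulr0.
  exact: submxMl.
have rK := mxrankS KB; rewrite mxrank_ker in rK.
have [K0|K0] := posnP #|faces|.
  by left; have rB := rank_leq_row B; move: rB K0 rK rM; clear; lia.
right; split=> //; have B0 : (const_mx 1 : 'M[F]_(1, #|faces|)) *m B = 0.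
  apply/matrixP => i j; rewrite !mxE; under eq_bigr => k _ do rewrite !mxE mul1r.
  rewrite -(big_enum_val (fun c => face c (grep (enum_val j)))) /=.
  rewrite -[RHS](faces_sum (enum_val j)) [LHS]big_mkcond /=; apply: eq_bigr => c _.
  case: ifP => // /negbT; rewrite inE => /existsPn/(_ (enum_val j)).
  by rewrite enum_valP /= negbK => /eqP ->.
by have := mulmx0_rank_max B0; rewrite rank_ones //; move: rK rM; clear; lia.
Qed.

Lemma face_large c : girth_at_least G 10 -> c \in faces ->
  (10 <= #|[set eps in E_S | (face c (grep eps) != 0)%R]|)%N.
Proof.
move=> hg; rewrite inE => /existsP[e0 /andP[Ee0 ne0]]; apply: even_edges_girth => //.
- by apply/subsetP => e; rewrite inE => /andP[]; rewrite inE => /andP[].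
- by apply/set0Pn; exists e0; rewrite inE Ee0.
move=> u; have [uS|uS] := boolP (u \in S); last first.
  rewrite big1 // => e; rewrite inE => /andP[/E_SP[_ s1 s2 _] _].
  have E v : v \in S -> (v == u) = false by move=> vS; apply: contraNF uS => /eqP <-.
  by rewrite !E // addr0.
rewrite -[RHS](face_even c uS) [RHS](bigID (fun eps => face c (grep eps) != 0)) /=.
rewrite [X in _ = _ + X]big1 ?addr0 => [|e /andP[_]]; last by rewrite negbK => /eqP ->; rewrite mulr0.
apply: eq_big => [e|e]; first by rewrite inE.
by rewrite inE => /andP[_]; case: (F2P (face c (grep e))) => ->; rewrite ?eqxx ?mulr1.
Qed.

Lemma faces_edges : girth_at_least G 10 -> (10 * #|faces| <= 2 * #|E_S|)%N.
Proof.
move=> hg; pose P c eps := (eps \in E_S) && (face c (grep eps) != 0).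
apply: (@leq_trans (\sum_(c in faces) \sum_(eps in E_S) (face c (grep eps) != 0)%R)%N).
  rewrite mulnC -sum_nat_const; apply: leq_sum => c cF; apply: leq_trans (face_large hg cF) _.
  rewrite -sum1_card big_mkcond [leqRHS]big_mkcond /=; apply: leq_sum => e _; rewrite inE.
  by case: (e \in E_S); case: (_ != 0).
rewrite exchange_big /= mulnC -sum_nat_const; apply: leq_sum => e _; apply: leq_trans (faces_two e).
rewrite -sum1_card big_mkcond [leqRHS]big_mkcond /=; apply: leq_sum => c _.
by case: (c \in faces); rewrite // inE; case: (_ != 0).
Qed.

End Euler.

(** With [k > 0] faces, [e + 2 <= |S| + k] and [10 k <= 2 e] give [4 e + 10 <= 5 |S|]; without
    faces, [e < |S|] gives [4 e + |S| + 4 <= 5 |S|]. *)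
Theorem grid_minor_sparse (G : sgraph) n (D : G -> pred pt) (S : {set G}) :
  (forall u, in_grid n.+1 (D u)) -> (forall u, gconn (D u)) ->
  (forall u v p, D u p -> D v p -> u = v) ->
  (forall u v, edge u v -> exists p q, [/\ D u p, D v q & adj p q]) ->
  girth_at_least G 10 -> S != set0 -> (4 * edges_in S + minn 10 (#|S| + 4) <= 5 * #|S|)%N.
Proof.
move=> Dint Dconn Ddisj Dadj hg S0; have [rep repP] := representatives S Dint Dadj.
have := faces_edges Dint Ddisj repP hg.
have := edges_faces Dint Dconn Ddisj repP S0; rewrite -[edges_in S]/#|E_S S|.
by move: #|E_S S| #|faces _ _ _| => e k; lia.
Qed.

From mathcomp Require Import all_classical all_reals all_analysis.
Import numFieldNormedType.Exports.
Local Open Scope classical_set_scope.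
Local Open Scope ring_scope.

(** * From plane drawings to connected sets in a grid *)

Inductive reach (A : pt -> Prop) (p : pt) : pt -> Prop :=
| reach_refl : A p -> reach A p p
| reach_step q r : reach A p q -> adj q r -> A r -> reach A p r.

Lemma adjC p q : adj p q = adj q p.
Proof.
rewrite /adj (eq_sym q.1 p.1) (eq_sym q.2 p.2).
by congr ((_ && _) || (_ && _)); exact: orbC.
Qed.

Lemma reach_end A p q : reach A p q -> A q.
Proof. by case. Qed.

Lemma reach_trans A p q r : reach A p q -> reach A q r -> reach A p r.
Proof. by move=> pq; elim=> [//|r' s _ IH rs As]; apply: reach_step IH rs As. Qed.

Lemma reach_sub (A B : pt -> Prop) p q : (forall r, A r -> B r) -> reach A p q -> reach B p q.
Proof.
move=> AB; elim=> [/AB Bp|r s _ IH rs As]; first exact: reach_refl.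
by apply: reach_step IH rs _; apply: AB.
Qed.

Lemma reach_sym A p q : reach A p q -> reach A q p.
Proof.
elim=> [Ap|r s pr IH rs As]; first exact: reach_refl.
apply: reach_trans IH; apply: reach_step (reach_refl As) _ (reach_end pr).
by rewrite adjC.
Qed.

Lemma reach_path (A : pt -> Prop) p q : reach A p q ->
  exists s, [/\ path adj p s, last p s = q & forall r, r \in s -> A r].
Proof.
elim=> [Ap|r t _ [s [ps ls As]] rt At]; first by exists [::].
exists (rcons s t); split; rewrite ?last_rcons ?rcons_path ?ps ?ls //.
by move=> x; rewrite mem_rcons inE => /orP[/eqP -> //|/As].
Qed.

Lemma reach_exit (A X : pt -> Prop) p q : reach A p q -> X p -> ~ X q ->
  exists x y, [/\ A x /\ X x, A y /\ ~ X y & adj x y].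
Proof.
move=> + Xp; elim=> [//|r s pr IH rs As nXs].
have [Xr|nXr] := pselect (X r); last exact: IH.
by exists r, s; split=> //; split=> //; exact: reach_end pr.
Qed.

(** * Disjoint connected sets from stars [S u] and middles [M u v] of edges *)

Section Minor.
Variables (G : sgraph) (n : nat) (S : G -> pt -> Prop) (M : G -> G -> pt -> Prop).
Hypothesis S_conn : forall u p q, S u p -> S u q -> reach (S u) p q.
Hypothesis M_conn : forall u v p q, edge u v -> M u v p -> M u v q -> reach (M u v) p q.
Hypothesis SM1 : forall u v, edge u v -> exists p, S u p /\ M u v p.
Hypothesis SM2 : forall u v, edge u v -> exists p, S v p /\ M u v p.
Hypothesis SS : forall u v p, S u p -> S v p -> u = v.
Hypothesis SM : forall u v w p, edge u v -> S w p -> M u v p -> w = u \/ w = v.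
Hypothesis MM : forall u v x y p, edge u v -> edge x y -> M u v p -> M x y p ->
  (u = x /\ v = y) \/ (u = y /\ v = x).
Hypothesis S_in : forall u p, S u p -> (0 < p.1 < n)%N && (0 < p.2 < n)%N.
Hypothesis M_in : forall u v p, edge u v -> M u v p -> (0 < p.1 < n)%N && (0 < p.2 < n)%N.

Let fwd (u v : G) := edge u v /\ (enum_rank u < enum_rank v)%N.
Let rest u v p := M u v p /\ ~ S v p.
(* The part of the middle of uv that is joined to the star of u before
   reaching the star of v. *)
Let C u v p := exists2 r, S u r & reach (rest u v) r p.
Let Dp u p := S u p \/ exists2 v, fwd u v & C u v p.

Let CM u v p : C u v p -> rest u v p.
Proof. by case=> r _ /reach_end. Qed.

Let D_disj u v p : Dp u p -> Dp v p -> u = v.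
Proof.
have SC a b c : fwd b c -> S a p -> C b c p -> a = b.
  by move=> [e _] Sa /CM[Mp nS]; have [//|E] := SM e Sa Mp; rewrite E in Sa.
case=> [Su|[a fa Ca]] [Sv|[b fb Cb]].
- exact: SS Su Sv.
- exact: SC fb Su Cb.
- by apply/esym; exact: SC fa Sv Ca.
- have [[ea ra] [eb rb]] := (fa, fb); have [[Ma _] [Mb _]] := (CM Ca, CM Cb).
  have [[-> //]|[E1 E2]] := MM ea eb Ma Mb.
  by move: ra rb; rewrite E1 E2; lia.
Qed.

Let D_conn1 u p : Dp u p -> exists2 r, S u r & reach (Dp u) r p.
Proof.
case=> [Sp|[v fv [r Sr rp]]]; first by exists p => //; apply: reach_refl; left.
exists r => //; have : forall q, reach (rest u v) r q -> reach (Dp u) r q.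
  move=> q; elim=> [_|s t rs IH st rt]; first by apply: reach_refl; left.
  apply: (reach_step IH st); right; exists v => //; exists r => //.
  exact: (reach_step rs st rt).
exact.
Qed.

(** For [u] of smaller rank, a walk through the middle of [uv] starts in the star of [u] and ends in
    the star of [v]. The first step leaving the set of [u] must enter the star of [v], as any other
    point of the middle would have joined the set of [u]; this step is the required adjacency. *)
Theorem minor_of_pieces : exists D : G -> pred pt,
  [/\ forall u, in_grid n (D u), forall u, gconn (D u), forall u v p, D u p -> D v p -> u = v &
   forall u v, edge u v -> exists p q, [/\ D u p, D v q & adj p q]].
Proof.
exists (fun u p => `[< Dp u p >]); split.
- move=> u p /asboolP [/S_in //|[v [e _] /CM[/(M_in e) //]]].
- move=> u p q /asboolP /D_conn1[a Sa ap] /asboolP /D_conn1[b Sb bq].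
  have [|s [ps ls As]] := @reach_path (Dp u) p q.
    apply: reach_trans (reach_sym ap) _; apply: reach_trans bq.
    by apply: reach_sub (S_conn Sa Sb) => r Sr; left.
  by exists s; split=> //; apply/allP => r /As h; apply/asboolP.
- by move=> u v p /asboolP h1 /asboolP; exact: D_disj.
have main u v : fwd u v -> exists p q, [/\ Dp u p, Dp v q & adj p q].
  move=> fv; have [e _] := fv; have [p [Sp Mp]] := SM1 e; have [q [Sq Mq]] := SM2 e.
  have uv : u <> v by move=> E; move: e; rewrite E edge_irrefl.
  have [||x [y [[Mx Dx] [My nDy] xy]]] := reach_exit (X := Dp u) (M_conn e Mp Mq).
  - by left.
  - by move=> Dq; apply: uv; apply: D_disj Dq _; left.
  exists x, y; split=> //; left; have [//|nSy] := pselect (S v y); case: nDy.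
  right; exists v => //; case: Dx => [Sx|[w fw Cx]].
    exists x => //; apply: (@reach_step _ _ x) => //; apply: reach_refl; split=> // Sx'.
    exact: uv (SS Sx Sx').
  have [Mx' _] := CM Cx; have [[_ E]|[E _]] := MM fw.1 e Mx' Mx; last by case: uv.
  rewrite E in Cx; case: Cx => r Sr rx; exists r => //.
  exact: (reach_step rx xy).
move=> u v e; have ne : enum_rank u <> enum_rank v.
  by move=> /enum_rank_inj E; rewrite E edge_irrefl in e.
case: (ltngtP (enum_rank u) (enum_rank v)) => [lt|lt|/val_inj //].
  have [//|p [q [h1 h2 h3]]] := main u v; exists p, q; split=> //; exact/asboolP.
have [|p [q [h1 h2 h3]]] := main v u; first by split; rewrite // edge_sym.
by exists q, p; split; [exact/asboolP|exact/asboolP|rewrite adjC].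
Qed.

End Minor.

(** * Compactness arguments for plane curves *)

Section Real.
Variable R : realType.
Implicit Types (s t e : R) (f g : R -> R * R).

(** Compactness of the interval as continuous induction: the supremum of the [t] with [P a t]
    satisfies [P a] as well, and cannot lie below [b]. *)
Lemma creeping (P : R -> R -> Prop) a b : a <= b ->
  (forall x y z, x <= y -> y <= z -> P x y -> P y z -> P x z) ->
  (forall t, a <= t <= b -> exists2 e, 0 < e & forall x y, a <= x -> y <= b -> x <= t -> t <= y ->
     t - x < e -> y - t < e -> P x y) -> P a b.
Proof.
move=> ab Ptr Ploc; pose S : set R := [set t | a <= t <= b /\ P a t].
have Sa : S a.
  split; first by rewrite lexx.
  have [|e e0 he] := Ploc a; first by rewrite lexx.
  by apply: he; rewrite // subrr.
have S0 : S !=set0 by exists a.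
have hS : has_sup S by split=> //; exists b => t [/andP[]].
have cb : sup S <= b by apply: ge_sup => // t [/andP[]].
have ac : a <= sup S by apply: ub_le_sup => //; case: hS.
have [|e e0 he] := Ploc (sup S); first by rewrite ac.
have [t [/andP[at_ tb] Pt] tc] := sup_adherent e0 hS.
have tS : t <= sup S by apply: ub_le_sup; [case: hS | split; rewrite ?at_].
have Pay y : sup S <= y -> y <= b -> y - sup S < e -> P a y.
  move=> cy yb ye; apply: Ptr Pt _ => //; first exact: le_trans cy.
  by apply: he => //; lra.
have [lt|ge] := ltP (sup S) b; last by apply: Pay => //; lra.
pose y := Num.min b (sup S + e / 2).
have yb : y <= b by rewrite ge_min lexx.
have ye : y <= sup S + e / 2 by rewrite ge_min lexx orbT.
have cy : sup S < y by rewrite lt_min lt; lra.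
have : y <= sup S.
  apply: ub_le_sup; first by case: hS.
  by split; [lra | apply: Pay => //; lra].
by rewrite leNgt cy.
Qed.

Definition near2 e (p q : R * R) := (`|p.1 - q.1| < e) && (`|p.2 - q.2| < e).

Lemma within_near f a b : {within `[a, b], continuous f} -> forall t, a <= t <= b -> forall e, 0 < e ->
  exists2 d, 0 < d & forall s, a <= s <= b -> `|t - s| < d -> near2 e (f t) (f s).
Proof.
move=> /subspace_continuousP cf t tab e e0.
have : `[a, b]%classic t by rewrite /= in_itv.
move=> /cf cft; have nb : nbhs (f t) (ball (f t) e) by exact: nbhsx_ballx.
have /nbhs_ballP[d /= d0 hd] := cft _ nb; exists d => // s sab ts.
have [||h1 h2] := hd s; rewrite /ball /= ?in_itv //.
by rewrite /near2 h1 h2.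
Qed.

Lemma near2C e p q : near2 e p q = near2 e q p.
Proof. by rewrite /near2 !(distrC p.1) !(distrC p.2). Qed.

Lemma near2_le e e' p q : e <= e' -> near2 e p q -> near2 e' p q.
Proof. by move=> ee /andP[h1 h2]; rewrite /near2 !(lt_le_trans _ ee). Qed.

Lemma near2_trans e e' p q r : near2 e p q -> near2 e' q r -> near2 (e + e') p r.
Proof.
move=> /andP[h1 h2] /andP[h3 h4]; apply/andP; split.
  by apply: le_lt_trans (ler_distD q.1 _ _) _; apply: ltrD.
by apply: le_lt_trans (ler_distD q.2 _ _) _; apply: ltrD.
Qed.

Lemma near2_neq (p q : R * R) : p <> q -> exists2 e, 0 < e & ~~ near2 e p q.
Proof.
move=> pq; case: (eqVneq p.1 q.1) => [E1|n1].
  have n2 : p.2 != q.2 by apply: contra_notN pq => /eqP E2; rewrite [p]surjective_pairing [q]surjective_pairing E1 E2.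
  by exists `|p.2 - q.2|; rewrite ?normr_gt0 ?subr_eq0 // /near2 ltxx andbF.
by exists `|p.1 - q.1|; rewrite ?normr_gt0 ?subr_eq0 // /near2 ltxx.
Qed.

Section Curves.
Variables (f : R -> R * R) (a b : R).
Hypothesis ab : a <= b.
Hypothesis cf : forall t, a <= t <= b -> forall e, 0 < e ->
  exists2 d, 0 < d & forall s, a <= s <= b -> `|t - s| < d -> near2 e (f t) (f s).

Lemma curve_bounded : exists B, forall t, a <= t <= b -> `|(f t).1| <= B /\ `|(f t).2| <= B.
Proof.
suff : exists B, forall t, a <= t <= b -> `|(f t).1| <= B /\ `|(f t).2| <= B by [].
pose P x y := exists B, forall t, a <= t <= b -> x <= t <= y -> `|(f t).1| <= B /\ `|(f t).2| <= B.
have [B hB] : P a b; last by exists B => t tab; exact: hB.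
apply: creeping => //.
- move=> x y z xy yz [B1 h1] [B2 h2]; exists (Num.max B1 B2) => t tab /andP[xt tz].
  rewrite !le_max; have [ty|yt] := leP t y.
    by have [|-> ->] := h1 t tab; rewrite ?xt.
  by have [|-> ->] := h2 t tab; rewrite ?tz ?(ltW yt) // !orbT.
- move=> t tab; have [d d0 hd] := cf tab ltr01; exists d => // x y ax yb xt ty tx yt.
  exists (Num.max `|(f t).1| `|(f t).2| + 1) => s sab /andP[xs sy].
  have /andP[h1 h2] : near2 1 (f t) (f s) by apply: hd => //; rewrite ltr_norml; apply/andP; split; lra.
  have m1 : `|(f t).1| <= Num.max `|(f t).1| `|(f t).2| by rewrite le_max lexx.
  have m2 : `|(f t).2| <= Num.max `|(f t).1| `|(f t).2| by rewrite le_max lexx orbT.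
  have e1 := ler_normD (f t).1 ((f s).1 - (f t).1); have e2 := ler_normD (f t).2 ((f s).2 - (f t).2).
  rewrite !subrKC in e1 e2; rewrite distrC in h1; rewrite distrC in h2; split; lra.
Qed.

Variables (g : R -> R * R) (c d : R).
Hypothesis cd : c <= d.
Hypothesis cg : forall t, c <= t <= d -> forall e, 0 < e ->
  exists2 d', 0 < d' & forall s, c <= s <= d -> `|t - s| < d' -> near2 e (g t) (g s).

(** Disjoint compact curves have positive distance: creeping along [f], where the local claim at a
    point of [f] is proved by creeping along [g]. *)
Lemma curves_apart : (forall s t, a <= s <= b -> c <= t <= d -> f s <> g t) ->
  exists2 e, 0 < e & forall s t, a <= s <= b -> c <= t <= d -> ~~ near2 e (f s) (g t).
Proof.
move=> hfg; pose P x y := exists2 e, 0 < e & forall s t, a <= s <= b -> x <= s <= y -> c <= t <= d -> ~~ near2 e (f s) (g t).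
have [e e0 he] : P a b; last by exists e => // s t sab; apply: he.
apply: creeping => //.
  move=> x y z xy yz [e1 e10 h1] [e2 e20 h2]; exists (Num.min e1 e2); first by rewrite lt_min e10.
  move=> s t sab /andP[xs sz] tcd; have [sy|ys] := leP s y.
    by apply: contraNN (h1 s t sab _ tcd); rewrite ?xs //; apply: near2_le; rewrite ge_min lexx.
  by apply: contraNN (h2 s t sab _ tcd); rewrite ?sz ?(ltW ys) //; apply: near2_le; rewrite ge_min lexx orbT.
move=> s0 s0ab.
pose P2 x y := exists2 e, 0 < e & forall s t, a <= s <= b -> `|s0 - s| < e -> c <= t <= d -> x <= t <= y -> ~~ near2 e (f s) (g t).
have [e e0 he] : P2 c d.
  apply: creeping => //.
    move=> x y z xy yz [e1 e10 h1] [e2 e20 h2]; exists (Num.min e1 e2); first by rewrite lt_min e10.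
    move=> s t sab; rewrite lt_min => /andP[s1 s2] tcd /andP[xt tz].
    have [ty|yt] := leP t y.
      by apply: contraNN (h1 s t sab s1 tcd _); rewrite ?xt //; apply: near2_le; rewrite ge_min lexx.
    by apply: contraNN (h2 s t sab s2 tcd _); rewrite ?tz ?(ltW yt) //; apply: near2_le; rewrite ge_min lexx orbT.
  move=> t0 t0cd; have [e e0 ne] := near2_neq (hfg _ _ s0ab t0cd).
  have e3 : 0 < e / 3 by rewrite divr_gt0.
  have [d1 d10 h1] := cf s0ab e3; have [d2 d20 h2] := cg t0cd e3.
  exists d2 => // x y _ _ xt ty tx yt; exists (Num.min d1 (e / 3)); first by rewrite lt_min d10.
  move=> s t sab; rewrite lt_min => /andP[s1 _] tcd /andP[xt' ty'].
  apply: contraNN ne => nst; have -> : e = e / 3 + (e / 3 + e / 3) by field.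
  apply: near2_trans (h1 s sab s1) _; apply: near2_trans (_ : near2 _ _ (g t)) _.
    by apply: near2_le nst; rewrite ge_min lexx orbT.
  by rewrite near2C; apply: h2 => //; rewrite ltr_norml; apply/andP; split; lra.
exists e => // x y ax yb xs sy sx ys; exists e => // s t sab /andP[xs' sy'] tcd.
by apply: he => //; rewrite ltr_norml; apply/andP; split; lra.
Qed.

End Curves.

(* Grid points at distance less than 1: the corners of the cell of p. *)
Definition corner (p : R * R) (q : pt) := near2 1 p (q.1%:R, q.2%:R).

Lemma corner_ex p : 0 <= p.1 -> 0 <= p.2 -> exists q, corner p q.
Proof.
move=> /truncn_itv/andP[a1 a2] /truncn_itv/andP[b1 b2]; exists (Num.truncn p.1, Num.truncn p.2).
rewrite /corner /near2 /= -natr1 in a2 b2 *; rewrite !ltr_norml; apply/andP; split; apply/andP; split; lra.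
Qed.

Lemma corner_reach p q r : corner p q -> corner p r -> reach (corner p) q r.
Proof.
case: q r => [i j] [k l]; rewrite /corner /near2 /= => /andP[h1 h2] /andP[h3 h4].
have close (x : R) (m m' : nat) : `|x - m%:R| < 1 -> `|x - m'%:R| < 1 -> [\/ m = m', m' = m.+1 | m = m'.+1].
  rewrite !ltr_norml => /andP[u1 u2] /andP[u3 u4].
  have v1 : (m%:R : R) < (m'.+2)%:R by rewrite -!natr1; lra.
  have v2 : (m'%:R : R) < (m.+2)%:R by rewrite -!natr1; lra.
  move: v1 v2; rewrite !ltr_nat => v1 v2.
  have : (m = m' \/ m' = m.+1 \/ m = m'.+1)%N by lia.
  by case=> [->|[->|->]]; [apply: Or31|apply: Or32|apply: Or33].
have R1 : reach (corner p) (i, j) (i, j) by apply: reach_refl; rewrite /corner /near2 /= h1 h2.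
have R2 : reach (corner p) (i, j) (k, j).
  have C : corner p (k, j) by rewrite /corner /near2 /= h3 h2.
  case: (close _ _ _ h1 h3) => E; first by rewrite -E.
    by apply: (reach_step R1) C; rewrite /adj /= E !eqxx orbT.
  by apply: (reach_step R1) C; rewrite /adj /= E !eqxx !orbT.
have C : corner p (k, l) by rewrite /corner /near2 /= h3 h4.
case: (close _ _ _ h2 h4) => E; first by rewrite -E.
  by apply: (reach_step R2) C; rewrite /adj /= E !eqxx.
by apply: (reach_step R2) C; rewrite /adj /= E !eqxx !orbT.
Qed.

(** Being a corner is an open condition, so nearby points of the curve share a corner, and the
    corners of one point are connected by [corner_reach]. *)
Lemma curve_reach f a b : a <= b ->
  (forall t, a <= t <= b -> 0 <= (f t).1 /\ 0 <= (f t).2) ->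
  (forall t, a <= t <= b -> forall e, 0 < e ->
    exists2 d, 0 < d & forall s, a <= s <= b -> `|t - s| < d -> near2 e (f t) (f s)) ->
  let A q := exists2 t, a <= t <= b & corner (f t) q in
  forall p q, A p -> A q -> reach A p q.
Proof.
move=> ab pos cf A.
have sub t q r : a <= t <= b -> corner (f t) q -> corner (f t) r -> reach A q r.
  by move=> tab cq cr; apply: reach_sub (corner_reach cq cr) => x cx; exists t.
pose P x y := forall q r, a <= x -> y <= b -> corner (f x) q -> corner (f y) r -> reach A q r.
have main x y : a <= x -> x <= y -> y <= b -> P x y.
  move=> ax xy yb; apply: creeping => //.
    move=> x' y' z' xy' yz' h1 h2 q r ax' zb' cq cr.
    have [] := pos y'; first by apply/andP; split; lra.
    move=> p1 p2; have [w cw] := corner_ex p1 p2.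
    by apply: reach_trans (h1 q w ax' _ cq cw) (h2 w r _ zb' cw cr); lra.
  move=> t /andP[xt ty]; have tab : a <= t <= b by apply/andP; split; lra.
  have [p1 p2] := pos t tab; have [w cw] := corner_ex p1 p2.
  have [e e0 he] : exists2 e, 0 < e & forall p', near2 e (f t) p' -> corner p' w.
    move: cw => /andP[/= c1 c2]; pose m := Num.max `|(f t).1 - w.1%:R| `|(f t).2 - w.2%:R|.
    have m1 : `|(f t).1 - w.1%:R| <= m by rewrite le_max lexx.
    have m2 : `|(f t).2 - w.2%:R| <= m by rewrite le_max lexx orbT.
    have m3 : m < 1 by rewrite gt_max c1.
    exists (1 - m); first by lra.
    move=> p' np; apply: (@near2_le (1 - m + m)); first by lra.
    rewrite near2C in np; case/andP: np => n1 n2; rewrite /near2 /=.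
    by apply/andP; split; [apply: le_lt_trans (ler_distD (f t).1 _ _) (ltr_leD n1 m1)|apply: le_lt_trans (ler_distD (f t).2 _ _) (ltr_leD n2 m2)].
  have [d d0 hd] := cf t tab e e0; exists d => // x' y' xx' yy' xt' ty' tx' yt' q r ax' yb' cq cr.
  have xab : a <= x' <= b by apply/andP; split; lra.
  have yab : a <= y' <= b by apply/andP; split; lra.
  have cx : corner (f x') w by apply: he; apply: hd => //; rewrite ltr_norml; apply/andP; split; lra.
  have cy : corner (f y') w by apply: he; apply: hd => //; rewrite ltr_norml; apply/andP; split; lra.
  exact: reach_trans (sub x' q w xab cq cx) (sub y' w r yab cy cr).
move=> p q [s sab cp] [t tab cq]; have [/andP[a_s sb] /andP[at' tb]] := (sab, tab).
have [st|ts] := leP s t; first exact: (main s t a_s st tb).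
by apply: reach_sym; apply: (main t s) => //; exact: ltW.
Qed.

Lemma fin_eventually (T : finType) (P : T -> nat -> Prop) :
  (forall x, exists k, forall m, (k <= m)%N -> P x m) -> exists k, forall m, (k <= m)%N -> forall x, P x m.
Proof.
move=> /choice[K hK]; exists (\max_x K x)%N => m km x; apply: hK.
by apply: leq_trans km; exact: (@leq_bigmax _ (fun x => K x)).
Qed.

(** * Choosing the grid for a plane drawing *)

Section Drawing.
Variables (G : sgraph) (pos : G -> R * R) (arc : G -> G -> R -> R * R).
Hypothesis PD : plane_drawing pos arc.

(** The parameters stay below 1, so the far ends are not involved; the last third of an arc is
    treated as the first third of the reversed arc. *)
Lemma arc_meet u v x y s t : edge u v -> edge x y -> 0 <= s < 1 -> 0 <= t < 1 -> arc u v s = arc x y t ->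
  [/\ s = 0, t = 0 & u = x] \/ [/\ 0 < s, 0 < t & [/\ u = x, v = y & s = t] \/ [/\ u = y, v = x & s = 1 - t]].
Proof.
move=> uv xy /andP[s0 s1] /andP[t0 t1] E.
have [sz|sn] := eqVneq s 0; have [tz|tn] := eqVneq t 0.
- by left; split=> //; apply: (pos_inj PD); rewrite -(arc_start PD uv) -(arc_start PD xy) -[in LHS]sz -[in RHS]tz.
- have ti : t \in `]0, 1[ by rewrite in_itv /= lt_def tn t0.
  by case: (arc_avoids_vertices PD (w := u) xy ti); rewrite -E sz (arc_start PD uv).
- have si : s \in `]0, 1[ by rewrite in_itv /= lt_def sn s0.
  by case: (arc_avoids_vertices PD (w := x) uv si); rewrite E tz (arc_start PD xy).
have sp : 0 < s by rewrite lt_def sn.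
have tp : 0 < t by rewrite lt_def tn.
have sI : s \in `[0, 1] by rewrite in_itv /= s0 ltW.
have tI : t \in `[0, 1] by rewrite in_itv /= t0 ltW.
right; split=> //; have [[E1 E2]|n1] := pselect ((u, v) = (x, y)).
  by left; split=> //; subst x y; exact: (arc_inj PD uv).
have [[E1 E2]|n2] := pselect ((u, v) = (y, x)).
  right; split=> //; subst x y; apply: (arc_inj PD uv) => //; last by rewrite -(arc_rev PD).
  by rewrite in_itv /=; apply/andP; split; lra.
by case: (arc_disjoint PD uv xy n1 n2 _ _ E); rewrite in_itv /= ?sp ?tp.
Qed.

Lemma arc_within u v : edge u v -> forall t, 0 <= t <= 1 -> forall e, 0 < e ->
  exists2 d, 0 < d & forall s, 0 <= s <= 1 -> `|t - s| < d -> near2 e (arc u v t) (arc u v s).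
Proof. by move=> uv; apply: within_near; exact: (arc_continuous PD). Qed.

(** The index [false] stands for the first third of an arc, a ray of the star at its start, and
    [true] for the middle third. *)
Let lo (b : bool) : R := if b then 3^-1 else 0.
Let hi (b : bool) : R := if b then 2 / 3 else 3^-1.

Let lohi b : lo b <= hi b.
Proof. by rewrite /lo /hi; case: b; lra. Qed.

Let lohi01 b t : lo b <= t <= hi b -> 0 <= t <= 1.
Proof. by rewrite /lo /hi; case: b => /andP[h1 h2]; apply/andP; split; lra. Qed.

Let lohi01' b t : lo b <= t <= hi b -> 0 <= t < 1.
Proof. by rewrite /lo /hi; case: b => /andP[h1 h2]; apply/andP; split; lra. Qed.

(** The drawing is moved into the first quadrant by [B] and enlarged by [k]; adding 1 keeps all
    corners off the axes. *)
Let scale (k B : nat) (p : R * R) := (k%:R * (p.1 + B%:R) + 1, k%:R * (p.2 + B%:R) + 1).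

Let scale_near (k B : nat) e p q : (0 < k)%N -> near2 e (scale k B p) (scale k B q) = near2 (e / k%:R) p q.
Proof.
move=> k0; have k0' : 0 < k%:R :> R by rewrite ltr0n.
have E (x y : R) : (`|k%:R * (x + B%:R) + 1 - (k%:R * (y + B%:R) + 1)| < e) = (`|x - y| < e / k%:R).
  have -> : k%:R * (x + B%:R) + 1 - (k%:R * (y + B%:R) + 1) = (x - y) * k%:R by ring.
  by rewrite normrM (gtr0_norm k0') ltr_pdivlMr.
by rewrite /near2 /= !E.
Qed.

Let bounded : exists B : nat, forall u v t, edge u v -> 0 <= t <= 1 ->
  `|(arc u v t).1| <= B%:R /\ `|(arc u v t).2| <= B%:R.
Proof.
have [|B hB] := @fin_eventually (G * G)%type (fun x B => edge x.1 x.2 -> forall t, 0 <= t <= 1 ->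
  `|(arc x.1 x.2 t).1| <= B%:R /\ `|(arc x.1 x.2 t).2| <= B%:R).
  case=> u v /=; have [uv|] := boolP (edge u v); last by exists 0%N.
  have [B hB] := curve_bounded ler01 (arc_within uv).
  exists (Num.truncn B).+1 => m mB _ t t01.
  have Bm : B <= m%:R by apply: le_trans (ltW (truncnS_gt B)) _; rewrite ler_nat.
  by have [h1 h2] := hB t t01; split; apply: le_trans Bm.
by exists B => u v t uv; apply: (hB _ (leqnn B) (u, v)).
Qed.

(** Pieces sharing a corner are within [2 / k] of each other before scaling. For large [k] this
    happens only to pieces that meet, as there are finitely many pairs. *)
Let apart : exists2 k : nat, (0 < k)%N & forall u v b x y c s t, edge u v -> edge x y ->
   lo b <= s <= hi b -> lo c <= t <= hi c -> near2 (2 / k%:R) (arc u v s) (arc x y t) ->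
   exists s' t', [/\ lo b <= s' <= hi b, lo c <= t' <= hi c & arc u v s' = arc x y t'].
Proof.
have [|k hk] := @fin_eventually ((G * G * bool) * (G * G * bool))%type (fun z k => 
  let: ((u, v, b), (x, y, c)) := z in (0 < k)%N /\ forall s t, edge u v -> edge x y ->
   lo b <= s <= hi b -> lo c <= t <= hi c -> near2 (2 / k%:R) (arc u v s) (arc x y t) ->
   exists s' t', [/\ lo b <= s' <= hi b, lo c <= t' <= hi c & arc u v s' = arc x y t']).
  case=> [[[u v] b] [[x y] c]].
  have [uv|nuv] := boolP (edge u v); last by exists 1%N => m m1; split=> // s t.
  have [xy|nxy] := boolP (edge x y); last by exists 1%N => m m1; split=> // s t _.
  have [ex|nex] := pselect (exists s' t', [/\ lo b <= s' <= hi b, lo c <= t' <= hi c & arc u v s' = arc x y t']).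
    by exists 1%N => m m1; split=> // *.
  have W u' v' b' : edge u' v' -> forall t, lo b' <= t <= hi b' -> forall e, 0 < e ->
     exists2 d, 0 < d & forall s, lo b' <= s <= hi b' -> `|t - s| < d -> near2 e (arc u' v' t) (arc u' v' s).
    move=> uv' t /lohi01 t01 e e0; have [d d0 hd] := arc_within uv' t01 e0.
    by exists d => // s /lohi01; exact: hd.
  have [|e e0 he] := curves_apart (lohi b) (W _ _ b uv) (lohi c) (W _ _ c xy).
    by move=> s t sb tc E; apply: nex; exists s, t.
  exists (Num.truncn (2 / e)).+1 => m km; split; first exact: leq_trans km.
  move=> s t _ _ sb tc near; case/negP: (he s t sb tc); apply: near2_le near.
  have m0 : 0 < m%:R :> R by rewrite ltr0n (leq_trans _ km).
  rewrite ler_pdivrMr // mulrC -ler_pdivrMr //; apply: le_trans (ltW (truncnS_gt _)) _.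
  by rewrite ler_nat.
exists k.+1 => // u v b x y c s t.
by have [_] := hk _ (leqnSn k) ((u, v, b), (x, y, c)); apply.
Qed.

Lemma drawing_pieces : exists n (S : G -> pt -> Prop) (M : G -> G -> pt -> Prop),
  [/\ forall u p q, S u p -> S u q -> reach (S u) p q,
      forall u v p q, edge u v -> M u v p -> M u v q -> reach (M u v) p q,
      forall u v, edge u v -> (exists p, S u p /\ M u v p) /\ (exists p, S v p /\ M u v p) &
  [/\ forall u v p, S u p -> S v p -> u = v,
      forall u v w p, edge u v -> S w p -> M u v p -> w = u \/ w = v,
      forall u v x y p, edge u v -> edge x y -> M u v p -> M x y p -> (u = x /\ v = y) \/ (u = y /\ v = x),
      forall u p, S u p -> (0 < p.1 < n.+1)%N && (0 < p.2 < n.+1)%N &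
      forall u v p, edge u v -> M u v p -> (0 < p.1 < n.+1)%N && (0 < p.2 < n.+1)%N]].
Proof.
have [B hB] := bounded; have [k k0 hk] := apart.
have k0' : 0 < k%:R :> R by rewrite ltr0n.
pose F u v t := scale k B (arc u v t).
pose K u v b (p : pt) := exists2 t, lo b <= t <= hi b & corner (F u v t) p.
have Fpos u v t : edge u v -> 0 <= t <= 1 -> 
    1 <= (F u v t).1 <= (2 * k * B)%:R + 1 /\ 1 <= (F u v t).2 <= (2 * k * B)%:R + 1.
  have aux (x : R) : `|x| <= B%:R -> 1 <= k%:R * (x + B%:R) + 1 <= (2 * k * B)%:R + 1.
    rewrite ler_norml => /andP[x1 x2]; rewrite lerDr lerD2r pmulr_rge0 //; apply/andP; split; first by lra.
    by rewrite (mulnC 2) -mulnA natrM ler_pM2l // mul2n -addnn natrD lerD2r.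
  by move=> uv t01; have [h1 h2] := hB u v t uv t01; split; exact: aux.
have Fpos0 u v b : edge u v -> forall t, lo b <= t <= hi b -> 0 <= (F u v t).1 /\ 0 <= (F u v t).2.
  by move=> uv t /lohi01 t01; have [/andP[h1 _] /andP[h2 _]] := Fpos u v t uv t01; split; lra.
have K_reach u v b p q : edge u v -> K u v b p -> K u v b q -> reach (K u v b) p q.
  move=> uv; apply: (curve_reach (lohi b) (Fpos0 _ _ _ uv)).
  move=> t /lohi01 tb e e0; have [|d d0 hd] := arc_within uv tb (_ : 0 < e / k%:R).
    by rewrite divr_gt0.
  by exists d => // s /lohi01 sb ts; rewrite /F scale_near //; exact: hd.
have K_in u v b p : edge u v -> K u v b p -> (0 < p.1 < (2 * k * B + 1).+1)%N && (0 < p.2 < (2 * k * B + 1).+1)%N.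
  have aux (x : R) m : 1 <= x <= (2 * k * B)%:R + 1 -> `|x - m%:R| < 1 -> (0 < m < (2 * k * B + 1).+1)%N.
    move=> /andP[x1 x2]; rewrite ltr_norml => /andP[y1 y2].
    by rewrite -(ltr_nat R) -(ltr_nat R m) -!natr1 natrD; apply/andP; split; lra.
  move=> uv [t /lohi01 t01 /andP[c1 c2]]; have [h1 h2] := Fpos u v t uv t01.
  by rewrite (aux _ _ h1 c1) (aux _ _ h2 c2).
have K_meet u v b x y c p : edge u v -> edge x y -> K u v b p -> K x y c p ->
    exists s t, [/\ lo b <= s <= hi b, lo c <= t <= hi c & arc u v s = arc x y t].
  move=> uv xy [s sb cs] [t tc ct]; apply: (hk _ _ _ _ _ _ s t) => //.
  rewrite -(scale_near B) //; rewrite /corner near2C in ct.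
  by apply: near2_trans cs _; exact: ct.
have K_arc u v t : edge u v -> 0 <= t <= 1 -> exists p, corner (F u v t) p.
  by move=> uv t01; have [/andP[h1 _] /andP[h2 _]] := Fpos u v t uv t01; apply: corner_ex; lra.
(* The star of [u] is the union of the first thirds of its arcs; it is empty for an isolated vertex,
   which the grid argument allows. *)
exists (2 * k * B + 1)%N, (fun u p => exists2 v, edge u v & K u v false p), (fun u v => K u v true); split.
- move=> u p q [v uv Kp] [w uw Kq].
  have [|r cr] := K_arc u v 0 uv; first by rewrite lexx ler01.
  have t0 : lo false <= 0 <= hi false by rewrite lexx /hi /= invr_ge0 ler0n.
  have Kv : K u v false r by exists 0.
  have Kw : K u w false r by exists 0 => //; move: cr; rewrite /F (arc_start PD uv) (arc_start PD uw).
  apply: reach_trans (reach_sub _ (K_reach _ _ _ _ _ uv Kp Kv)) (reach_sub _ (K_reach _ _ _ _ _ uw Kw Kq)).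
    by move=> x Kx; exists v.
  by move=> x Kx; exists w.
- by move=> u v p q uv; exact: K_reach.
- move=> u v uv; split.
    have [|p cp] := K_arc u v 3^-1 uv; first by apply/andP; split; lra.
    exists p; split; first exists v => //; exists 3^-1 => //; rewrite /lo /hi; apply/andP; split; lra.
  have [|p cp] := K_arc u v (2 / 3) uv; first by apply/andP; split; lra.
  exists p; split; last by exists (2 / 3) => //; rewrite /lo /hi; apply/andP; split; lra.
  exists u; first by rewrite edge_sym.
  exists 3^-1; first by rewrite /lo /hi; apply/andP; split; lra.
  rewrite /F (arc_rev PD _ uv); have -> // : 1 - 3^-1 = 2 / 3 :> R by lra.
split.
(* First thirds meet only at a common start or on the same arc: on reversed arcs the two parameters
   would have sum 1, but both are at most 1/3. *)
- move=> u v p [a ua Ku] [b vb Kv]; have [s [t [s1 t1 E]]] := K_meet _ _ _ _ _ _ _ ua vb Ku Kv.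
  have [[]//|[_ _ [[]//|[_ _ st]]]] := arc_meet ua vb (lohi01' s1) (lohi01' t1) E.
  by move: s1 t1; rewrite /lo /hi => /andP[s0 s1] /andP[t0 t1]; exfalso; lra.
- move=> u v w p uv [a wa Kw] Kp; have [s [t [s1 t1 E]]] := K_meet _ _ _ _ _ _ _ wa uv Kw Kp.
  have [[_ t0 _]|[_ _ [[]|[]]]] := arc_meet wa uv (lohi01' s1) (lohi01' t1) E; [|by left|by right].
  by move: t1; rewrite t0 /lo /hi => /andP[h1 h2]; exfalso; lra.
- move=> u v x y p uv xy Ku Kx; have [s [t [s1 t1 E]]] := K_meet _ _ _ _ _ _ _ uv xy Ku Kx.
  have [[_ t0 _]|[_ _ [[]|[]]]] := arc_meet uv xy (lohi01' s1) (lohi01' t1) E; [|by left|by right].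
  by move: t1; rewrite t0 /lo /hi => /andP[h1 h2]; exfalso; lra.
- by move=> u p [v uv]; exact: K_in.
- by move=> u v p; exact: K_in.
Qed.

End Drawing.
End Real.

Theorem corollary5 (R : realType) (G C : sgraph) (v1 v2 : G) (c1 c2 : C)
    (G_planar : planar R G) (G_girth : girth_at_least G 10)
    (C_cycle5 : is_cycle_graph C 5) :
  (exists psi : G -> C, homomorphism psi /\ psi v1 = c1 /\ psi v2 = c2) <->
  plausible v1 v2 c1 c2.
Proof.
case: G_planar => pos [arc PD].
have [n [S [M [S_conn M_conn SM12 [SS SM MM S_in M_in]]]]] := drawing_pieces PD.
have [D [D_in D_conn D_disj D_adj]] := minor_of_pieces S_conn M_conn
  (fun u v e => (SM12 u v e).1) (fun u v e => (SM12 u v e).2) SS SM MM S_in M_in.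
apply: coloring_criterion C_cycle5 => A A0.
exact: grid_minor_sparse D_in D_conn D_disj D_adj G_girth A0.
Qed.
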